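(* Let $\Omega$ be a bounded domain in $\mathbb{C}^d$ satisfying properties (1) and (2) below, and let $\Phi:\Omega\to\mathbb{C}^d$ be holomorphic on $\overline\Omega$ with $\Phi(\Omega)$ having an interior point. Then for every $\varepsilon>0$ there is a domain $\widehat\Omega$ satisfying properties (1) and (2) with $\widehat\Omega\,\Delta\,\Omega\subseteq O(\partial\Omega,\varepsilon)$ such that $\mathcal{V}^*(\Phi,\widehat\Omega)$ is trivial, i.e. equals $\mathbb{C}I$ (here $\Phi$ is regarded as its holomorphic extension to a neighborhood of $\overline\Omega$ containing $\widehat\Omega$).
   Context: ''Holomorphic on $\overline\Omega$'' means holomorphic on an open neighborhood of $\overline\Omega$. $\widehat\Omega\,\Delta\,\Omega$ is the symmetric difference and $O(\partial\Omega,\varepsilon)$ the $\varepsilon$-neighborhood of $\partial\Omega$. For a domain $D$ and $\Phi=(\phi_1,\dots,\phi_d)$ bounded holomorphic on $D$, $\mathcal{V}^*(\Phi,D)$ is the von Neumann algebra of all bounded operators on the Bergman space $L^2_a(D)$ commuting with each $M_{\phi_j,D}f=\phi_jf$ and its adjoint. Property (1): the boundary has Lebesgue measure zero. Property (2): for every boundary point $\zeta$ and every open neighborhood $\mathcal O$ of $\zeta$, $\mathcal O$ minus the domain contains an open ball. *)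

(* Defs.v *)
From HB Require Import structures.
From mathcomp Require Import all_boot all_order all_algebra.
From mathcomp Require Import all_classical all_reals all_analysis.
From mathcomp.real_closed Require Import complex.
Import Order.TTheory GRing.Theory Num.Theory.
Import numFieldNormedType.Exports.

Set Implicit Arguments.
Unset Strict Implicit.
Unset Printing Implicit Defensive.

Local Open Scope ring_scope.
Local Open Scope classical_set_scope.

Notation Cx R := ((complex R)^o).
Definition Cd (R : realType) (d : nat) := 'rV[Cx R]_d.

Section Defs.
Variables (R : realType) (d : nat).
Local Notation C := (Cx R).
Local Notation Cd := (Cd R d).

Definition sqmod (z : C) : R := (complex.Re z) ^+ 2 + (complex.Im z) ^+ 2.

Definition edist (z w : Cd) : R := Num.sqrt (\sum_(j < d) sqmod (z 0 j - w 0 j)).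
Definition eball (z : Cd) (r : R) : set Cd := [set w | edist z w < r].

Definition is_domain (D : set Cd) : Prop := open D /\ connected D /\ D !=set0.
Definition bounded_dom (D : set Cd) : Prop :=
  exists M : R, forall z, D z -> edist z 0 <= M.
Definition boundary (D : set Cd) : set Cd := closure D `\` interior D.
Definition eps_nbhd (S : set Cd) (eps : R) : set Cd :=
  [set z | exists2 b, S b & edist z b < eps].

Definition box := (('I_d -> R) * ('I_d -> R) * ('I_d -> R) * ('I_d -> R))%type.
Definition box_set (B : box) : set Cd :=
  let: (a, b, c, e) := B in
  [set z | forall j, a j <= complex.Re (z 0 j) < b j /\ c j <= complex.Im (z 0 j) < e j].
Definition vol (B : box) : R :=
  let: (a, b, c, e) := B in
  \prod_(j < d) (Num.max 0 (b j - a j) * Num.max 0 (e j - c j)).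

Definition lebesgue_null (A : set Cd) : Prop :=
  forall eps : R, 0 < eps -> exists B : nat -> box,
    A `<=` \bigcup_k box_set (B k) /\ forall n, \sum_(k < n) vol (B k) <= eps.

Definition property1 (D : set Cd) : Prop := lebesgue_null (boundary D).

Definition property2 (D : set Cd) : Prop :=
  forall zeta, boundary D zeta -> forall O : set Cd, open O -> O zeta ->
    exists w r, 0 < r /\ eball w r `<=` O `\` D.

(* holomorphy on an open set: continuous and complex differentiable in each
   variable separately (equivalent to the usual notion by Osgood's lemma) *)
Definition holomorphic_on (U : set Cd) (f : Cd -> C) : Prop :=
  forall z, U z -> {for z, continuous f} /\
    forall j : 'I_d, derivable (fun w : C => f (z + w *: 'e_j)) 0 1.

(* Lebesgue integral over an open set D of a nonnegative continuous function,
   as the supremum of lower sums over finite disjoint families of boxes in D *)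
Definition lower_sum (g : Cd -> R) (s : seq box) : \bar R :=
  (\sum_(B <- s) (vol B)%:E * ereal_inf [set (g z)%:E | z in box_set B])%E.
Definition admissible (D : set Cd) (s : seq box) : Prop :=
  (forall B, B \in s -> box_set B `<=` D) /\
  (forall i j, (i < size s)%N -> (j < size s)%N -> i <> j ->
     box_set (nth (0, 0, 0, 0) s i) `&` box_set (nth (0, 0, 0, 0) s j) = set0).
Definition integral_open (D : set Cd) (g : Cd -> R) : \bar R :=
  ereal_sup [set lower_sum g s | s in admissible D].

(* Bergman space L^2_a(D): holomorphic on D and square integrable on D
   (functions are identified when they agree on D) *)
Definition sqnorm (D : set Cd) (f : Cd -> C) : \bar R :=
  integral_open D (fun z => sqmod (f z)).
Definition bergman (D : set Cd) (f : Cd -> C) : Prop :=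
  holomorphic_on D f /\ (sqnorm D f < +oo)%E.

(* inner product <f, g> = int_D f conj(g), via the polarization identity *)
Definition inner (D : set Cd) (f g : Cd -> C) : C :=
  4%:R^-1 * \sum_(k < 4)
     ('i ^+ k * (fine (sqnorm D (fun z => f z + 'i ^+ k * g z)))%:C)%C.

Definition bounded_op (D : set Cd) (T : (Cd -> C) -> (Cd -> C)) : Prop :=
  [/\ forall f, bergman D f -> bergman D (T f),
      forall f g, bergman D f -> bergman D g -> (forall z, D z -> f z = g z) ->
        forall z, D z -> T f z = T g z,
      forall (a : C) f g, bergman D f -> bergman D g ->
        forall z, D z -> T (fun x => a * f x + g x) z = a * T f z + T g z
    & exists c : R, forall f, bergman D f -> (sqnorm D (T f) <= c%:E * sqnorm D f)%E].

Definition adjoint_mult (D : set Cd) (phi : Cd -> C) (f h : Cd -> C) : Prop :=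
  bergman D h /\
  forall g, bergman D g -> inner D (fun x => phi x * g x) f = inner D g h.

(* V^*(Phi, D): bounded operators commuting with every M_{phi_j} and M_{phi_j}^* *)
Definition in_Vstar (Phi : 'I_d -> Cd -> C) (D : set Cd)
    (T : (Cd -> C) -> (Cd -> C)) : Prop :=
  bounded_op D T /\ forall j : 'I_d,
    (forall f, bergman D f -> forall z, D z ->
        T (fun x => Phi j x * f x) z = Phi j z * T f z) /\
    (forall f h, bergman D f -> adjoint_mult D (Phi j) f h ->
        adjoint_mult D (Phi j) (T f) (T h)).

Definition Vstar_trivial (Phi : 'I_d -> Cd -> C) (D : set Cd) : Prop :=
  forall T, in_Vstar Phi D T ->
    exists c : C, forall f, bergman D f -> forall z, D z -> T f z = c * f z.

End Defs.

(* Main.v *)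
(* Take for Omegah a finite union of open cubes inside Omega, with generic radii so that the
   boundary is a null set seen from outside through balls, covering the part of Omega far from its
   boundary together with a polyline leading to a small cube on which Phi is injective.  By the
   maximum principle and a Sard-type counting argument this cube and a point la in it can be
   chosen so that Phi(la) stays away from the values of Phi on the rest of Omegah.
   For T in V^*(Phi, Omegah) and g in the Bergman space, <T f, g> = <f, T^* g> still holds after
   inserting powers of p = 1 - k sum_j |phi_j - phi_j(mu)|^2, which peak at mu only when mu is near
   la.  Hence T f conj(g) = f conj(T^* g) pointwise near la; with g = 1 this gives T f = f T1 with
   T1 both holomorphic and antiholomorphic, so T1 is constant near la and T f = c f on Omegah by
   the identity theorem. *)
Require Import Defs.
From HB Require Import structures.
From mathcomp Require Import all_boot all_order all_algebra.
From mathcomp Require Import all_classical all_reals all_analysis.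
From mathcomp.real_closed Require Import complex.
From mathcomp Require Import ring lra zify.
Import Order.TTheory GRing.Theory Num.Theory.
Import numFieldNormedType.Exports.
Import Normc.
Import Defs.
Set Implicit Arguments.
Unset Strict Implicit.
Unset Printing Implicit Defensive.
Local Open Scope ring_scope.
Local Open Scope classical_set_scope.

(** * Norms and compactness in C^d *)

Section ComplexNorm.
Variable R : realType.
Local Notation C := (Cx R).
Implicit Types z w : C.

(** Distinct points with the same value of Phi are what could support operators other than scalars,
    so Omegah must own an open set of values that Phi takes only once, with a gap to its values
    elsewhere. On the core the gap is forced by raising the modulus of one coordinate of Phi above
    its maximum there; this is possible because Phi(Omega) has interior, so that no coordinate is
    constant. The polyline that restores connectedness may run through the same values again, but
    its image has real dimension one, and [la] can be moved off it. Powers of [p] may be inserted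
    because [p] is a polynomial in the phi_j - phi_j(mu) and their conjugates: holomorphic factors
    pass through T, conjugate ones through its adjoint. The integral is a supremum of lower sums
    over boxes and adjoints are relations between functions, so additivity of the integral,
    completeness of the Bergman space and the Riesz representation are all derived here. Squares and
    cubes replace discs and balls throughout, since they fit these boxes. As Omegah lies inside
    Omega, only points of Omega near its boundary are lost. *)

Lemma normc_ge0 z : 0 <= normc z.
Proof. by case: z => a b; exact: sqrtr_ge0. Qed.

Lemma normc_sqr z : normc z ^+ 2 = complex.Re z ^+ 2 + complex.Im z ^+ 2.
Proof. by case: z => a b /=; rewrite sqr_sqrtr // addr_ge0 ?sqr_ge0. Qed.

Lemma sqmodE z : sqmod z = normc z ^+ 2.
Proof. by rewrite normc_sqr. Qed.

Lemma normc_Re z : `|complex.Re z| <= normc z.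
Proof.
rewrite -(ler_pXn2r (n:=2)) ?nnegrE ?normc_ge0 // normc_sqr real_normK ?num_real //.
by rewrite lerDl sqr_ge0.
Qed.

Lemma normc_Im z : `|complex.Im z| <= normc z.
Proof.
rewrite -(ler_pXn2r (n:=2)) ?nnegrE ?normc_ge0 // normc_sqr real_normK ?num_real //.
by rewrite lerDr sqr_ge0.
Qed.

Lemma normc_le_ReIm z : normc z <= `|complex.Re z| + `|complex.Im z|.
Proof.
rewrite -(ler_pXn2r (n:=2)) ?nnegrE ?normc_ge0 ?addr_ge0 // normc_sqr.
have := @normr_ge0 _ _ (complex.Re z); have := @normr_ge0 _ _ (complex.Im z).
rewrite -(real_normK (num_real (complex.Re z))) -(real_normK (num_real (complex.Im z))).
by nra.
Qed.

Lemma normcB_sym z w : normc (z - w) = normc (w - z).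
Proof. by rewrite -normcN opprB. Qed.

Lemma normcB_tri z w : normc z <= normc (z - w) + normc w.
Proof. by rewrite -{1}[z](subrK w) le_normcD. Qed.

Lemma normcR (a : R) : normc (a%:C)%C = `|a|.
Proof. by rewrite /= expr0n addr0 sqrtr_sqr. Qed.

Lemma normcX z n : normc (z ^+ n) = normc z ^+ n.
Proof.
elim: n => [|n IH]; first by rewrite !expr0 normc1.
by rewrite !exprS normcM IH.
Qed.

Lemma normc_eq0 z : (normc z == 0) = (z == 0).
Proof.
apply/eqP/eqP => [/eq0_normc //|->]; exact: normc0.
Qed.

Lemma normc_gt0 z : (0 < normc z) = (z != 0).
Proof. by rewrite lt_def normc_ge0 normc_eq0 andbT. Qed.

Lemma normc_sum I (r : seq I) (P : pred I) (F : I -> C) :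
  normc (\sum_(i <- r | P i) F i) <= \sum_(i <- r | P i) normc (F i).
Proof.
elim/big_ind2 : _ => //; first by rewrite normc0.
by move=> x1 x2 y1 y2 h1 h2; apply: le_trans (le_normcD _ _) _; exact: lerD.
Qed.

Lemma normc_conj z : normc (z^*)%C = normc z.
Proof. by case: z => a b /=; rewrite sqrrN. Qed.

(** The sup norm of the real plane: its balls are squares, the shape of both the contours of
    Cauchy's formula and the boxes of the integral. *)
Definition cmax z : R := Num.max `|complex.Re z| `|complex.Im z|.

Lemma cmax_ge0 z : 0 <= cmax z.
Proof. by rewrite /cmax le_max normr_ge0. Qed.

Lemma cmax_lt z r : (cmax z < r) = (`|complex.Re z| < r) && (`|complex.Im z| < r).
Proof. by rewrite /cmax gt_max. Qed.

Lemma cmax_le z r : (cmax z <= r) = (`|complex.Re z| <= r) && (`|complex.Im z| <= r).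
Proof. by rewrite /cmax ge_max. Qed.

Lemma cmax_normc z : cmax z <= normc z.
Proof. by rewrite cmax_le normc_Re normc_Im. Qed.

Lemma normc_cmax z : normc z <= 2 * cmax z.
Proof.
apply: le_trans (normc_le_ReIm z) _.
have /andP[h1 h2] : (`|complex.Re z| <= cmax z) && (`|complex.Im z| <= cmax z).
  by rewrite -cmax_le.
lra.
Qed.

Lemma ReD z w : complex.Re (z + w) = complex.Re z + complex.Re w.
Proof. by case: z; case: w. Qed.
Lemma ImD z w : complex.Im (z + w) = complex.Im z + complex.Im w.
Proof. by case: z; case: w. Qed.
Lemma ReN z : complex.Re (- z) = - complex.Re z.
Proof. by case: z. Qed.
Lemma ImN z : complex.Im (- z) = - complex.Im z.
Proof. by case: z. Qed.
Lemma ReM z w : complex.Re (z * w) =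
  complex.Re z * complex.Re w - complex.Im z * complex.Im w.
Proof. by case: z; case: w. Qed.
Lemma ImM z w : complex.Im (z * w) =
  complex.Re z * complex.Im w + complex.Im z * complex.Re w.
Proof. by case: z; case: w. Qed.

Lemma cmaxN z : cmax (- z) = cmax z.
Proof. by rewrite /cmax ReN ImN !normrN. Qed.

Lemma cmaxD z w : cmax (z + w) <= cmax z + cmax w.
Proof.
have := lexx (cmax z); rewrite {1}cmax_le => /andP[a b].
have := lexx (cmax w); rewrite {1}cmax_le => /andP[c e].
rewrite cmax_le ReD ImD; apply/andP; split; apply: le_trans (ler_normD _ _) _; exact: lerD.
Qed.

Lemma cmax0 : cmax 0 = 0.
Proof. by rewrite /cmax /= normr0 maxxx. Qed.

Lemma cmax_eq0 z : cmax z = 0 -> z = 0.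
Proof.
move=> h; apply: eq0_normc; apply/eqP; rewrite eq_le normc_ge0 andbT.
by rewrite (le_trans (normc_cmax z)) // h mulr0.
Qed.

Lemma nbhs_C z (A : set C) :
  nbhs z A <-> exists2 r : R, 0 < r & forall w, normc (w - z) < r -> A w.
Proof.
split => [/nbhs_ballP[e /= e0 h]|[r r0 h]]; last apply/nbhs_ballP.
  (* Radii of balls in [C] are themselves complex numbers; a positive one is real, and its real part
     serves as radius. *)
  have eR : e = (complex.Re e)%:C%C by rewrite RRe_real // ger0_real // ltW.
  exists (complex.Re e); first by move: e0; rewrite eR ltcR.
  move=> w hw; apply: h; rewrite -ball_normE /ball_ /= eR.
  rewrite distrC (normc_def (w - z)) ltcR.
  by move: hw; case: (w - z).
exists (r%:C)%C; first by rewrite /= ltcR.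
move=> w; rewrite -ball_normE /ball_ /= distrC (normc_def (w - z)) ltcR => hw.
apply: h; move: hw; case: (w - z) => a b //.
Qed.
End ComplexNorm.

Section PolyNorm.
Variables (R : realType) (d : nat).
Local Notation C := (Cx R).
Local Notation Cd := (Cd R d).
Implicit Types z w : Cd.

(** The norm used on C^d throughout: its balls are the cubes of which Omegah is built. Up to the
    factor [2 * d] it is equivalent to [edist]. *)
Definition qn z : R := \big[Num.max/0]_(j < d) cmax (z 0 j).

Lemma qn_ge0 z : 0 <= qn z.
Proof. by rewrite /qn bigmax_idl le_max lexx. Qed.

Lemma cmax_qn z j : cmax (z 0 j) <= qn z.
Proof. by rewrite /qn; exact: (le_bigmax _ (fun j => cmax (z 0 j))). Qed.

Lemma qn_leP z r : 0 <= r -> reflect (forall j, cmax (z 0 j) <= r) (qn z <= r).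
Proof.
move=> r0; apply: (iffP idP) => [h j|h]; first exact: le_trans (cmax_qn z j) h.
by rewrite /qn; apply/bigmax_leP; split.
Qed.

Lemma qn_ltP z r : 0 < r -> reflect (forall j, cmax (z 0 j) < r) (qn z < r).
Proof.
move=> r0; apply: (iffP idP) => [h j|h]; first exact: le_lt_trans (cmax_qn z j) h.
by rewrite /qn; apply/bigmax_ltP; split.
Qed.

Lemma qn0 : qn 0 = 0.
Proof. by apply/eqP; rewrite eq_le qn_ge0 andbT; apply/qn_leP => // j; rewrite mxE cmax0. Qed.

Lemma qnN z : qn (- z) = qn z.
Proof. by rewrite /qn; apply: eq_bigr => j _; rewrite mxE cmaxN. Qed.

Lemma qnB_sym z w : qn (z - w) = qn (w - z).
Proof. by rewrite -qnN opprB. Qed.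

Lemma qnD z w : qn (z + w) <= qn z + qn w.
Proof.
apply/qn_leP => [|j]; first by rewrite addr_ge0 ?qn_ge0.
by rewrite mxE; apply: le_trans (cmaxD _ _) _; rewrite lerD ?cmax_qn.
Qed.

Lemma qn_tri z1 z2 z3 : qn (z1 - z3) <= qn (z1 - z2) + qn (z2 - z3).
Proof. by rewrite (_ : z1 - z3 = (z1 - z2) + (z2 - z3)) ?qnD // addrA subrK. Qed.

Lemma qn_eq0 z : qn z = 0 -> z = 0.
Proof.
move=> h; apply/rowP => j; rewrite mxE; apply: cmax_eq0.
by apply/eqP; rewrite eq_le cmax_ge0 andbT -h cmax_qn.
Qed.

Lemma normc_qn z j : normc (z 0 j) <= 2 * qn z.
Proof. by apply: le_trans (normc_cmax _) _; rewrite ler_pM2l // cmax_qn. Qed.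

Lemma qn_delta (a : C) j : qn (a *: 'e_j) = cmax a.
Proof.
apply/eqP; rewrite eq_le; apply/andP; split.
  apply/qn_leP => [|k]; first exact: cmax_ge0.
  rewrite !mxE eqxx /=; case: (k == j); rewrite ?mulr1 // mulr0 cmax0; exact: cmax_ge0.
by apply: le_trans (cmax_qn _ j); rewrite !mxE !eqxx mulr1.
Qed.

Lemma nbhs_Cd z (A : set Cd) :
  nbhs z A <-> exists2 r : R, 0 < r & forall w, qn (w - z) < r -> A w.
Proof.
split => [/nbhs_ballP[e /= e0 h]|[r r0 h]]; last apply/nbhs_ballP.
  have eR : e = (complex.Re e)%:C%C by rewrite RRe_real // ger0_real // ltW.
  have e0' : 0 < complex.Re e by move: e0; rewrite eR ltcR.
  exists (complex.Re e / 2); first by rewrite divr_gt0.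
  move=> w hw; apply: h; split => // i j; rewrite ord1 -ball_normE /ball_ /= eR.
  rewrite distrC (normc_def (w 0 j - z 0 j)) ltcR.
  suff : normc (w 0 j - z 0 j) < complex.Re e by case: (w 0 j - z 0 j).
  have := normc_qn (w - z) j; rewrite !mxE; lra.
exists (r%:C)%C; first by rewrite /= ltcR.
move=> w [_ hw]; apply: h; apply/qn_ltP => // j; rewrite !mxE.
apply: le_lt_trans (cmax_normc _) _.
have := hw 0 j; rewrite -ball_normE /ball_ /= distrC (normc_def (w 0 j - z 0 j)) ltcR.
by case: (w 0 j - z 0 j).
Qed.

Lemma open_Cd (A : set Cd) : open A <->
  forall z, A z -> exists2 r : R, 0 < r & forall w, qn (w - z) < r -> A w.
Proof.
rewrite openE; split => h z Az; first by have /nbhs_Cd := h z Az.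
by apply/nbhs_Cd; exact: h.
Qed.

Lemma interior_Cd (A : set Cd) z : interior A z <->
  exists2 r : R, 0 < r & forall w, qn (w - z) < r -> A w.
Proof. exact: nbhs_Cd. Qed.

Lemma closure_Cd (A : set Cd) z : closure A z <->
  forall r : R, 0 < r -> exists2 w, A w & qn (w - z) < r.
Proof.
split => [h r r0|h B /nbhs_Cd[r r0 hB]].
  have /h[w [Aw Bw]] : nbhs z [set w | qn (w - z) < r] by apply/nbhs_Cd; exists r.
  by exists w.
by have [w Aw hw] := h r r0; exists w; split => //; exact: hB.
Qed.

Lemma continuous_CdC (f : Cd -> C) z : {for z, continuous f} <->
  forall e : R, 0 < e -> exists2 r : R, 0 < r &
    forall w, qn (w - z) < r -> normc (f w - f z) < e.
Proof.
split => [h e e0|h A /nbhs_C[e e0 hA]].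
  have : nbhs (f z) [set y | normc (y - f z) < e] by apply/nbhs_C; exists e.
  by move=> /h /nbhs_Cd.
have [r r0 hr] := h e e0; apply/nbhs_Cd; exists r => // w /hr; exact: hA.
Qed.

Lemma continuous_CdR (f : Cd -> R) z : {for z, continuous f} <->
  forall e : R, 0 < e -> exists2 r : R, 0 < r &
    forall w, qn (w - z) < r -> `|f w - f z| < e.
Proof.
split => [h e e0|h A /nbhs_ballP[e /= e0 hA]].
  have : nbhs (f z) [set y | `|y - f z| < e].
    by apply/nbhs_ballP; exists e => //= y; rewrite -ball_normE /= distrC.
  by move=> /h /nbhs_Cd.
have [r r0 hr] := h e e0; apply/nbhs_Cd; exists r => // w /hr hw.
by apply: hA; rewrite -ball_normE /= distrC.
Qed.

Lemma edist_le z w : edist z w <= 2 * d%:R * qn (z - w).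
Proof.
rewrite /edist -(ler_pXn2r (n:=2)) ?nnegrE ?sqrtr_ge0 ?mulr_ge0 ?qn_ge0 // sqr_sqrtr.
  apply: (@le_trans _ _ (\sum_(j < d) (2 * qn (z - w)) ^+ 2)).
    apply: ler_sum => j _; rewrite sqmodE ler_pXn2r ?nnegrE ?normc_ge0 ?mulr_ge0 ?qn_ge0 //.
    by have := normc_qn (z - w) j; rewrite !mxE.
  rewrite sumr_const card_ord -[leLHS]mulr_natl.
  have -> : (2 * d%:R * qn (z - w)) ^+ 2 = d%:R * (d%:R * (2 * qn (z - w)) ^+ 2) by ring.
  have := sqr_ge0 (2 * qn (z - w)); move: (_ ^+ 2) => S S0.
  by case: (d) => [|n]; [rewrite !mul0r|rewrite ler_wpM2l // ler_peMl // ler1n].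
by apply: sumr_ge0 => j _; rewrite sqmodE sqr_ge0.
Qed.

Lemma qn_le_edist z w : qn (z - w) <= edist z w.
Proof.
apply/qn_leP => [|j]; first exact: sqrtr_ge0.
apply: le_trans (cmax_normc _) _.
rewrite -(ler_pXn2r (n:=2)) ?nnegrE ?sqrtr_ge0 ?normc_ge0 // /edist sqr_sqrtr.
  rewrite -sqmodE !mxE (bigD1 j) //= lerDl.
  by apply: sumr_ge0 => i _; rewrite sqmodE sqr_ge0.
by apply: sumr_ge0 => i _; rewrite sqmodE sqr_ge0.
Qed.

(** A square is the continuous image of a product of two segments, hence compact; row vectors with
    entries in it form a compact set, of which the cube is a closed subset. *)
Lemma compact_cube (r : R) : compact [set z : Cd | qn z <= r].
Proof.
pose f (p : R * R) : C := (p.1 +i* p.2)%C.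
have cf : continuous f.
  move=> p A /nbhs_C[e e0 hA]; apply/nbhs_ballP; exists (e / 2) => /=; first by rewrite divr_gt0.
  move=> q [/= h1 h2]; apply: hA; apply: le_lt_trans (normc_le_ReIm _) _ => /=.
  move: h1 h2; rewrite -!ball_normE /= distrC [`|p.2 - _|]distrC => h1 h2.
  rewrite [e](splitr e); exact: ltrD.
have cS : compact (f @` (`[-r, r] `*` `[-r, r])).
  apply: continuous_compact; last by apply: compact_setX; exact: segment_compact.
  by apply: continuous_subspaceT.
have := @rV_compact _ d _ (fun=> cS); move=> cR; apply: (subclosed_compact _ cR) => [|z /= hz i].
  apply/closure_id; rewrite eqEsubset; split=> [|z]; first exact: subset_closure.
  move=> /closure_Cd h /=; rewrite leNgt; apply/negP => rz.
  have [w /= wr wz] := h (qn z - r) ltac:(by rewrite subr_gt0).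
  have := qnD (z - w) w; rewrite subrK qnB_sym; move: wr wz; lra.
have := le_trans (cmax_qn z i) hz; rewrite cmax_le !ler_norml => /andP[h1 h2].
exists (complex.Re (z 0 i), complex.Im (z 0 i)); first by split; rewrite /= in_itv.
by rewrite /f; case: (z 0 i).
Qed.

Lemma closed_bounded_compact (A : set Cd) (M : R) :
  closed A -> (forall z, A z -> qn z <= M) -> compact A.
Proof. by move=> cA AM; apply: (subclosed_compact cA (@compact_cube M)) => z /AM. Qed.

Lemma closed_Cd (A : set Cd) : closed A <->
  forall z, (forall r : R, 0 < r -> exists2 w, A w & qn (w - z) < r) -> A z.
Proof.
split => [cA z /closure_Cd|h z /closure_Cd]; [exact: cA|exact: h].
Qed.

Lemma compact_cube_at z (r : R) : compact [set w : Cd | qn (w - z) <= r].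
Proof.
apply: (@closed_bounded_compact _ (r + qn z)) => [|w /= h].
  apply/closed_Cd => w h /=; rewrite leNgt; apply/negP => rw.
  have [v /= vr vw] := h (qn (w - z) - r) ltac:(by rewrite subr_gt0).
  by have := qn_tri w v z; rewrite (qnB_sym w v); move: vr vw; lra.
by have := qnD (w - z) z; rewrite subrK; move: h; lra.
Qed.

Lemma compact_finite_cover (K : set Cd) (rho : Cd -> R) :
  compact K -> (forall z, K z -> 0 < rho z) ->
  exists2 s : seq Cd, (forall x, x \in s -> K x) &
    forall z, K z -> exists2 x, x \in s & qn (z - x) < rho x.
Proof.
rewrite compact_cover => cK rK.
have [z Kz|z Kz|D' sD' cov] := cK Cd K (fun x => [set z | qn (z - x) < rho x]).
- apply/open_Cd => w /= wz; exists (rho z - qn (w - z)); first by rewrite subr_gt0.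
  move=> v hv; have := qn_tri v w z; move: hv; lra.
- by exists z => //=; rewrite subrr qn0; exact: rK.
exists (finmap.enum_fset D') => [x xD|z /cov[x xD hx]]; first by have := sD' x xD; rewrite inE.
by exists x.
Qed.

Lemma finite_min (T : eqType) (s : seq T) (rho : T -> R) :
  (forall x, x \in s -> 0 < rho x) ->
  exists2 r : R, 0 < r & forall x, x \in s -> r <= rho x.
Proof.
elim: s => [|x s IH] h; first by exists 1.
have [y ys|r r0 hr] := IH; first by apply: h; rewrite inE ys orbT.
exists (Num.min (rho x) r); first by rewrite lt_min r0 h // inE eqxx.
move=> y; rewrite inE ge_min => /orP[/eqP ->|/hr ->]; rewrite ?lexx ?orbT //.
Qed.

(** Heine-Cantor with halved radii. Only [x] is confined to [K]; [y] may leave it, since continuity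
    is assumed in the full space at the points of [K]. *)
Lemma unif_continuous (K : set Cd) (g : Cd -> R) :
  compact K -> (forall z, K z -> {for z, continuous g}) ->
  forall e : R, 0 < e -> exists2 r : R, 0 < r &
    forall x y, K x -> qn (y - x) < r -> `|g y - g x| < e.
Proof.
move=> cK cg e e0.
have /choice[rho hrho] : forall z, exists r : R, 0 < r /\
    (K z -> forall w, qn (w - z) < r -> `|g w - g z| < e / 2).
  move=> z; have [Kz|nK] := pselect (K z); last by exists 1.
  have /continuous_CdR/(_ (e / 2)) := cg z Kz.
  by case=> [|r r0 hr]; [rewrite divr_gt0|exists r].
have [z _|s sK cov] := compact_finite_cover (rho := fun z => rho z / 2) cK.
  by rewrite divr_gt0 //; case: (hrho z).
have [z _|r r0 hr] := @finite_min _ s (fun z => rho z / 2).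
  by rewrite divr_gt0 //; case: (hrho z).
exists r => // x y /cov[z zs xz] yx.
have [_ /(_ (sK z zs)) hz] := hrho z; have := hr z zs.
have h1 : `|g x - g z| < e / 2 by apply: hz; have := hrho z; lra.
have h2 : `|g y - g z| < e / 2.
  by apply: hz; have := qn_tri y x z; have := hr z zs; lra.
move=> _; have := ler_distD (g z) (g y) (g x); rewrite (distrC (g z)); lra.
Qed.

Lemma compact_max (K : set Cd) (g : Cd -> R) :
  K !=set0 -> compact K -> (forall z, K z -> {for z, continuous g}) ->
  exists2 z, K z & forall w, K w -> g w <= g z.
Proof.
move=> K0 cK cg.
have [|z] := @compact_EVT_max _ _ g K K0 cK.
  by apply: continuous_in_subspaceT => z; rewrite inE; exact: cg.
by rewrite inE => Kz h; exists z => // w Kw; apply: h; rewrite inE.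
Qed.

Lemma compact_bound (K : set Cd) (g : Cd -> R) :
  compact K -> (forall z, K z -> {for z, continuous g}) ->
  exists2 M : R, 0 < M & forall z, K z -> g z <= M.
Proof.
move=> cK cg; have [[z0 Kz0]|K0] := pselect (K !=set0); last first.
  by exists 1 => // z Kz; case: K0; exists z.
have [z Kz h] := compact_max (ex_intro _ z0 Kz0) cK cg.
exists (Num.max 1 (g z)); first by rewrite lt_max ltr01.
by move=> w /h; rewrite le_max orbC => ->.
Qed.

Lemma compact_min_gt0 (K : set Cd) (g : Cd -> R) :
  compact K -> (forall z, K z -> {for z, continuous g}) ->
  (forall z, K z -> 0 < g z) -> exists2 m : R, 0 < m & forall z, K z -> m <= g z.
Proof.
move=> cK cg g0; have [[z0 Kz0]|K0] := pselect (K !=set0); last first.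
  by exists 1 => // z Kz; case: K0; exists z.
have [z Kz|z Kz h] := compact_max (g := fun z => - g z) (ex_intro _ z0 Kz0) cK.
  by apply: continuousN; exact: cg.
by exists (g z) => [|w /h]; [exact: g0|rewrite lerN2].
Qed.

Lemma continuous_normc (f : Cd -> C) z : {for z, continuous f} ->
  {for z, continuous (fun x => normc (f x))}.
Proof.
move=> /continuous_CdC cf; apply/continuous_CdR => e /cf[r r0 hr].
exists r => // w /hr; apply: le_lt_trans.
rewrite ler_norml; have := normcB_tri (f w) (f z); have := normcB_tri (f z) (f w).
by rewrite normcB_sym; lra.
Qed.
End PolyNorm.

(** * Integrals of continuous functions over a segment *)

Section RealIntegral.
Variable R : realType.
Implicit Types (u v : R -> R) (a b c : R).

Definition rint u a b : R := Rintegral (@lebesgue_measure R) `[a, b] u.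

Lemma continuous_integrable u a b :
  (forall t, a <= t <= b -> {for t, continuous u}) ->
  (@lebesgue_measure R).-integrable `[a, b] (EFin \o u).
Proof.
move=> cu; apply: continuous_compact_integrable; first exact: segment_compact.
by apply: continuous_in_subspaceT => t; rewrite inE /= in_itv; exact: cu.
Qed.

Lemma eq_rint u v a b : (forall t, a <= t <= b -> u t = v t) -> rint u a b = rint v a b.
Proof. by move=> uv; apply: eq_Rintegral => t; rewrite inE /= in_itv; exact: uv. Qed.

Lemma rintD u v a b : (forall t, a <= t <= b -> {for t, continuous u}) ->
  (forall t, a <= t <= b -> {for t, continuous v}) ->
  rint (fun t => u t + v t) a b = rint u a b + rint v a b.
Proof. by move=> cu cv; rewrite /rint RintegralD //; exact: continuous_integrable. Qed.

Lemma rintB u v a b : (forall t, a <= t <= b -> {for t, continuous u}) ->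
  (forall t, a <= t <= b -> {for t, continuous v}) ->
  rint (fun t => u t - v t) a b = rint u a b - rint v a b.
Proof. by move=> cu cv; rewrite /rint RintegralB //; exact: continuous_integrable. Qed.

Lemma rintZ k u a b : (forall t, a <= t <= b -> {for t, continuous u}) ->
  rint (fun t => k * u t) a b = k * rint u a b.
Proof. by move=> cu; rewrite /rint RintegralZl //; exact: continuous_integrable. Qed.

Lemma rint_cst k a b : a <= b -> rint (fun=> k) a b = k * (b - a).
Proof.
move=> ab; have e : fine (@lebesgue_measure R `[a, b]) = b - a.
  rewrite lebesgue_measure_itv /= lte_fin.
  by case: ltP => // ba; rewrite (_ : b = a) ?subrr //; apply/eqP; rewrite eq_le ba ab.
by rewrite -e; exact: Rintegral_cst.
Qed.

Lemma ler_rint u v a b : (forall t, a <= t <= b -> {for t, continuous u}) ->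
  (forall t, a <= t <= b -> {for t, continuous v}) ->
  (forall t, a <= t <= b -> u t <= v t) -> rint u a b <= rint v a b.
Proof.
move=> cu cv uv; apply: le_Rintegral => //; try exact: continuous_integrable.
Qed.

Lemma rint_abs u a b M : a <= b -> (forall t, a <= t <= b -> {for t, continuous u}) ->
  (forall t, a <= t <= b -> `|u t| <= M) -> `|rint u a b| <= M * (b - a).
Proof.
move=> ab cu uM; rewrite ler_norml -mulNr -!rint_cst //.
apply/andP; split.
  by apply: ler_rint => [t _|t ht|t /uM]; [exact: cst_continuous|exact: cu|rewrite ler_norml => /andP[]].
by apply: ler_rint => [t ht|t _|t /uM]; [exact: cu|exact: cst_continuous|rewrite ler_norml => /andP[]].
Qed.

Lemma rint_split u a c b : a <= c -> c <= b ->
  (forall t, a <= t <= b -> {for t, continuous u}) ->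
  rint u a b = rint u a c + rint u c b.
Proof.
move=> ac cb cu; have iu := continuous_integrable cu.
have := Rintegral_itvB iu (x := c); rewrite !bnd_simp => /(_ ac cb).
rewrite Rintegral_itv_obnd_cbnd; first by rewrite /rint => <-; rewrite addrC subrK.
by apply: integrableS iu => //; apply: subset_itvr; rewrite bnd_simp.
Qed.
End RealIntegral.

(** * Cauchy's formula on squares *)

Section ComplexIntegral.
Variable R : realType.
Local Notation C := (Cx R).
Implicit Types (f g : C -> C) (F G : R -> C) (z w : C) (a b c : R).
Local Notation Re := complex.Re.
Local Notation Im := complex.Im.

Definition ccont f z := forall e : R, 0 < e -> exists2 r : R, 0 < r &
  forall w, normc (w - z) < r -> normc (f w - f z) < e.

(** The derivative as a first order expansion, without quotients; [cdiffP] identifies the resulting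
    differentiability with [derivable]. *)
Definition cderiv f z (l : C) := forall e : R, 0 < e -> exists2 r : R, 0 < r &
  forall w, normc (w - z) < r -> normc (f w - f z - l * (w - z)) <= e * normc (w - z).

Definition cdiff f z := exists l, cderiv f z l.

Definition rccont F t := forall e : R, 0 < e -> exists2 r : R, 0 < r &
  forall s, `|s - t| < r -> normc (F s - F t) < e.

Lemma cdiff_ccont f z : cdiff f z -> ccont f z.
Proof.
move=> [l hl] e e0; have [r r0 hr] := hl 1 ltr01.
have l0 := normc_ge0 l.
exists (Num.min r (e / (1 + normc l))); first by rewrite lt_min r0 divr_gt0 // ltr_wpDr.
move=> w; rewrite lt_min => /andP[/hr h1]; rewrite ltr_pdivlMr ?ltr_wpDr // => h2.
have := normcB_tri (f w - f z) (l * (w - z)); rewrite normcM; lra.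
Qed.

Lemma rccont_Re F t : rccont F t -> {for t, continuous (fun s => Re (F s))}.
Proof.
move=> h A /nbhs_ballP[e /= e0 hA]; have [r r0 hr] := h e e0.
apply/nbhs_ballP; exists r => //= s; rewrite -ball_normE /= distrC => /hr hs.
apply: hA; rewrite -ball_normE /= distrC; apply: le_lt_trans hs.
by rewrite -ReN -ReD normc_Re.
Qed.

Lemma rccont_Im F t : rccont F t -> {for t, continuous (fun s => Im (F s))}.
Proof.
move=> h A /nbhs_ballP[e /= e0 hA]; have [r r0 hr] := h e e0.
apply/nbhs_ballP; exists r => //= s; rewrite -ball_normE /= distrC => /hr hs.
apply: hA; rewrite -ball_normE /= distrC; apply: le_lt_trans hs.
by rewrite -ImN -ImD normc_Im.
Qed.

Definition cint F a b : C := (rint (fun t => Re (F t)) a b +i* rint (fun t => Im (F t)) a b)%C.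

Definition rccontI F a b := forall t, a <= t <= b -> rccont F t.

Lemma eq_cint F G a b : (forall t, a <= t <= b -> F t = G t) -> cint F a b = cint G a b.
Proof. by move=> FG; rewrite /cint; congr Complex; apply: eq_rint => t /FG ->. Qed.

Lemma cintD F G a b : rccontI F a b -> rccontI G a b ->
  cint (fun t => F t + G t) a b = cint F a b + cint G a b.
Proof.
move=> cF cG; rewrite /cint.
rewrite (eq_rint (u := fun t => Re (F t + G t)) (v := fun t => Re (F t) + Re (G t)))=> [|t _]; last exact: ReD.
rewrite (eq_rint (u := fun t => Im (F t + G t)) (v := fun t => Im (F t) + Im (G t)))=> [|t _]; last exact: ImD.
rewrite rintD => [|t /cF|t /cG]; [|exact: rccont_Re|exact: rccont_Re].
by rewrite rintD => [|t /cF|t /cG]; [|exact: rccont_Im|exact: rccont_Im].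
Qed.

Lemma cintZ k F a b : rccontI F a b ->
  cint (fun t => k * F t) a b = k * cint F a b.
Proof.
move=> cF; case: k => x y; rewrite /cint.
have cR t : a <= t <= b -> {for t, continuous (fun s => Re (F s))} by move=> /cF; exact: rccont_Re.
have cI t : a <= t <= b -> {for t, continuous (fun s => Im (F s))} by move=> /cF; exact: rccont_Im.
have cM r (u : R -> R) : (forall t, a <= t <= b -> {for t, continuous u}) ->
  forall t, a <= t <= b -> {for t, continuous (fun s => r * u s)}.
  by move=> cu t /cu hu; apply: continuousM => //; exact: cst_continuous.
rewrite (eq_rint (v := fun t => x * Re (F t) - y * Im (F t)))=> [|t _]; last by rewrite ReM.
rewrite [X in Complex _ X](eq_rint (v := fun t => x * Im (F t) + y * Re (F t)))=> [|t _]; last by rewrite ImM.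
rewrite rintB; [|exact: cM|exact: cM].
rewrite rintD; [|exact: cM|exact: cM].
by rewrite !(rintZ _ cR) !(rintZ _ cI).
Qed.

Lemma cint_cst k a b : a <= b -> cint (fun=> k) a b = k * ((b - a)%:C)%C.
Proof. by move=> ab; rewrite /cint !rint_cst //; case: k => x y; simpc. Qed.

(** Real and imaginary parts are estimated separately, whence the factor 2. *)
Lemma cint_bound F a b M : a <= b -> rccontI F a b ->
  (forall t, a <= t <= b -> normc (F t) <= M) -> normc (cint F a b) <= 2 * M * (b - a).
Proof.
move=> ab cF FM; apply: le_trans (normc_le_ReIm _) _ => /=.
have h1 : `|rint (fun t => Re (F t)) a b| <= M * (b - a).
  apply: rint_abs => // t ht; first exact/rccont_Re/cF.
  exact: le_trans (normc_Re _) (FM _ ht).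
have h2 : `|rint (fun t => Im (F t)) a b| <= M * (b - a).
  apply: rint_abs => // t ht; first exact/rccont_Im/cF.
  exact: le_trans (normc_Im _) (FM _ ht).
lra.
Qed.

Lemma cint_split F a c b : a <= c -> c <= b -> rccontI F a b ->
  cint F a b = cint F a c + cint F c b.
Proof.
move=> ac cb cF; rewrite /cint.
rewrite (rint_split ac cb) => [|t /cF]; last exact: rccont_Re.
by rewrite (rint_split ac cb) => [|t /cF]; last exact: rccont_Im.
Qed.

Definition inrect x0 x1 y0 y1 z := (x0 <= Re z <= x1) && (y0 <= Im z <= y1).

(** The contour integral of f dz along the boundary of the rectangle, counterclockwise; the factor i
    is dz/dt on the vertical sides. *)
Definition rect f x0 x1 y0 y1 : C :=
  cint (fun t => f (t +i* y0)%C) x0 x1 - cint (fun t => f (t +i* y1)%C) x0 x1 +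
  'i%C * (cint (fun t => f (x1 +i* t)%C) y0 y1 - cint (fun t => f (x0 +i* t)%C) y0 y1).

Definition onbd x0 x1 y0 y1 z := [|| Re z == x0, Re z == x1, Im z == y0 | Im z == y1].

Definition rectcont f x0 x1 y0 y1 := forall z, inrect x0 x1 y0 y1 z -> onbd x0 x1 y0 y1 z ->
  ccont f z.

Lemma ccont_hor f t y : ccont f (t +i* y)%C -> rccont (fun t => f (t +i* y)%C) t.
Proof.
move=> h e /h[r r0 hr]; exists r => // s hs; apply: hr => /=.
by rewrite subrr expr0n addr0 sqrtr_sqr.
Qed.

Lemma ccont_ver f t x : ccont f (x +i* t)%C -> rccont (fun t => f (x +i* t)%C) t.
Proof.
move=> h e /h[r r0 hr]; exists r => // s hs; apply: hr => /=.
by rewrite subrr expr0n add0r sqrtr_sqr.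
Qed.

Lemma rectcontP f x0 x1 y0 y1 : x0 <= x1 -> y0 <= y1 -> rectcont f x0 x1 y0 y1 ->
  [/\ rccontI (fun t => f (t +i* y0)%C) x0 x1, rccontI (fun t => f (t +i* y1)%C) x0 x1,
      rccontI (fun t => f (x0 +i* t)%C) y0 y1 & rccontI (fun t => f (x1 +i* t)%C) y0 y1].
Proof.
move=> hx hy cf; split=> t ht; do 1?[apply: ccont_hor|apply: ccont_ver]; apply: cf;
  by rewrite /onbd /inrect /= ?ht ?lexx ?hx ?hy ?eqxx ?orbT.
Qed.

Lemma rect_ext f g x0 x1 y0 y1 : x0 <= x1 -> y0 <= y1 ->
  (forall z, inrect x0 x1 y0 y1 z ->
    onbd x0 x1 y0 y1 z -> f z = g z) ->
  rect f x0 x1 y0 y1 = rect g x0 x1 y0 y1.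
Proof.
move=> hx hy fg; rewrite /rect.
by congr (_ - _ + _ * (_ - _)); apply: eq_cint => t ht; apply: fg;
  rewrite /onbd /inrect /= ?ht ?lexx ?hx ?hy ?eqxx ?orbT.
Qed.

Lemma rectD f g x0 x1 y0 y1 : x0 <= x1 -> y0 <= y1 ->
  rectcont f x0 x1 y0 y1 -> rectcont g x0 x1 y0 y1 ->
  rect (fun z => f z + g z) x0 x1 y0 y1 = rect f x0 x1 y0 y1 + rect g x0 x1 y0 y1.
Proof.
move=> hx hy cf cg; rewrite /rect.
have [f1 f2 f3 f4] := rectcontP hx hy cf; have [g1 g2 g3 g4] := rectcontP hx hy cg.
by rewrite !cintD //; ring.
Qed.

Lemma rectZ k f x0 x1 y0 y1 : x0 <= x1 -> y0 <= y1 -> rectcont f x0 x1 y0 y1 ->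
  rect (fun z => k * f z) x0 x1 y0 y1 = k * rect f x0 x1 y0 y1.
Proof.
move=> hx hy cf; rewrite /rect.
have [f1 f2 f3 f4] := rectcontP hx hy cf.
by rewrite !cintZ //; ring.
Qed.

Lemma rect_bound f x0 x1 y0 y1 M : x0 <= x1 -> y0 <= y1 -> rectcont f x0 x1 y0 y1 ->
  (forall z, inrect x0 x1 y0 y1 z ->
    onbd x0 x1 y0 y1 z -> normc (f z) <= M) ->
  normc (rect f x0 x1 y0 y1) <= 4 * M * ((x1 - x0) + (y1 - y0)).
Proof.
move=> hx hy cf fM; rewrite /rect.
have [f1 f2 f3 f4] := rectcontP hx hy cf.
have b1 : normc (cint (fun t => f (t +i* y0)%C) x0 x1) <= 2 * M * (x1 - x0).
  apply: (cint_bound hx f1) => t ht.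
  by apply: fM; rewrite /onbd /inrect /= ?ht ?lexx ?hx ?hy ?eqxx ?orbT.
have b2 : normc (cint (fun t => f (t +i* y1)%C) x0 x1) <= 2 * M * (x1 - x0).
  apply: (cint_bound hx f2) => t ht.
  by apply: fM; rewrite /onbd /inrect /= ?ht ?lexx ?hx ?hy ?eqxx ?orbT.
have b3 : normc (cint (fun t => f (x0 +i* t)%C) y0 y1) <= 2 * M * (y1 - y0).
  apply: (cint_bound hy f3) => t ht.
  by apply: fM; rewrite /onbd /inrect /= ?ht ?lexx ?hx ?hy ?eqxx ?orbT.
have b4 : normc (cint (fun t => f (x1 +i* t)%C) y0 y1) <= 2 * M * (y1 - y0).
  apply: (cint_bound hy f4) => t ht.
  by apply: fM; rewrite /onbd /inrect /= ?ht ?lexx ?hx ?hy ?eqxx ?orbT.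
apply: le_trans (le_normcD _ _) _.
apply: (@le_trans _ _ ((2 * M * (x1 - x0) + 2 * M * (x1 - x0)) +
   (2 * M * (y1 - y0) + 2 * M * (y1 - y0)))); last by lra.
rewrite lerD //; first by rewrite (le_trans (le_normcD _ _)) // normcN lerD.
rewrite normcM (_ : normc 'i%C = 1) ?mul1r; last first.
  by rewrite /= expr0n expr1n add0r sqrtr1.
by rewrite (le_trans (le_normcD _ _)) // normcN lerD.
Qed.

Lemma rect_splitx f x0 xm x1 y0 y1 : x0 <= xm -> xm <= x1 ->
  rccontI (fun t => f (t +i* y0)%C) x0 x1 -> rccontI (fun t => f (t +i* y1)%C) x0 x1 ->
  rect f x0 x1 y0 y1 = rect f x0 xm y0 y1 + rect f xm x1 y0 y1.
Proof.
move=> h1 h2 cf0 cf1; rewrite /rect.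
by rewrite (cint_split h1 h2 cf0) (cint_split h1 h2 cf1); ring.
Qed.

Lemma rect_splity f x0 x1 y0 ym y1 : y0 <= ym -> ym <= y1 ->
  rccontI (fun t => f (x0 +i* t)%C) y0 y1 -> rccontI (fun t => f (x1 +i* t)%C) y0 y1 ->
  rect f x0 x1 y0 y1 = rect f x0 x1 y0 ym + rect f x0 x1 ym y1.
Proof.
move=> h1 h2 cf0 cf1; rewrite /rect.
by rewrite (cint_split h1 h2 cf0) (cint_split h1 h2 cf1); ring.
Qed.

Lemma ccont_affine (a b : C) z : ccont (fun z => a + b * z) z.
Proof.
move=> e e0; have b0 := normc_ge0 b.
exists (e / (1 + normc b)); first by rewrite divr_gt0 // ltr_wpDr.
move=> w; rewrite ltr_pdivlMr ?ltr_wpDr // => h.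
rewrite (_ : _ - _ = b * (w - z)); last by ring.
by rewrite normcM; have := normc_ge0 (w - z); nra.
Qed.

(** On opposite sides the values differ by a constant, [b] times the side vector between them, and
    the horizontal and vertical contributions cancel. *)
Lemma rect_affine (a b : C) x0 x1 y0 y1 : x0 <= x1 -> y0 <= y1 ->
  rect (fun z => a + b * z) x0 x1 y0 y1 = 0.
Proof.
move=> hx hy; rewrite /rect.
have ch y : rccontI (fun t => a + b * (t +i* y)%C) x0 x1.
  by move=> t _; apply: (ccont_hor (f := fun z => a + b * z)); exact: ccont_affine.
have cv x : rccontI (fun t => a + b * (x +i* t)%C) y0 y1.
  by move=> t _; apply: (ccont_ver (f := fun z => a + b * z)); exact: ccont_affine.
have cc (k : C) c e : rccontI (fun=> k) c e.
  by move=> t _ q q0; exists 1 => // s _; rewrite subrr normc0.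
have -> : cint (fun t => a + b * (t +i* y0)%C) x0 x1 =
    cint (fun t => a + b * (t +i* y1)%C) x0 x1 + b * (0 +i* (y0 - y1))%C * ((x1 - x0)%:C)%C.
  rewrite -(cint_cst _ hx) -cintD //; apply: eq_cint => t _.
  rewrite -addrA -mulrDr; congr (_ + _ * _).
  by apply/eqP; rewrite eq_complex /= addr0 eqxx /= addrC subrK eqxx.
have -> : cint (fun t => a + b * (x1 +i* t)%C) y0 y1 =
    cint (fun t => a + b * (x0 +i* t)%C) y0 y1 + b * ((x1 - x0)%:C)%C * ((y1 - y0)%:C)%C.
  rewrite -(cint_cst _ hy) -cintD //; apply: eq_cint => t _.
  rewrite -addrA -mulrDr; congr (_ + _ * _).
  by apply/eqP; rewrite eq_complex /= addr0 eqxx /= addrC subrK eqxx.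
rewrite (_ : (0 +i* (y0 - y1))%C = - ('i%C * ((y1 - y0)%:C)%C)); first by ring.
by apply/eqP; rewrite eq_complex /= !mul0r !mulr0 ?mul1r; apply/andP; split; apply/eqP; ring.
Qed.
End ComplexIntegral.

(** * Goursat's theorem, Cauchy's formula and one-variable estimates *)

Section Goursat.
Variable R : realType.
Local Notation C := (Cx R).
Implicit Types (f g : C -> C) (z w : C).
Local Notation Re := complex.Re.
Local Notation Im := complex.Im.

Lemma half_pow_lt (w e : R) : 0 < e -> exists n : nat, w / 2 ^+ n < e.
Proof.
move=> e0; pose n := Num.bound `|w / e|.
have hn : w / e < n%:R by apply: le_lt_trans (ler_norm _) _; exact: archi_boundP.
exists n; rewrite ltr_pdivrMr ?exprn_gt0 // mulrC -ltr_pdivrMr //.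
by apply: lt_trans hn _; rewrite -natrX ltr_nat ltn_expl.
Qed.

(** Bisection as an induction principle. If [P] failed for the big rectangle it would fail for one
    quarter, again for a quarter of that, and so on; the nested rectangles shrink to a point, where
    the local hypothesis contradicts the failure. *)
Lemma quarter_ind (P : R -> R -> R -> R -> Prop) (X0 X1 Y0 Y1 : R) :
  X0 <= X1 -> Y0 <= Y1 ->
  (forall x0 x1 y0 y1, X0 <= x0 -> x0 <= x1 -> x1 <= X1 -> Y0 <= y0 -> y0 <= y1 -> y1 <= Y1 ->
     P x0 ((x0 + x1) / 2) y0 ((y0 + y1) / 2) -> P ((x0 + x1) / 2) x1 y0 ((y0 + y1) / 2) ->
     P x0 ((x0 + x1) / 2) ((y0 + y1) / 2) y1 -> P ((x0 + x1) / 2) x1 ((y0 + y1) / 2) y1 ->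
     P x0 x1 y0 y1) ->
  (forall x y, X0 <= x <= X1 -> Y0 <= y <= Y1 -> exists2 r : R, 0 < r &
     forall x0 x1 y0 y1, X0 <= x0 -> x0 <= x <= x1 -> x1 <= X1 ->
       Y0 <= y0 -> y0 <= y <= y1 -> y1 <= Y1 -> x1 - x0 < r -> y1 - y0 < r ->
       P x0 x1 y0 y1) ->
  P X0 X1 Y0 Y1.
Proof.
move=> hX hY sub loc; have [//|nP] := pselect (P X0 X1 Y0 Y1); exfalso.
pose inv (r : R * R * R * R) := let: (x0, x1, y0, y1) := r in
  [/\ X0 <= x0, x0 <= x1 & x1 <= X1] /\ [/\ Y0 <= y0, y0 <= y1 & y1 <= Y1] /\ ~ P x0 x1 y0 y1.
pose nest (r s : R * R * R * R) := let: (x0, x1, y0, y1) := r in let: (a0, a1, b0, b1) := s in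
  [/\ x0 <= a0, a1 <= x1, y0 <= b0 & b1 <= y1] /\
  a1 - a0 = (x1 - x0) / 2 /\ b1 - b0 = (y1 - y0) / 2.
have /choice[step hstep] : forall r, exists s, inv r -> inv s /\ nest r s.
  move=> [[[x0 x1] y0] y1]; have [|ni] := pselect (inv (x0, x1, y0, y1)); last first.
    by exists (x0, x1, y0, y1).
  move=> [[a1 a2 a3] [[b1 b2 b3] np]].
  have [p1|n1] := pselect (P x0 ((x0 + x1) / 2) y0 ((y0 + y1) / 2)); last first.
    by exists (x0, (x0 + x1) / 2, y0, (y0 + y1) / 2) => _; rewrite /inv /nest; do !split => //; lra.
  have [p2|n2] := pselect (P ((x0 + x1) / 2) x1 y0 ((y0 + y1) / 2)); last first.
    by exists ((x0 + x1) / 2, x1, y0, (y0 + y1) / 2) => _; rewrite /inv /nest; do !split => //; lra.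
  have [p3|n3] := pselect (P x0 ((x0 + x1) / 2) ((y0 + y1) / 2) y1); last first.
    by exists (x0, (x0 + x1) / 2, (y0 + y1) / 2, y1) => _; rewrite /inv /nest; do !split => //; lra.
  have [p4|n4] := pselect (P ((x0 + x1) / 2) x1 ((y0 + y1) / 2) y1); last first.
    by exists ((x0 + x1) / 2, x1, (y0 + y1) / 2, y1) => _; rewrite /inv /nest; do !split => //; lra.
  by case: np; exact: sub.
pose r n := iter n step (X0, X1, Y0, Y1).
have ir n : inv (r n).
  elim: n => [|n /hstep[]//]; by rewrite /r /= /inv; do !split.
have nr n : nest (r n) (r n.+1) by have [] := hstep _ (ir n).
pose a n := (r n).1.1.1; pose b n := (r n).1.1.2; pose c n := (r n).1.2; pose e n := (r n).2.
have ri n : [/\ X0 <= a n, a n <= b n & b n <= X1] /\ [/\ Y0 <= c n, c n <= e n & e n <= Y1] /\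
   ~ P (a n) (b n) (c n) (e n).
  by have := ir n; rewrite /a /b /c /e; case: (r n) => [[[? ?] ?] ?].
have rn n : [/\ a n <= a n.+1, b n.+1 <= b n, c n <= c n.+1 & e n.+1 <= e n] /\
  b n.+1 - a n.+1 = (b n - a n) / 2 /\ e n.+1 - c n.+1 = (e n - c n) / 2.
  have := nr n; rewrite /a /b /c /e; case: (r n) => [[[? ?] ?] ?].
  by case: (r n.+1) => [[[? ?] ?] ?].
have wx n : b n - a n = (X1 - X0) / 2 ^+ n.
  elim: n => [|n IH]; first by rewrite expr0 divr1.
  by have [_ [-> _]] := rn n; rewrite IH exprSr invfM mulrA.
have wy n : e n - c n = (Y1 - Y0) / 2 ^+ n.
  elim: n => [|n IH]; first by rewrite expr0 divr1.
  by have [_ [_ ->]] := rn n; rewrite IH exprSr invfM mulrA.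
have limit (u v : nat -> R) : (forall n, u n <= u n.+1) -> (forall n, v n.+1 <= v n) ->
    (forall n, u n <= v n) -> exists x, forall n, u n <= x <= v n.
  move=> hu hv huv.
  have mu : {homo u : m n / (m <= n)%N >-> m <= n} by exact/nondecreasing_seqP.
  have mv : {homo v : m n / (m <= n)%N >-> n <= m} by exact/nonincreasing_seqP.
  have uv m n : u m <= v n.
    apply: (@le_trans _ _ (u (maxn m n))); first by apply: mu; rewrite leq_maxl.
    by apply: le_trans (huv _) _; apply: mv; rewrite leq_maxr.
  exists (sup (range u)) => n; apply/andP; split.
    by apply: ub_le_sup; [exists (v 0%N) => _ [k _ <-]|exists n].
  by apply: ge_sup; [exists (u 0%N), 0%N|move=> _ [k _ <-]].
have [n|n|n|x hx] := limit a b; [by have [[]] := rn n|by have [[]] := rn n|by have [[]] := ri n|].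
have [n|n|n|y hy] := limit c e; [by have [[]] := rn n|by have [[]] := rn n|by have [_ [[]]] := ri n|].
have [||d d0 hd] := loc x y; rewrite ?(hx 0%N) ?(hy 0%N) //.
have [n1 hn1] := half_pow_lt (X1 - X0) d0; have [n2 hn2] := half_pow_lt (Y1 - Y0) d0.
pose n := maxn n1 n2.
have dec (w : R) m k : 0 <= w -> (m <= k)%N -> w / 2 ^+ k <= w / 2 ^+ m.
  move=> w0 mk; rewrite ler_wpM2l // lef_pV2 ?posrE ?exprn_gt0 //.
  by rewrite ler_eXn2l // ltr1n.
have [[h1 h2 h3] [[h4 h5 h6] np]] := ri n; apply: np; apply: hd => //.
  by rewrite wx (le_lt_trans _ hn1) // dec ?subr_ge0 ?leq_maxl.
by rewrite wy (le_lt_trans _ hn2) // dec ?subr_ge0 ?leq_maxr.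
Qed.

Lemma cdiffP f z : cdiff f z <-> derivable f z 1.
Proof.
split => [[l hl]|].
  apply/cvg_ex; exists l; move=> A /nbhs_C[e e0 hA].
  have [|r r0 hr] := hl (e / 2); first by rewrite divr_gt0.
  apply/nbhs_C; exists r => // h; rewrite subr0 => hh h0; apply: hA => /=.
  have /= := hr (h *: 1 + z); rewrite addrK [h *: 1]mulr1 => /(_ hh) hb.
  have n0 : 0 < normc h by rewrite normc_gt0.
  have -> : h^-1 *: (f (h + z) - f z) - l = h^-1 * (f (h + z) - f z - l * h).
    rewrite [h^-1 *: _]/(h^-1 * _) mulrBr; congr (_ - _).
    by rewrite mulrCA mulVf // mulr1.
  rewrite normcM normcV mulrC ltr_pdivrMr //.
  by apply: le_lt_trans hb _; rewrite ltr_pM2r //; lra.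
move=> /cvg_ex[l hl]; exists l => e e0.
have : nbhs l [set y | normc (y - l) < e] by apply/nbhs_C; exists e.
move=> /hl /nbhs_C[r r0 hr]; exists r => // w hw.
have [->|wz] := eqVneq w z; first by rewrite !subrr mulr0 subrr normc0 mulr0.
have := hr (w - z); rewrite subr0 subr_eq0 => /(_ hw wz) /=.
rewrite [(w - z) *: 1]mulr1 subrK => hb.
have n0 : 0 < normc (w - z) by rewrite normc_gt0 subr_eq0.
have -> : f w - f z - l * (w - z) = (w - z) * ((w - z)^-1 *: (f w - f z) - l).
  have aux (h k m : C) : h != 0 -> k - m * h = h * (h^-1 * k - m).
    by move=> h0; rewrite mulrBr mulrA mulfV // mul1r [m * _]mulrC.
  by apply: aux; rewrite subr_eq0.
by rewrite normcM mulrC ler_wpM2r ?normc_ge0 // ltW.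
Qed.

Lemma cdiff_cst (k : C) z : cdiff (fun=> k) z.
Proof. by apply/cdiffP; exact: derivable_cst. Qed.

Lemma cdiff_id z : cdiff (fun z => z) z.
Proof. by apply/cdiffP; exact: derivable_id. Qed.

Lemma cdiffD f g z : cdiff f z -> cdiff g z -> cdiff (fun z => f z + g z) z.
Proof. by move=> /cdiffP hf /cdiffP hg; apply/cdiffP; exact: derivableD. Qed.

Lemma cdiffB f g z : cdiff f z -> cdiff g z -> cdiff (fun z => f z - g z) z.
Proof. by move=> /cdiffP hf /cdiffP hg; apply/cdiffP; exact: derivableB. Qed.

Lemma cdiffM f g z : cdiff f z -> cdiff g z -> cdiff (fun z => f z * g z) z.
Proof.
move=> df [m hm]; have cf := cdiff_ccont df; case: df => l hl.
exists (l * g z + f z * m) => e e0.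
pose K := 1 + normc (f z) + normc (g z) + normc m.
have K0 : 0 < K by rewrite /K !ltr_wpDr ?normc_ge0.
have e1 : 0 < e / K by rewrite divr_gt0.
have [r1 r10 hr1] := hl _ e1; have [r2 r20 hr2] := hm _ e1.
have [|r3 r30 hr3] := cf (Num.min 1 (e / K)); first by rewrite lt_min ltr01.
exists (Num.min r1 (Num.min r2 r3)); first by rewrite !lt_min r10 r20.
move=> w; rewrite !lt_min => /and3P[/hr1 h1 /hr2 h2 /hr3].
rewrite lt_min => /andP[h3 h4].
set h := w - z in h1 h2 *.
rewrite (_ : _ - _ = (f w - f z - l * h) * g z + f w * (g w - g z - m * h) + (f w - f z) * (m * h)); last by ring.
have b1 : normc ((f w - f z - l * h) * g z) <= e / K * normc h * normc (g z).
  by rewrite normcM ler_wpM2r ?normc_ge0.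
have b2 : normc (f w * (g w - g z - m * h)) <= (1 + normc (f z)) * (e / K * normc h).
  rewrite normcM ler_pM ?normc_ge0 //.
  by apply: le_trans (normcB_tri _ (f z)) _; rewrite lerD2r ltW.
have b3 : normc ((f w - f z) * (m * h)) <= e / K * (normc m * normc h).
  by rewrite !normcM ler_wpM2r ?mulr_ge0 ?normc_ge0 // ltW.
have -> : e = e / K * K by rewrite divfK // gt_eqF.
apply: le_trans (le_normcD _ _) _.
apply: (@le_trans _ _ (e / K * normc h * normc (g z) + (1 + normc (f z)) * (e / K * normc h)
   + e / K * (normc m * normc h))).
  by rewrite lerD //; apply: le_trans (le_normcD _ _) _; rewrite lerD.
by rewrite le_eqVlt; apply/orP; left; apply/eqP; rewrite /K; ring.
Qed.

Lemma cdiffV f z : f z != 0 -> cdiff f z -> cdiff (fun z => (f z)^-1) z.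
Proof. by move=> f0 /cdiffP hf; apply/cdiffP; exact: derivableV. Qed.

Lemma cdiffX f n z : cdiff f z -> cdiff (fun z => f z ^+ n) z.
Proof.
move=> hf; elim: n => [|n IH].
  by rewrite (_ : (fun _ => _) = fun=> 1) ?funeqE; [exact: cdiff_cst|move=> x; rewrite expr0].
rewrite (_ : (fun z => _) = fun z => f z * f z ^+ n) ?funeqE; first exact: cdiffM.
by move=> x; rewrite exprS.
Qed.

Lemma cdiff_near f g z (r : R) : 0 < r -> (forall w, normc (w - z) < r -> f w = g w) ->
  cdiff f z -> cdiff g z.
Proof.
move=> r0 fg [l hl]; exists l => e /hl[q q0 hq].
exists (Num.min r q); first by rewrite lt_min r0.
move=> w; rewrite lt_min => /andP[wr wq].
by rewrite -!fg ?hq // subrr normc0.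
Qed.

Lemma normc_inrect x0 x1 y0 y1 (z w : C) : inrect x0 x1 y0 y1 z -> inrect x0 x1 y0 y1 w ->
  normc (z - w) <= (x1 - x0) + (y1 - y0).
Proof.
rewrite /inrect => /andP[/andP[a1 a2] /andP[a3 a4]] /andP[/andP[b1 b2] /andP[b3 b4]].
apply: le_trans (normc_le_ReIm _) _; rewrite ReD ReN ImD ImN.
by apply: lerD; rewrite ler_norml; apply/andP; split; lra.
Qed.

(** The bound [e] times the squared half-perimeter of a rectangle is the sum of the bounds of its
    four quarters, so [quarter_ind] applies. Locally [f] is affine up to an error [e / 4] times the
    size: affine functions integrate to zero, and the 4 of [rect_bound] restores [e]. *)
Lemma goursat f (x0 x1 y0 y1 : R) : x0 <= x1 -> y0 <= y1 ->
  (forall z, inrect x0 x1 y0 y1 z -> cdiff f z) -> rect f x0 x1 y0 y1 = 0.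
Proof.
move=> hx hy df; set D := (x1 - x0) + (y1 - y0).
have D0 : 0 <= D by rewrite /D; lra.
suff key e : 0 < e -> normc (rect f x0 x1 y0 y1) <= e * D ^+ 2.
  apply: eq0_normc; apply/eqP; rewrite eq_le normc_ge0 andbT leNgt; apply/negP => n0.
  have := key (normc (rect f x0 x1 y0 y1) / (2 * (1 + D ^+ 2))).
  have D2 : 0 <= D ^+ 2 by rewrite sqr_ge0.
  rewrite divr_gt0 ?mulr_gt0 ?ltr_wpDr // => /(_ isT).
  rewrite mulrAC ler_pdivlMr ?mulr_gt0 ?ltr_wpDr //; nra.
move=> e0.
pose P a b c h := normc (rect f a b c h) <= e * ((b - a) + (h - c)) ^+ 2.
apply: (@quarter_ind P) => //.
  move=> a b c h xa ab bx yc ch hy'; rewrite /P.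
  set m := (a + b) / 2; set n := (c + h) / 2 => p1 p2 p3 p4.
  have [am mb] : a <= m /\ m <= b by split; [rewrite midf_le|rewrite midf_le].
  have [cn nh] : c <= n /\ n <= h by split; [rewrite midf_le|rewrite midf_le].
  have dab z : inrect a b c h z -> ccont f z.
    move=> /andP[/andP[az zb] /andP[cz zh]]; apply/cdiff_ccont/df.
    by rewrite /inrect (le_trans xa az) (le_trans zb bx) (le_trans yc cz) (le_trans zh hy').
  have cv x : a <= x <= b -> rccontI (fun t => f (x +i* t)%C) c h.
    by move=> hx' t ht; apply/ccont_ver/dab; rewrite /inrect hx' ht.
  have ch' y : c <= y <= h -> rccontI (fun t => f (t +i* y)%C) a b.
    by move=> hy'' t ht; apply/ccont_hor/dab; rewrite /inrect hy'' ht.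
  rewrite (rect_splitx am mb) ?(rect_splity cn nh); do ?[apply: cv|apply: ch'];
    rewrite ?lexx ?am ?mb ?ab ?ch //.
  apply: le_trans (le_normcD _ _) _.
  have := le_normcD (rect f a m c n) (rect f a m n h).
  have := le_normcD (rect f m b c n) (rect f m b n h).
  move: p1 p2 p3 p4.
  have -> : b - m = (b - a) / 2 by rewrite /m; lra.
  have -> : m - a = (b - a) / 2 by rewrite /m; lra.
  have -> : h - n = (h - c) / 2 by rewrite /n; lra.
  have -> : n - c = (h - c) / 2 by rewrite /n; lra.
  have -> : ((b - a) / 2 + (h - c) / 2) ^+ 2 = (b - a + (h - c)) ^+ 2 / 4 by field.
  by set q := (_ ^+ 2); clear; lra.
move=> x y hxx hyy.
have zr : inrect x0 x1 y0 y1 (x +i* y)%C by apply/andP.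
have [l hl] := df _ zr; have [|r r0 hr] := hl (e / 4); first by rewrite divr_gt0.
exists (r / 2); first by rewrite divr_gt0.
move=> a b c h xa hab bx yc hch hy' w1 w2; rewrite /P.
have zr' : inrect a b c h (x +i* y)%C by apply/andP.
have ab : a <= b by move: hab => /andP[]; lra.
have ch : c <= h by move: hch => /andP[]; lra.
set z0 := (x +i* y)%C in hl hr zr zr'.
pose g z := f z - f z0 - l * (z - z0).
pose A z := (f z0 - l * z0) + l * z.
have dA z : cdiff A z.
  by apply: cdiffD; [exact: cdiff_cst|apply: cdiffM; [exact: cdiff_cst|exact: cdiff_id]].
have dff z : inrect a b c h z -> cdiff f z.
  move=> /andP[/andP[az zb] /andP[cz ze]]; apply: df.
  by rewrite /inrect (le_trans xa az) (le_trans zb bx) (le_trans yc cz) (le_trans ze hy').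
have dg z : inrect a b c h z -> cdiff g z.
  move=> zz; rewrite (_ : g = fun z => f z - A z); first by apply: cdiffB; [exact: dff|exact: dA].
  by rewrite funeqE => w; rewrite /g /A; ring.
have -> : f = fun z => A z + g z by rewrite funeqE => w; rewrite /g /A; ring.
rewrite rectD //; [|by move=> z _ _; apply: cdiff_ccont; exact: dA|by move=> z /dg + _; exact: cdiff_ccont].
rewrite rect_affine // add0r.
have -> : e * (b - a + (h - c)) ^+ 2 = 4 * (e / 4 * (b - a + (h - c))) * (b - a + (h - c)).
  by field.
apply: rect_bound => // [z /dg + _|z zz _]; first exact: cdiff_ccont.
have zb := normc_inrect zz zr'.
apply: le_trans (hr _ _) _; first by lra.
by rewrite ler_wpM2l // divr_ge0 // ltW.
Qed.

(** The frame between the two rectangles is cut into a left, a right, a lower and an upper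
    rectangle, over each of which the integral vanishes by Goursat. *)
Lemma rect_deform f (X0 x0 x1 X1 Y0 y0 y1 Y1 : R) :
  X0 <= x0 -> x0 <= x1 -> x1 <= X1 -> Y0 <= y0 -> y0 <= y1 -> y1 <= Y1 ->
  (forall z, inrect X0 X1 Y0 Y1 z -> ~~ ((x0 < Re z < x1) && (y0 < Im z < y1)) -> cdiff f z) ->
  rect f X0 X1 Y0 Y1 = rect f x0 x1 y0 y1.
Proof.
move=> h1 h2 h3 h4 h5 h6 df.
have zero a b c e : X0 <= a -> a <= b -> b <= X1 -> Y0 <= c -> c <= e -> e <= Y1 ->
    [|| b <= x0, x1 <= a, e <= y0 | y1 <= c] -> rect f a b c e = 0.
  move=> Xa ab bX Yc ce eY out; apply: goursat => // z /andP[/andP[az zb] /andP[cz ze]].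
  apply: df; first by rewrite /inrect (le_trans Xa az) (le_trans zb bX) (le_trans Yc cz) (le_trans ze eY).
  apply/negP => /andP[/andP[p1 p2] /andP[p3 p4]]; move: out => /or4P[] q.
  - by have := le_lt_trans (le_trans zb q) p1; rewrite ltxx.
  - by have := lt_le_trans p2 (le_trans q az); rewrite ltxx.
  - by have := le_lt_trans (le_trans ze q) p3; rewrite ltxx.
  - by have := lt_le_trans p4 (le_trans q cz); rewrite ltxx.
have x0X : x0 <= X1 by exact: le_trans h2 h3.
have Xx1 : X0 <= x1 by exact: le_trans h1 h2.
have y0Y : y0 <= Y1 by exact: le_trans h5 h6.
have Yy1 : Y0 <= y1 by exact: le_trans h4 h5.
have XX : X0 <= X1 by exact: le_trans h1 x0X.
have YY : Y0 <= Y1 by exact: le_trans h4 y0Y.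
have hor y a b : (y <= y0) || (y1 <= y) -> Y0 <= y <= Y1 -> X0 <= a -> b <= X1 ->
    rccontI (fun t => f (t +i* y)%C) a b.
  move=> out hy Xa bX t /andP[at_ tb]; apply/ccont_hor/cdiff_ccont/df => /=.
    by rewrite /inrect /= (le_trans Xa at_) (le_trans tb bX).
  by rewrite negb_and; apply/orP; right; rewrite negb_and -!leNgt.
have ver x a b : (x <= x0) || (x1 <= x) -> X0 <= x <= X1 -> Y0 <= a -> b <= Y1 ->
    rccontI (fun t => f (x +i* t)%C) a b.
  move=> out hx Ya bY t /andP[at_ tb]; apply/ccont_ver/cdiff_ccont/df => /=.
    by rewrite /inrect /= hx (le_trans Ya at_) (le_trans tb bY).
  by rewrite negb_and; apply/orP; left; rewrite negb_and -!leNgt.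
rewrite (rect_splitx h1 x0X); try (apply: hor; rewrite ?lexx ?h4 ?h6 ?YY ?orbT //).
rewrite (rect_splitx h2 h3); try (apply: hor; rewrite ?lexx ?h4 ?h6 ?YY ?orbT //).
rewrite (@rect_splity _ f x0 x1 _ _ _ h4 y0Y); try (apply: ver; rewrite ?lexx ?h1 ?h3 ?x0X ?Xx1 ?orbT //).
rewrite (@rect_splity _ f x0 x1 _ _ _ h5 h6); try (apply: ver; rewrite ?lexx ?h1 ?h3 ?x0X ?Xx1 ?orbT //).
rewrite (zero X0 x0 Y0 Y1) ?lexx // (zero x1 X1 Y0 Y1) ?lexx ?orbT //.
rewrite (zero x0 x1 Y0 y0) ?lexx ?orbT // (zero x0 x1 y1 Y1) ?lexx ?orbT //.
by rewrite !add0r !addr0.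
Qed.

Definition sq f (a : C) (r : R) := rect f (Re a - r) (Re a + r) (Im a - r) (Im a + r).

Lemma inrect_sq (a z : C) (r : R) :
  inrect (Re a - r) (Re a + r) (Im a - r) (Im a + r) z = (cmax (z - a) <= r).
Proof.
rewrite cmax_le ReD ReN ImD ImN !ler_norml /inrect.
by rewrite !lerBrDl !lerBlDl.
Qed.

Lemma onbd_sq (a z : C) (r : R) : cmax (z - a) <= r ->
  onbd (Re a - r) (Re a + r) (Im a - r) (Im a + r) z -> cmax (z - a) = r.
Proof.
move=> h b; apply/eqP; rewrite eq_le h /= /cmax le_max ReD ReN ImD ImN !ler_normr.
by move: b => /or4P[] /eqP ->; rewrite addrAC subrr add0r ?opprK lexx ?orbT.
Qed.

Definition sqcont f a r := forall z, cmax (z - a) = r -> ccont f z.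

Lemma sqcontP f a r : sqcont f a r ->
  rectcont f (Re a - r) (Re a + r) (Im a - r) (Im a + r).
Proof. by move=> cf z; rewrite inrect_sq => h b; apply: cf; exact: onbd_sq. Qed.

Lemma sq_le (x r : R) : 0 <= r -> x - r <= x + r.
Proof. by move=> r0; rewrite lerBlDr -addrA lerDl addr_ge0. Qed.

Lemma sqD f g a r : 0 <= r -> sqcont f a r -> sqcont g a r ->
  sq (fun z => f z + g z) a r = sq f a r + sq g a r.
Proof. by move=> r0 cf cg; apply: rectD; rewrite ?sq_le //; exact: sqcontP. Qed.

Lemma sqZ k f a r : 0 <= r -> sqcont f a r -> sq (fun z => k * f z) a r = k * sq f a r.
Proof. by move=> r0 cf; apply: rectZ; rewrite ?sq_le //; exact: sqcontP. Qed.

Lemma sq_bound f a r M : 0 <= r -> sqcont f a r ->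
  (forall z, cmax (z - a) = r -> normc (f z) <= M) -> normc (sq f a r) <= 16 * M * r.
Proof.
move=> r0 cf fM; rewrite (_ : 16 * M * r = 4 * M * ((Re a + r - (Re a - r)) + (Im a + r - (Im a - r)))); last by ring.
apply: rect_bound; rewrite ?sq_le //; first exact: sqcontP.
by move=> z; rewrite inrect_sq => h b; apply: fM; exact: onbd_sq.
Qed.

Lemma eq_sq f g a r : 0 <= r -> (forall z, cmax (z - a) = r -> f z = g z) ->
  sq f a r = sq g a r.
Proof.
move=> r0 fg; apply: rect_ext; rewrite ?sq_le // => z.
by rewrite inrect_sq => h1 h2; apply: fg; exact: onbd_sq.
Qed.

Lemma sq_deform f a b r s : 0 <= s -> cmax (b - a) + s <= r ->
  (forall z, cmax (z - a) <= r -> s <= cmax (z - b) -> cdiff f z) -> sq f a r = sq f b s.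
Proof.
move=> s0 bas df.
have := lexx (cmax (b - a)); rewrite {1}cmax_le ReD ReN ImD ImN !ler_norml.
move=> /andP[/andP[h1 h2] /andP[h3 h4]].
apply: rect_deform; try lra.
move=> z; rewrite inrect_sq => h out; apply: df => //.
rewrite leNgt cmax_lt ReD ReN ImD ImN !ltr_norml; apply: contra out.
by rewrite !ltrBrDl !ltrBlDl.
Qed.

Lemma sqcont_diff f a r : (forall z, cmax (z - a) = r -> cdiff f z) -> sqcont f a r.
Proof. by move=> df z /df; exact: cdiff_ccont. Qed.

Lemma cdiff_kernel f z w : w != z -> cdiff f w -> cdiff (fun x => f x / (x - z)) w.
Proof.
move=> wz df; apply: cdiffM => //; apply: cdiffV; first by rewrite subr_eq0.
by apply: cdiffB; [exact: cdiff_id|exact: cdiff_cst].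
Qed.

Lemma cmax_gt0 (z : C) : (0 < cmax z) = (z != 0).
Proof.
rewrite lt_def cmax_ge0 andbT; congr (~~ _).
by apply/eqP/eqP => [/cmax_eq0 //|->]; exact: cmax0.
Qed.

(** Cauchy's formula with the integral of 1/(x - z) left unevaluated. What remains is the difference
    quotient of [f] at [z]: its contour is shrunk to a small square about [z], on which the
    numerator is at most [e / 16] while the length of the contour cancels the denominator. *)
Lemma cauchy_gen f a r z : (forall w, cmax (w - a) <= r -> cdiff f w) -> cmax (z - a) < r ->
  sq (fun x => f x / (x - z)) a r = f z * sq (fun x => 1 / (x - z)) a r.
Proof.
move=> df zr; have r0 : 0 < r by exact: le_lt_trans (cmax_ge0 _) zr.
have xz x : cmax (x - a) = r -> x != z by move=> xa; apply/eqP => xz; move: zr; rewrite -xz xa ltxx.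
pose g x := (f x - f z) / (x - z).
have dg w : cmax (w - a) <= r -> w != z -> cdiff g w.
  by move=> wa wz; apply: cdiff_kernel => //; apply: cdiffB; [exact: df|exact: cdiff_cst].
have d1 w : w != z -> cdiff (fun x => 1 / (x - z)) w.
  by move=> wz; apply: cdiff_kernel => //; exact: cdiff_cst.
have -> : sq (fun x => f x / (x - z)) a r = sq (fun x => f z * (1 / (x - z)) + g x) a r.
  by apply: eq_sq => [|x _]; [exact: ltW|rewrite /g; ring].
rewrite sqD ?(sqZ (f z)) ?(ltW r0) //; last 3 first.
- by apply: sqcont_diff => w /xz; exact: d1.
- by apply: sqcont_diff => w /xz /d1 h; apply: cdiffM => //; exact: cdiff_cst.
- by apply: sqcont_diff => w /[dup] /xz wz wr; apply: dg => //; rewrite wr.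
suff -> : sq g a r = 0 by rewrite addr0.
have cz := cdiff_ccont (df z (ltW zr)).
suff key e : 0 < e -> normc (sq g a r) <= e.
  apply: eq0_normc; apply/eqP; rewrite eq_le normc_ge0 andbT leNgt; apply/negP => n0.
  have := key (normc (sq g a r) / 2); rewrite divr_gt0 // => /(_ isT).
  by move: n0; set x := normc _; clear; lra.
move=> e0; have [|t t0 ht] := cz (e / 16); first by rewrite divr_gt0.
pose s := Num.min (t / 4) (r - cmax (z - a)).
have s0 : 0 < s by rewrite /s lt_min divr_gt0 //= subr_gt0.
have st : s <= t / 4 by rewrite /s ge_min lexx.
have sr : s <= r - cmax (z - a) by rewrite /s ge_min lexx orbT.
have sz x : cmax (x - z) = s -> x != z.
  by move=> xs; rewrite -subr_eq0 -cmax_gt0 xs.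
have sb x : cmax (x - z) = s -> cmax (x - a) <= r.
  by move=> xs; have := cmaxD (x - z) (z - a); rewrite addrA subrK xs; move: sr; clear; lra.
rewrite (@sq_deform g a z r s) ?(ltW s0) //; last 2 first.
- by move: sr; clear; lra.
- move=> x xa xs; apply: dg => //; rewrite -subr_eq0 -cmax_gt0; exact: lt_le_trans s0 xs.
have -> : e = 16 * (e / 16 / s) * s by field; rewrite gt_eqF.
apply: sq_bound; first exact: ltW.
  by apply: sqcont_diff => x xs; apply: dg; [exact: sb|exact: sz].
move=> x xs; rewrite normcM normcV ler_pM ?invr_ge0 ?normc_ge0 //.
  apply/ltW/ht; have := normc_cmax (x - z); rewrite xs; move: st t0; clear; lra.
rewrite lef_pV2 ?posrE ?normc_gt0 ?subr_eq0 ?sz //.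
by rewrite -xs cmax_normc.
Qed.

(** This is 2 pi i. Its value is never computed: independence of the pole ([wind_const]) and a lower
    bound for the modulus ([wind_ge]) take its place. *)
Definition wind a r := sq (fun x => 1 / (x - a)) a r.

(** The kernels with poles [z] and [a] differ by (z - a)/((x - z)(x - a)), which decays
    quadratically: on a square of size [s] its integral is O(1/s), and the contour can be enlarged
    without limit. *)
Lemma wind_const a r z : cmax (z - a) < r -> sq (fun x => 1 / (x - z)) a r = wind a r.
Proof.
move=> zr; have r0 : 0 < r by exact: le_lt_trans (cmax_ge0 _) zr.
pose g x := 1 / (x - z) / (x - a).
have dg w : w != z -> w != a -> cdiff g w.
  by move=> wz wa; do 2 apply: cdiff_kernel => //; exact: cdiff_cst.
have d1 b w : w != b -> cdiff (fun x => 1 / (x - b)) w.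
  by move=> wz; apply: cdiff_kernel => //; exact: cdiff_cst.
have xz x s : r <= s -> cmax (x - a) = s -> x != z.
  move=> rs xs; apply/eqP => xz; move: zr; rewrite -xz xs => sr.
  by have := lt_le_trans sr rs; rewrite ltxx.
have xa x s : r <= s -> cmax (x - a) = s -> x != a.
  by move=> rs xs; rewrite -subr_eq0 -cmax_gt0 xs; exact: lt_le_trans r0 rs.
have gE x : cmax (x - a) = r -> 1 / (x - z) = 1 / (x - a) + (z - a) * g x.
  move=> xr; rewrite /g; field.
  by rewrite !subr_eq0 (xz _ _ (lexx r) xr) (xa _ _ (lexx r) xr).
rewrite (eq_sq (ltW r0) gE) sqD ?(sqZ (z - a)) ?(ltW r0) //; last 3 first.
- by apply: sqcont_diff => w wr; apply: dg; [exact: (xz _ r)|exact: (xa _ r)].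
- by apply: sqcont_diff => w wr; apply: d1; exact: (xa _ r).
- apply: sqcont_diff => w wr; apply: cdiffM; first exact: cdiff_cst.
  by apply: dg; [exact: (xz _ r)|exact: (xa _ r)].
suff -> : sq g a r = 0 by rewrite mulr0 addr0.
have bnd s : 2 * r <= s -> normc (sq g a r) <= 32 / s.
  move=> rs; have s0 : 0 < s by apply: lt_le_trans rs; rewrite mulr_gt0.
  have rs' : r <= s by move: rs r0; clear; lra.
  rewrite -(@sq_deform g a a s r) ?(ltW r0) //; last 2 first.
  - by rewrite subrr cmax0 add0r.
  - move=> x xs xr; apply: dg; first exact: (xz _ (cmax (x - a))).
    exact: (xa _ (cmax (x - a))).
  have -> : 32 / s = 16 * (2 / s / s) * s by field; rewrite gt_eqF.
  apply: sq_bound => [||x xs]; first exact: ltW.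
    by apply: sqcont_diff => w wr; apply: dg; [exact: (xz _ s)|exact: (xa _ s)].
  rewrite /g normcM normcM normc1 mul1r !normcV ler_pM ?invr_ge0 ?normc_ge0 //.
    rewrite (_ : 2 / s = (s / 2)^-1); last by rewrite invfM invrK mulrC.
    rewrite lef_pV2 ?posrE ?normc_gt0 ?subr_eq0 ?(xz _ s) ?divr_gt0 //.
    apply: le_trans (cmax_normc _).
    have := cmaxD (x - z) (z - a); rewrite addrA subrK xs; move: zr rs r0; clear; lra.
  rewrite lef_pV2 ?posrE ?normc_gt0 ?subr_eq0 ?(xa _ s) //.
  by rewrite -xs cmax_normc.
apply: eq0_normc; apply/eqP; rewrite eq_le normc_ge0 andbT leNgt; apply/negP => n0.
(* With this size the bound 32 / s is at most half of the modulus assumed positive. *)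
pose s := Num.max (2 * r) (64 / normc (sq g a r)).
have s0 : 0 < s by rewrite /s lt_max mulr_gt0.
have := bnd s; rewrite {1}/s le_max lexx => /(_ isT); rewrite ler_pdivlMr // => h.
have : 64 / normc (sq g a r) <= s by rewrite /s le_max lexx orbT.
by rewrite ler_pdivrMr //; move: h; rewrite mulrC; clear; lra.
Qed.


Lemma kernel_bound (s r : R) : 0 < r -> `|s| <= r -> (2 * r)^-1 <= r / (s ^+ 2 + r ^+ 2).
Proof.
move=> r0 sr; have s2 : s ^+ 2 <= r ^+ 2.
  by rewrite -(real_normK (num_real s)) ler_pXn2r ?nnegrE ?(ltW r0).
have r2 : 0 < r ^+ 2 by rewrite exprn_gt0.
rewrite ler_pdivlMr ?ltr_wpDl ?sqr_ge0 // mulrC ler_pdivrMr ?mulr_gt0 //.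
by rewrite mulrCA -expr2; move: s2; clear; lra.
Qed.

(** Each of the four sides contributes to the imaginary part the integral of r/(s^2 + r^2) over |s|
    <= r. Its exact value is pi/2; bounding the integrand below by 1/(2r) gives at least 1. *)
Lemma wind_ge a r : 0 < r -> 4 <= normc (wind a r).
Proof.
move=> r0; apply: le_trans (normc_Im _); apply: le_trans (ler_norm _).
pose u (w : C) : C := 1 / (w - a).
have du w : w != a -> ccont u w.
  by move=> wa; apply: cdiff_ccont; apply: cdiff_kernel => //; exact: cdiff_cst.
have subE (x y : R) : (x +i* y)%C - a = ((x - Re a) +i* (y - Im a))%C by case: (a).
have uI (x y : R) : Im (u (x +i* y)%C) = - ((y - Im a) / ((x - Re a) ^+ 2 + (y - Im a) ^+ 2)).
  by rewrite /u mul1r subE.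
have uR (x y : R) : Re (u (x +i* y)%C) = (x - Re a) / ((x - Re a) ^+ 2 + (y - Im a) ^+ 2).
  by rewrite /u mul1r subE.
have na w : cmax (w - a) = r -> ccont u w.
  by move=> wr; apply: du; rewrite -subr_eq0 -cmax_gt0 wr.
have [f1 f2 f3 f4] := rectcontP (sq_le (Re a) (ltW r0)) (sq_le (Im a) (ltW r0)) (sqcontP na).
have cst1 m : rint (fun=> (2 * r)^-1) (m - r) (m + r) = 1.
  by rewrite rint_cst ?sq_le ?(ltW r0) //; field; rewrite gt_eqF.
have cst2 m : rint (fun=> - (2 * r)^-1) (m - r) (m + r) = -1.
  by rewrite rint_cst ?sq_le ?(ltW r0) //; field; rewrite gt_eqF.
have nrm m t : m - r <= t <= m + r -> `|t - m| <= r.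
  by move=> /andP[h1 h2]; rewrite ler_norml; apply/andP; split; move: h1 h2; clear; lra.
have e1 : 1 <= rint (fun t => Im (u (t +i* (Im a - r))%C)) (Re a - r) (Re a + r).
  rewrite -(cst1 (Re a)); apply: ler_rint => [t _|t /f1|t /nrm ht]; [exact: cst_continuous|exact: rccont_Im|].
  by rewrite uI addrAC subrr add0r mulNr opprK sqrrN; exact: kernel_bound.
have e2 : rint (fun t => Im (u (t +i* (Im a + r))%C)) (Re a - r) (Re a + r) <= -1.
  rewrite -(cst2 (Re a)); apply: ler_rint => [t /f2|t _|t /nrm ht]; [exact: rccont_Im|exact: cst_continuous|].
  by rewrite uI addrAC subrr add0r lerN2; exact: kernel_bound.
have e3 : rint (fun t => Re (u ((Re a - r) +i* t)%C)) (Im a - r) (Im a + r) <= -1.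
  rewrite -(cst2 (Im a)); apply: ler_rint => [t /f3|t _|t /nrm ht]; [exact: rccont_Re|exact: cst_continuous|].
  by rewrite uR addrAC subrr add0r mulNr lerN2 sqrrN addrC; exact: kernel_bound.
have e4 : 1 <= rint (fun t => Re (u ((Re a + r) +i* t)%C)) (Im a - r) (Im a + r).
  rewrite -(cst1 (Im a)); apply: ler_rint => [t _|t /f4|t /nrm ht]; [exact: cst_continuous|exact: rccont_Re|].
  by rewrite uR addrAC subrr add0r addrC; exact: kernel_bound.
rewrite -[wind a r]/(sq u a r) /sq /rect !ImD ImM ImN ReD ReN /= mul0r mul1r add0r.
by move: e1 e2 e3 e4; rewrite /cint /=; clear; lra.
Qed.

Lemma cauchy f a r z : (forall w, cmax (w - a) <= r -> cdiff f w) -> cmax (z - a) < r ->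
  sq (fun x => f x / (x - z)) a r = f z * wind a r.
Proof. by move=> df zr; rewrite cauchy_gen // wind_const. Qed.

(** The constant 4 is the 16 of [sq_bound] divided by the lower bound 4 for [wind]. In [cdiff_zero]
    it is absorbed by a geometric factor. *)
Lemma cauchy_bound f a r z M : (forall w, cmax (w - a) <= r -> cdiff f w) ->
  cmax (z - a) < r -> (forall w, cmax (w - a) = r -> normc (f w) <= M) ->
  normc (f z) * (r - cmax (z - a)) <= 4 * M * r.
Proof.
move=> df zr fM; have r0 : 0 < r by exact: le_lt_trans (cmax_ge0 _) zr.
set s := r - cmax (z - a); have s0 : 0 < s by rewrite /s subr_gt0.
have far w : cmax (w - a) = r -> s <= normc (w - z).
  move=> wr; apply: le_trans (cmax_normc _); have := cmaxD (w - z) (z - a).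
  by rewrite addrA subrK wr /s; clear; lra.
have wz w : cmax (w - a) = r -> w != z.
  by move=> /far h; rewrite -subr_eq0 -normc_gt0; exact: lt_le_trans s0 h.
have : normc (sq (fun x => f x / (x - z)) a r) <= 16 * (M / s) * r.
  apply: sq_bound => [||w wr]; first exact: ltW.
    by apply: sqcont_diff => w wr; apply: cdiff_kernel; [exact: wz|apply: df; rewrite wr].
  rewrite normcM normcV ler_pM ?invr_ge0 ?normc_ge0 ?fM //.
  by rewrite lef_pV2 ?posrE ?far // normc_gt0 subr_eq0 wz.
rewrite cauchy // normcM => h.
have w4 := wind_ge a r0; have n0 := normc_ge0 (f z).
rewrite -ler_pdivlMr //; apply: (@le_trans _ _ (16 * (M / s) * r / 4)); last first.
  by rewrite le_eqVlt; apply/orP; left; apply/eqP; field; rewrite gt_eqF.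
by rewrite ler_pdivlMr //; apply: le_trans h; rewrite ler_wpM2l.
Qed.

(** Integrate [f] against the expansion 1/(x-w) = 1/(x-a) + (w-a)/(x-a)^2 + (w-a)^2/((x-a)^2 (x-w)):
    the second term yields [l] and the third the remainder. For w in the half-size square |x - w| is
    at least r/2 on the contour. *)
Lemma cauchy_taylor f a r M : 0 < r -> (forall w, cmax (w - a) <= r -> cdiff f w) ->
  (forall w, cmax (w - a) = r -> normc (f w) <= M) ->
  exists l, normc l <= 4 * M / r /\
    forall w, cmax (w - a) <= r / 2 ->
      normc (f w - f a - l * (w - a)) <= 8 * M / r ^+ 2 * normc (w - a) ^+ 2.
Proof.
move=> r0 df fM.
have w4 := wind_ge a r0.
have W0 : wind a r != 0 by rewrite -normc_gt0; apply: lt_le_trans w4.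
have za : cmax (a - a) < r by rewrite subrr cmax0.
have xa w : cmax (w - a) = r -> w != a by move=> wr; rewrite -subr_eq0 -cmax_gt0 wr.
have na w : cmax (w - a) = r -> normc (w - a)^-1 <= r^-1.
  move=> wr; rewrite normcV lef_pV2 ?posrE ?normc_gt0 ?subr_eq0 ?xa //.
  by rewrite -wr cmax_normc.
have M0 : 0 <= M.
  have rc : cmax (a + (r%:C)%C - a) = r.
    by rewrite addrAC subrr add0r /cmax /= normr0 ger0_norm ?ltW // max_l // ltW.
  by apply: le_trans (fM _ rc); exact: normc_ge0.
pose h2 x := f x / (x - a) / (x - a).
have dh2 w : cmax (w - a) = r -> cdiff h2 w.
  by move=> wr; do 2 (apply: cdiff_kernel; first exact: xa); apply: df; rewrite wr.
exists ((wind a r)^-1 * sq h2 a r); split.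
  rewrite normcM normcV mulrC ler_pdivrMr ?normc_gt0 //.
  apply: (@le_trans _ _ (16 * (M / r / r) * r)).
    apply: sq_bound => [||w wr]; [exact: ltW|exact: sqcont_diff|].
    rewrite /h2 !normcM; apply: ler_pM; rewrite ?mulr_ge0 ?normc_ge0 ?na //.
    by apply: ler_pM; rewrite ?normc_ge0 ?fM ?na.
  rewrite (_ : 16 * _ * r = 4 * M / r * 4); last by field; rewrite gt_eqF.
  by rewrite ler_wpM2l // divr_ge0 ?mulr_ge0 // ltW.
move=> w wr2; have wr : cmax (w - a) < r.
  by apply: le_lt_trans wr2 _; rewrite ltr_pdivrMr // ltr_pMr // ltr1n.
have far x : cmax (x - a) = r -> r / 2 <= normc (x - w).
  move=> xr; apply: le_trans (cmax_normc _); have := cmaxD (x - w) (w - a).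
  by rewrite addrA subrK xr; move: wr2; clear; lra.
have xw x : cmax (x - a) = r -> x != w.
  by move=> /far h; rewrite -subr_eq0 -normc_gt0; apply: lt_le_trans h; rewrite divr_gt0.
pose h3 x := f x / (x - a) / (x - a) / (x - w).
have dh3 x : cmax (x - a) = r -> cdiff h3 x.
  by move=> xr; apply: cdiff_kernel; [exact: xw|exact: dh2].
have dk b x : cmax (x - a) = r -> x != b -> cdiff (fun x => f x / (x - b)) x.
  by move=> xr xb; apply: cdiff_kernel => //; apply: df; rewrite xr.
have cc k g : (forall x, cmax (x - a) = r -> cdiff g x) -> forall x, cmax (x - a) = r -> cdiff (fun x => k * g x) x.
  by move=> dg x xr; apply: cdiffM; [exact: cdiff_cst|exact: dg].
have E : sq (fun x => f x / (x - w)) a r = sq (fun x => f x / (x - a)) a r +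
   ((w - a) * sq h2 a r + (w - a) ^+ 2 * sq h3 a r).
  rewrite -!sqZ ?(ltW r0) //; [|exact: sqcont_diff|exact: sqcont_diff].
  rewrite -sqD ?(ltW r0) //; [|exact/sqcont_diff/cc|exact/sqcont_diff/cc].
  rewrite -sqD ?(ltW r0) //; [|by apply: sqcont_diff => x xr; apply: dk => //; exact: xa|].
    apply: eq_sq => [|x xr]; first exact: ltW.
    rewrite /h2 /h3; field.
    by rewrite !subr_eq0 xw ?xa.
  by apply: sqcont_diff => x xr; apply: cdiffD; exact: cc.
move: E; rewrite (cauchy df wr) (cauchy df za) => E.
have -> : f w - f a - (wind a r)^-1 * sq h2 a r * (w - a) = (wind a r)^-1 * sq h3 a r * (w - a) ^+ 2.
  apply: (mulIf W0); rewrite !mulrBl E.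
  by field.
rewrite normcM normcX ler_wpM2r ?sqr_ge0 //.
rewrite normcM normcV mulrC ler_pdivrMr ?normc_gt0 //.
apply: (@le_trans _ _ (16 * (M / r / r * (2 / r)) * r)).
  apply: sq_bound => [||x xr]; [exact: ltW|exact: sqcont_diff|].
  rewrite /h3 normcM ler_pM ?normc_ge0 //.
    rewrite !normcM; apply: ler_pM; rewrite ?mulr_ge0 ?normc_ge0 ?na //.
    by apply: ler_pM; rewrite ?normc_ge0 ?fM ?na.
  rewrite (_ : 2 / r = (r / 2)^-1); last by rewrite invfM invrK mulrC.
  by rewrite normcV lef_pV2 ?posrE ?divr_gt0 ?far // normc_gt0 subr_eq0 xw.
rewrite (_ : 16 * _ * r = 8 * M / r ^+ 2 * 4); last by field; rewrite gt_eqF.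
apply: ler_wpM2l => //; apply: divr_ge0; [exact: mulr_ge0|exact: sqr_ge0].
Qed.

Lemma geom_small (q K e : R) : 0 <= q < 1 -> 0 < e -> exists n, K * q ^+ n < e.
Proof.
move=> /andP[q0 q1] e0.
have K0 : 0 < `|K| + 1 by rewrite ltr_wpDl.
have : (GRing.exp q) @ \oo --> (0 : R) by apply: cvg_expr; rewrite ger0_norm.
move=> /cvgrPdist_lt /(_ (e / (`|K| + 1))); rewrite divr_gt0 // => /(_ isT) [n _ /(_ n (leqnn n))] /=.
rewrite sub0r normrN ger0_norm ?exprn_ge0 // ltr_pdivlMr // => h.
exists n; apply: le_lt_trans h; rewrite mulrC ler_wpM2l ?exprn_ge0 //.
by apply: le_trans (ler_norm K) _; rewrite lerDl.
Qed.

(* f / (w - b)^n is still holomorphic and O(r^-n) on the boundary, for every n *)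
Lemma cdiff_zero f b r s M : 0 < s -> (forall w, cmax (w - b) <= r -> cdiff f w) ->
  (forall w, cmax (w - b) = r -> normc (f w) <= M) ->
  (forall w, cmax (w - b) < s -> f w = 0) -> forall z, normc (z - b) < r -> f z = 0.
Proof.
move=> s0 df fM f0 z zr; have r0 : 0 < r by exact: le_lt_trans (normc_ge0 _) zr.
have [->|zb] := eqVneq z b; first by apply: f0; rewrite subrr cmax0.
have zb0 : 0 < normc (z - b) by rewrite normc_gt0 subr_eq0.
have cr : cmax (z - b) < r by exact: le_lt_trans (cmax_normc _) zr.
have key n : normc (f z) * (r - cmax (z - b)) <= 4 * M * r * (normc (z - b) / r) ^+ n.
  pose g w := f w * ((w - b)^-1) ^+ n.
  have dg w : cmax (w - b) <= r -> cdiff g w.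
    move=> wr; have [->|wb] := eqVneq w b.
      apply: (@cdiff_near (fun=> 0) _ _ s) => // [x xb|]; last exact: cdiff_cst.
      by rewrite /g f0 ?mul0r //; apply: le_lt_trans (cmax_normc _) xb.
    apply: cdiffM; [exact: df|apply: cdiffX; apply: cdiffV; first by rewrite subr_eq0].
    by apply: cdiffB; [exact: cdiff_id|exact: cdiff_cst].
  have gM w : cmax (w - b) = r -> normc (g w) <= M / r ^+ n.
    move=> wr; rewrite /g normcM normcX normcV -exprVn.
    have wb0 : 0 < normc (w - b) by rewrite normc_gt0 -cmax_gt0 wr.
    rewrite ler_pM ?normc_ge0 ?fM ?exprn_ge0 ?invr_ge0 ?normc_ge0 //.
    apply: lerXn2r; rewrite ?nnegrE ?invr_ge0 ?normc_ge0 ?(ltW r0) //.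
    by rewrite lef_pV2 ?posrE // -wr cmax_normc.
  have := cauchy_bound dg cr gM.
  rewrite /g normcM normcX normcV -exprVn => h.
  have E : normc (f z) * (r - cmax (z - b)) =
      normc (z - b) ^+ n * (normc (f z) * (normc (z - b))^-1 ^+ n * (r - cmax (z - b))).
    by rewrite exprVn; field; rewrite expf_neq0 // gt_eqF.
  rewrite E exprMn.
  rewrite (_ : 4 * M * r * _ = normc (z - b) ^+ n * (4 * (M * r^-1 ^+ n) * r)); last by ring.
  by rewrite ler_wpM2l // exprn_ge0 // normc_ge0.
apply: eq0_normc; apply/eqP; rewrite eq_le normc_ge0 andbT leNgt; apply/negP => n0.
have [||n] := @geom_small (normc (z - b) / r) (4 * M * r) (normc (f z) * (r - cmax (z - b))).
- by rewrite divr_ge0 ?normc_ge0 ?(ltW r0) //= ltr_pdivrMr // mul1r.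
- by rewrite mulr_gt0 // subr_gt0.
by rewrite ltNge key.
Qed.
End Goursat.

(** * Holomorphic functions of several variables *)

Section Holomorphic.
Variables (R : realType) (d : nat).
Local Notation C := (Cx R).
Local Notation Cd := (Cd R d).
Implicit Types (f g : Cd -> C) (U : set Cd) (z : Cd).

Lemma cdiff_shift (g : C -> C) (a b : C) : cdiff g (a - b) -> cdiff (fun w => g (w - b)) a.
Proof.
move=> [l hl]; exists l => e /hl[r r0 hr]; exists r => // w.
by have := hr (w - b); rewrite (_ : w - b - (a - b) = w - a); last by ring.
Qed.

Lemma holo_slice U f z j (w : C) : holomorphic_on U f -> U (z + w *: 'e_j) ->
  cdiff (fun w => f (z + w *: 'e_j)) w.
Proof.
move=> hf /hf[_ /(_ j) /cdiffP h].
have := @cdiff_shift _ w w; rewrite subrr => /(_ _ h).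
apply: cdiff_near ltr01 _ => v _; congr f.
by rewrite -addrA -scalerDl (addrC w) subrK.
Qed.

Lemma holo_cont U f z : holomorphic_on U f -> U z -> {for z, continuous f}.
Proof. by move=> hf /hf[]. Qed.

Lemma holo_intro U f : (forall z, U z -> {for z, continuous f}) ->
  (forall z j, U z -> cdiff (fun w => f (z + w *: 'e_j)) 0) -> holomorphic_on U f.
Proof. by move=> cf df z Uz; split=> [|j]; [exact: cf|apply/cdiffP; exact: df]. Qed.

Lemma holo_slice0 U f z j : holomorphic_on U f -> U z -> cdiff (fun w => f (z + w *: 'e_j)) 0.
Proof. by move=> hf /hf[_ /(_ j) /cdiffP]. Qed.

Lemma holo_sub U V f : V `<=` U -> holomorphic_on U f -> holomorphic_on V f.
Proof. by move=> VU hf z /VU /hf. Qed.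

Lemma holo_cst U (k : C) : holomorphic_on U (fun=> k).
Proof. by apply: holo_intro => [z _|z j _]; [exact: cst_continuous|exact: cdiff_cst]. Qed.

Lemma holoD U f g : holomorphic_on U f -> holomorphic_on U g ->
  holomorphic_on U (fun z => f z + g z).
Proof.
move=> hf hg; apply: holo_intro => [z Uz|z j Uz].
  by apply: continuousD; [exact: holo_cont hf Uz|exact: holo_cont hg Uz].
by apply: cdiffD; [exact: holo_slice0 hf Uz|exact: holo_slice0 hg Uz].
Qed.

Lemma holoN U f : holomorphic_on U f -> holomorphic_on U (fun z => - f z).
Proof.
move=> hf; apply: holo_intro => [z Uz|z j Uz].
  by apply: continuousN; exact: holo_cont hf Uz.
have := cdiffB (cdiff_cst (0 : C) 0) (holo_slice0 j hf Uz).
by apply: cdiff_near ltr01 _ => w _; rewrite sub0r.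
Qed.

Lemma holoB U f g : holomorphic_on U f -> holomorphic_on U g ->
  holomorphic_on U (fun z => f z - g z).
Proof. by move=> hf hg; exact: (holoD hf (holoN hg)). Qed.

Lemma continuousMC f g z : {for z, continuous f} -> {for z, continuous g} ->
  {for z, continuous (fun z => f z * g z)}.
Proof.
move=> /continuous_CdC cf /continuous_CdC cg; apply/continuous_CdC => e e0.
pose K := 1 + normc (f z) + normc (g z).
have K0 : 0 < K by rewrite /K -addrA ltr_wpDr // addr_ge0 ?normc_ge0.
have [|r r0 hr] := cf (Num.min 1 (e / K)); first by rewrite lt_min ltr01 divr_gt0.
have [|s s0 hs] := cg (e / K); first by rewrite divr_gt0.
exists (Num.min r s); first by rewrite lt_min r0.
move=> w; rewrite lt_min => /andP[/hr + /hs h3]; rewrite lt_min => /andP[h1 h2].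
rewrite (_ : _ - _ = f w * (g w - g z) + (f w - f z) * g z); last by ring.
apply: le_lt_trans (le_normcD _ _) _; rewrite !normcM.
have h4 : normc (f w) < 1 + normc (f z).
  by apply: le_lt_trans (normcB_tri _ (f z)) _; rewrite ltrD2r.
have -> : e = (1 + normc (f z)) * (e / K) + e / K * normc (g z).
  by rewrite /K; field; rewrite gt_eqF.
rewrite ltr_leD // ?ler_wpM2r ?normc_ge0 ?(ltW h2) //.
by apply: ltr_pM; rewrite ?normc_ge0.
Qed.

Lemma holoM U f g : holomorphic_on U f -> holomorphic_on U g ->
  holomorphic_on U (fun z => f z * g z).
Proof.
move=> hf hg; apply: holo_intro => [z Uz|z j Uz].
  by apply: continuousMC; [exact: holo_cont hf Uz|exact: holo_cont hg Uz].
by apply: cdiffM; [exact: holo_slice0 hf Uz|exact: holo_slice0 hg Uz].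
Qed.

Lemma holoZ U f (k : C) : holomorphic_on U f -> holomorphic_on U (fun z => k * f z).
Proof. by move=> hf; exact: (holoM (@holo_cst U k) hf). Qed.

Lemma holoX U f n : holomorphic_on U f -> holomorphic_on U (fun z => f z ^+ n).
Proof.
move=> hf; elim: n => [|n IH].
  by under eq_fun do rewrite expr0; exact: holo_cst.
by under eq_fun do rewrite exprS; exact: holoM.
Qed.

Lemma holo_sum U I (r : seq I) (F : I -> Cd -> C) : (forall i, holomorphic_on U (F i)) ->
  holomorphic_on U (fun z => \sum_(i <- r) F i z).
Proof.
move=> hF; elim: r => [|i r IH].
  by under eq_fun do rewrite big_nil; exact: holo_cst.
have -> : (fun z => \sum_(k <- i :: r) F k z) = fun z => F i z + \sum_(k <- r) F k z.
    by rewrite funeqE => z; rewrite big_cons.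
  exact: (holoD (hF i) IH).
Qed.

Lemma holo_prod U I (r : seq I) (F : I -> Cd -> C) : (forall i, holomorphic_on U (F i)) ->
  holomorphic_on U (fun z => \prod_(i <- r) F i z).
Proof.
move=> hF; elim: r => [|i r IH].
  by under eq_fun do rewrite big_nil; exact: holo_cst.
have -> : (fun z => \prod_(k <- i :: r) F k z) = fun z => F i z * \prod_(k <- r) F k z.
    by rewrite funeqE => z; rewrite big_cons.
  exact: (holoM (hF i) IH).
Qed.

Lemma cderiv_unique (g : C -> C) a l l' : cderiv g a l -> cderiv g a l' -> l = l'.
Proof.
move=> hl hl'; apply/eqP; rewrite -subr_eq0; apply/eqP; apply: eq0_normc.
apply/eqP; rewrite eq_le normc_ge0 andbT leNgt; apply/negP => n0.
set e := normc (l - l') in n0.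
have e4 : 0 < e / 4 by rewrite divr_gt0.
have [r r0 hr] := hl _ e4; have [s s0 hs] := hl' _ e4.
pose t := Num.min r s / 2.
have t0 : 0 < t by rewrite divr_gt0 // lt_min r0.
have trs : t < Num.min r s by rewrite /t ltr_pdivrMr // ltr_pMr ?ltr1n // lt_min r0.
pose x : C := a + (t%:C)%C.
have nx : normc (x - a) = t by rewrite /x addrAC subrr add0r normcR ger0_norm // ltW.
move: trs; rewrite -nx lt_min => /andP[/hr h1 /hs h2].
have : normc ((l - l') * (x - a)) <= e / 4 * t + e / 4 * t.
  rewrite (_ : (l - l') * (x - a) = (g x - g a - l' * (x - a)) - (g x - g a - l * (x - a))); last by ring.
  by apply: le_trans (le_normcD _ _) _; rewrite normcN -nx lerD.
rewrite normcM nx -/e; have := mulr_gt0 n0 t0.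
have -> : e / 4 * t = e * t / 4 by rewrite mulrAC.
by move: (e * t) => k; clear; lra.
Qed.

Definition pd f (j : 'I_d) z : C :=
  if pselect (cdiff (fun w => f (z + w *: 'e_j)) 0) is left h then sval (cid h) else 0.

Lemma pdP f j z : cdiff (fun w => f (z + w *: 'e_j)) 0 ->
  cderiv (fun w => f (z + w *: 'e_j)) 0 (pd f j z).
Proof. by rewrite /pd; case: pselect => // h _; exact: (svalP (cid h)). Qed.

Lemma pd_taylor U f z r M j : holomorphic_on U f -> 0 < r ->
  (forall w, qn (w - z) <= r -> U w) -> (forall w, qn (w - z) <= r -> normc (f w) <= M) ->
  normc (pd f j z) <= 4 * M / r /\
  forall w : C, cmax w <= r / 2 ->
    normc (f (z + w *: 'e_j) - f z - pd f j z * w) <= 8 * M / r ^+ 2 * normc w ^+ 2.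
Proof.
move=> hf r0 zU fM.
have qw (w : C) : qn (z + w *: 'e_j - z) = cmax w by rewrite addrAC subrr add0r qn_delta.
have [||l [l1 l2]] := @cauchy_taylor R (fun w => f (z + w *: 'e_j)) 0 r M r0.
- by move=> w; rewrite subr0 => wr; apply: (holo_slice hf); apply: zU; rewrite qw.
- by move=> w; rewrite subr0 => wr; apply: fM; rewrite qw wr.
have z0 : z + 0 *: 'e_j = z by rewrite scale0r addr0.
have Uz : U z by apply: zU; rewrite subrr qn0 ltW.
have M0 : 0 <= M by apply: le_trans (fM z _); rewrite ?normc_ge0 // subrr qn0 ltW.
have -> : pd f j z = l.
  apply: cderiv_unique; first exact: (pdP (holo_slice0 j hf Uz)).
  move=> e e0; pose K := 8 * M / r ^+ 2.
  have K0 : 0 <= K by rewrite /K divr_ge0 ?mulr_ge0 // ltW.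
  exists (Num.min (r / 2) (e / (1 + K))); first by rewrite lt_min !divr_gt0 // ltr_wpDr.
  move=> w; rewrite lt_min => /andP[w1]; rewrite ltr_pdivlMr ?ltr_wpDr // => w2.
  have := l2 w; rewrite subr0 in w1 w2 *; move=> /(_ (ltW (le_lt_trans (cmax_normc _) w1))) h.
  apply: le_trans h _; rewrite -/K expr2 mulrA ler_wpM2r ?normc_ge0 //.
  have := normc_ge0 w; move: w2; clear; nra.
split=> // w wr; have := l2 w; rewrite subr0 z0; exact.
Qed.

(** The staircase from [w] to [w'] that changes one coordinate at a time: its k-th point already has
    the first [k] coordinates of [w']. One-variable estimates are summed along it. *)
Definition mix (w w' : Cd) (k : nat) : Cd :=
  \row_j (if (j < k)%N then w' 0 j else w 0 j).

Lemma mix0 (w w' : Cd) : mix w w' 0 = w.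
Proof. by apply/rowP => j; rewrite mxE. Qed.

Lemma mixd (w w' : Cd) : mix w w' d = w'.
Proof. by apply/rowP => j; rewrite mxE ltn_ord. Qed.

Lemma mixS (w w' : Cd) (k : 'I_d) :
  mix w w' k.+1 = mix w w' k + (w' 0 k - w 0 k) *: 'e_k.
Proof.
apply/rowP => j; rewrite !mxE eqxx /= ltnS.
have [->|jk] := eqVneq j k; first by rewrite leqnn ltnn mulr1 addrC subrK.
by rewrite mulr0 addr0 leq_eqVlt (inj_eq val_inj) (negbTE jk).
Qed.

Lemma qn_mix (w w' z : Cd) k r : qn (w - z) <= r -> qn (w' - z) <= r -> qn (mix w w' k - z) <= r.
Proof.
move=> h h'; have r0 : 0 <= r by apply: le_trans h; exact: qn_ge0.
apply/qn_leP => // j; rewrite !mxE; case: ifP => _.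
  by have := cmax_qn (w' - z) j; rewrite !mxE => /le_trans; apply.
by have := cmax_qn (w - z) j; rewrite !mxE => /le_trans; apply.
Qed.

Lemma telescope_coord f (w w' : Cd) (A : 'I_d -> C) (B : 'I_d -> R) :
  (forall k : 'I_d, normc (f (mix w w' k + (w' 0 k - w 0 k) *: 'e_k) - f (mix w w' k)
     - A k * (w' 0 k - w 0 k)) <= B k) ->
  normc (f w' - f w - \sum_(k < d) A k * (w' 0 k - w 0 k)) <= \sum_(k < d) B k.
Proof.
move=> h; have -> : f w' - f w = \sum_(k < d) (f (mix w w' k.+1) - f (mix w w' k)).
  have -> : f w' - f w = f (mix w w' d) - f (mix w w' 0) by rewrite mix0 mixd.
  by rewrite -(telescope_sumr (fun k => f (mix w w' k))) // big_mkord.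
rewrite -sumrB; apply: le_trans (normc_sum _ _ _) _; apply: ler_sum => k _.
by rewrite mixS; exact: h.
Qed.

(** Each step of the staircase is bounded by the one-variable Taylor estimate on squares of size
    r/2, which gives 24 M / r times |h|; passing from |h| to [cmax h] doubles the constant. *)
Lemma holo_lip U f z r M : holomorphic_on U f -> 0 < r ->
  (forall w, qn (w - z) <= r -> U w) -> (forall w, qn (w - z) <= r -> normc (f w) <= M) ->
  forall w w', qn (w - z) <= r / 8 -> qn (w' - z) <= r / 8 ->
    normc (f w' - f w) <= d%:R * (48 * M / r) * qn (w' - w).
Proof.
move=> hf r0 zU fM w w' wr wr'.
have M0 : 0 <= M by apply: le_trans (fM z _); rewrite ?normc_ge0 // subrr qn0 ltW.
have r2 : 0 < r / 2 by rewrite divr_gt0.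
have step (k : 'I_d) : normc (f (mix w w' k + (w' 0 k - w 0 k) *: 'e_k) - f (mix w w' k)
     - 0 * (w' 0 k - w 0 k)) <= 48 * M / r * qn (w' - w).
  set p := mix w w' k; set h := w' 0 k - w 0 k.
  have pz : qn (p - z) <= r / 8 by exact: qn_mix.
  have near x : qn (x - p) <= r / 2 -> qn (x - z) <= r.
    by move=> xp; have := qn_tri x p z; move: xp pz r0; clear; lra.
  have hq : cmax h <= qn (w' - w) by have := cmax_qn (w' - w) k; rewrite !mxE.
  have ww : qn (w' - w) <= r / 4.
    have := qn_tri w' z w; rewrite (qnB_sym z w); move: wr wr'; clear; lra.
  have [||l1 l2] := pd_taylor k hf r2 (z := p) (M := M).
  - by move=> x /near; exact: zU.
  - by move=> x /near; exact: fM.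
  have := l2 h; rewrite (_ : r / 2 / 2 = r / 4); last by field.
  move=> /(_ (le_trans hq ww)) l3.
  rewrite mul0r subr0; apply: le_trans (normcB_tri _ (pd f k p * h)) _; rewrite normcM.
  have hn : normc h <= 2 * cmax h by exact: normc_cmax.
  have hn' : normc h <= r / 2 by move: hn hq ww; clear; lra.
  have n0 := normc_ge0 h.
  apply: (@le_trans _ _ (8 * M / (r / 2) ^+ 2 * (r / 2) * normc h + 4 * M / (r / 2) * normc h)).
    apply: lerD; last by rewrite ler_wpM2r.
    apply: le_trans l3 _; rewrite [normc h ^+ 2]expr2 mulrA ler_wpM2r // ler_wpM2l //.
    by apply: divr_ge0; [exact: mulr_ge0|exact: sqr_ge0].
  rewrite (_ : _ + _ = 24 * M / r * normc h); last by field; rewrite gt_eqF.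
  rewrite (_ : 48 * M / r = 24 * M / r * 2) ?mulrA; last by ring.
  rewrite -[leRHS]mulrA ler_wpM2l //; first by apply: divr_ge0; [exact: mulr_ge0|exact: ltW].
  by move: hn hq; clear; lra.
have := telescope_coord (A := fun=> 0) (B := fun=> _) step.
rewrite sumr_const card_ord -[leRHS]mulr_natl big1 ?subr0 => [h|k _]; last by rewrite mul0r.
by rewrite -[leRHS]mulrA.
Qed.

Lemma C_complete (u : nat -> C) :
  (forall e : R, 0 < e -> exists N, forall m n, (N <= m)%N -> (N <= n)%N -> normc (u m - u n) < e) ->
  exists l, forall e : R, 0 < e -> exists N, forall n, (N <= n)%N -> normc (u n - l) < e.
Proof.
move=> cu.
have lim (v : nat -> R) : (forall m n, `|v m - v n| <= normc (u m - u n)) ->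
    exists l, forall e : R, 0 < e -> exists N, forall n, (N <= n)%N -> `|v n - l| < e.
  move=> vu; have /cvg_ex[l hl] : cvgn v.
    apply/cauchy_cvgP/cauchy_exP => e e0; have [N hN] := cu e e0.
    exists (v N); exists N => // n /= Nn; rewrite -ball_normE /=.
    by apply: le_lt_trans (vu _ _) _; exact: hN.
  exists l => e e0; move/cvgrPdist_lt : hl => /(_ e e0)[N _ hN].
  by exists N => n Nn; rewrite distrC; exact: hN.
have [|x hx] := lim (fun n => complex.Re (u n)).
  by move=> m n; rewrite -ReN -ReD normc_Re.
have [|y hy] := lim (fun n => complex.Im (u n)).
  by move=> m n; rewrite -ImN -ImD normc_Im.
exists (x +i* y)%C => e e0; have e2 : 0 < e / 2 by rewrite divr_gt0.
have [N1 h1] := hx _ e2; have [N2 h2] := hy _ e2.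
exists (maxn N1 N2) => n; rewrite geq_max => /andP[/h1 a1 /h2 a2].
apply: le_lt_trans (normc_le_ReIm _) _; rewrite ReD ImD ReN ImN /=.
by rewrite [e]splitr ltrD.
Qed.

(** Weierstrass' theorem. By the Cauchy estimates the partial derivatives of the approximants form a
    Cauchy sequence, and their quadratic Taylor remainders share one constant [K]; the expansion
    therefore survives in the limit. *)
Lemma holo_limit U f :
  (forall z, U z -> exists2 r : R, 0 < r & forall e : R, 0 < e -> exists2 g,
     holomorphic_on [set w | qn (w - z) < r] g &
     forall w, qn (w - z) < r -> normc (f w - g w) <= e) ->
  holomorphic_on U f.
Proof.
move=> H.
have cf z : U z -> {for z, continuous f}.
  move=> /H[r r0 hr]; apply/continuous_CdC => e e0.
  have [|g hg fg] := hr (e / 4); first by rewrite divr_gt0.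
  have zz : qn (z - z) < r by rewrite subrr qn0.
  have /continuous_CdC := holo_cont hg zz.
  move=> /(_ (e / 4)); rewrite divr_gt0 // => /(_ isT)[s s0 hs].
  exists (Num.min r s); first by rewrite lt_min r0.
  move=> w; rewrite lt_min => /andP[/fg h1 /hs h2]; have h3 := fg _ zz.
  rewrite (_ : f w - f z = (f w - g w) + (g w - g z) - (f z - g z)); last by ring.
  apply: le_lt_trans (le_normcD _ _) _; rewrite normcN.
  have := le_normcD (f w - g w) (g w - g z); move: h1 h2 h3 e0; clear; lra.
apply: holo_intro => // z j Uz.
have [r r0 hr] := H z Uz.
have [g0 hg0 fg0] := hr 1 ltr01.
have cub w : qn (w - z) <= r / 2 -> [set w | qn (w - z) < r] w.
  by move=> /= h; apply: le_lt_trans h _; rewrite ltr_pdivrMr // ltr_pMr // ltr1n.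
have [M M0 hM] : exists2 M : R, 0 < M & forall w, qn (w - z) <= r / 2 -> normc (f w) <= M.
  have [||M M0 hM] := @compact_bound R d [set w | qn (w - z) <= r / 2] (fun w => normc (g0 w)).
  - exact: compact_cube_at.
  - by move=> w /cub hw; apply/continuous_normc; exact: holo_cont hg0 hw.
  exists (M + 1) => [|w hw]; first by rewrite ltr_wpDr.
  have h1 := hM w hw; have h2 := fg0 w (cub _ hw); have := normcB_tri (f w) (g0 w).
  by move: h1 h2; clear; lra.
have r2 : 0 < r / 2 by rewrite divr_gt0.
have inv0 n : 0 < (n.+1%:R : R)^-1 by rewrite invr_gt0.
have /choice[G hG] : forall n : nat, exists g, holomorphic_on [set w | qn (w - z) < r] g /\
     forall w, qn (w - z) < r -> normc (f w - g w) <= n.+1%:R^-1.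
  by move=> n; have [g hg fg] := hr _ (inv0 n); exists g.
pose l n := pd (G n) j z.
have small (e : R) : 0 < e -> exists N, forall n, (N <= n)%N -> n.+1%:R^-1 < e.
  move=> e0; exists (Num.bound e^-1) => n hn.
  rewrite invf_plt ?posrE //; apply: lt_le_trans (archi_boundP _) _; first by rewrite invr_ge0 ltW.
  by rewrite ler_nat; apply: leq_trans hn _.
have dG m n : normc (l m - l n) <= 8 / r * (m.+1%:R^-1 + n.+1%:R^-1).
  have [h1 k1] := hG m; have [h2 k2] := hG n.
  have hB := holoB h1 h2.
  have [|b1 _] := pd_taylor j hB r2 cub (M := m.+1%:R^-1 + n.+1%:R^-1).
    move=> w /cub hw; rewrite (_ : _ - _ = - (f w - G m w) + (f w - G n w)); last by ring.
    by apply: le_trans (le_normcD _ _) _; rewrite normcN lerD ?k1 ?k2.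
  rewrite (_ : l m - l n = pd (fun w => G m w - G n w) j z).
    apply: le_trans b1 _; move: (m.+1%:R^-1 + n.+1%:R^-1) => x.
    by rewrite le_eqVlt; apply/orP; left; apply/eqP; field; rewrite gt_eqF.
  have zz : [set w | qn (w - z) < r] z by rewrite /= subrr qn0.
  have d1 := pdP (holo_slice0 j h1 zz); have d2 := pdP (holo_slice0 j h2 zz).
  apply: cderiv_unique (pdP (holo_slice0 j hB zz)) => e e0.
  have e2 : 0 < e / 2 by rewrite divr_gt0.
  have [s s0 hs] := d1 _ e2; have [t t0 ht] := d2 _ e2.
  exists (Num.min s t); first by rewrite lt_min s0.
  move=> w; rewrite lt_min => /andP[/hs a1 /ht a2].
  rewrite (_ : _ - _ = (G m (z + w *: 'e_j) - G m (z + 0 *: 'e_j) - pd (G m) j z * (w - 0)) -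
      (G n (z + w *: 'e_j) - G n (z + 0 *: 'e_j) - pd (G n) j z * (w - 0))); last by rewrite /l; ring.
  apply: le_trans (le_normcD _ _) _; rewrite normcN.
  rewrite (_ : e * _ = e / 2 * normc (w - 0) + e / 2 * normc (w - 0)); last by field.
  exact: lerD.
have [e e0|L hL] := @C_complete l.
  have [|N hN] := small (e * r / 32); first by rewrite divr_gt0 // mulr_gt0.
  exists N => m n /hN h1 /hN h2; apply: le_lt_trans (dG m n) _.
  rewrite -ltr_pdivlMl ?divr_gt0 // invf_div.
  rewrite (_ : r / 8 * e = 4 * (e * r / 32)); last by field.
  have q0 : 0 < e * r / 32 by rewrite divr_gt0 // mulr_gt0.
  move: (m.+1%:R^-1) (n.+1%:R^-1) (e * r / 32) q0 h1 h2 => x y q; clear; lra.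
pose K := 8 * (M + 1) / (r / 2) ^+ 2.
have K0 : 0 <= K.
  by apply: divr_ge0; [apply: mulr_ge0 => //; apply: addr_ge0 => //; exact: ltW|exact: sqr_ge0].
have qw (w : C) : qn (z + w *: 'e_j - z) = cmax w by rewrite addrAC subrr add0r qn_delta.
have main (w : C) : cmax w <= r / 4 -> normc (f (z + w *: 'e_j) - f z - L * w) <= K * normc w ^+ 2.
  move=> wr; rewrite leNgt; apply/negP => lt.
  set a := normc (_ - _) in lt; set b := K * _ in lt.
  (* Replacing [f] by [G n] and [L] by [l n] costs less than 2e + e|w|, which this choice keeps
     below a - b. *)
  pose e := (a - b) / (4 * (1 + normc w)).
  have w1 : 0 < 1 + normc w by rewrite ltr_wpDr ?normc_ge0.
  have e0 : 0 < e by rewrite divr_gt0 ?subr_gt0 // mulr_gt0.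
  have [N1 hN1] := hL e e0; have [N2 hN2] := small e e0.
  pose n := maxn N1 N2.
  have h1 := hN1 n (leq_maxl _ _); have h2 := hN2 n (leq_maxr _ _).
  have [hg kg] := hG n.
  have [|_ tay] := pd_taylor j hg r2 cub (M := M + 1).
    move=> v hv; have := kg v (cub _ hv); have := hM v hv; have := normcB_tri (G n v) (f v).
    rewrite normcB_sym; have : n.+1%:R^-1 <= (1 : R) by rewrite invf_le1 ?ler1n.
    by move: (n.+1%:R^-1) => x; clear; lra.
  have := tay w; rewrite (_ : r / 2 / 2 = r / 4); last by field.
  move=> /(_ wr); rewrite -/K -/b => h3.
  have c1 : normc (f (z + w *: 'e_j) - G n (z + w *: 'e_j)) <= n.+1%:R^-1.
    by apply: kg; apply: cub; rewrite qw; move: wr r0; clear; lra.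
  have c2 : normc (f z - G n z) <= n.+1%:R^-1 by apply: kg; rewrite subrr qn0.
  have : a <= b + n.+1%:R^-1 + n.+1%:R^-1 + e * normc w.
    rewrite /a (_ : f (z + w *: 'e_j) - f z - L * w = (G n (z + w *: 'e_j) - G n z - pd (G n) j z * w)
      + (f (z + w *: 'e_j) - G n (z + w *: 'e_j)) - (f z - G n z) + (l n - L) * w); last by rewrite /l; ring.
    apply: le_trans (le_normcD _ _) _; rewrite lerD //; last by rewrite normcM ler_wpM2r ?normc_ge0 // ltW.
    apply: le_trans (le_normcD _ _) _; rewrite normcN lerD //.
    by apply: le_trans (le_normcD _ _) _; rewrite lerD.
  have : a - b = e * (4 * (1 + normc w)) by rewrite /e divfK // gt_eqF // mulr_gt0.
  have := normc_ge0 w; move: h2 e0 lt; move: (n.+1%:R^-1) => x; clear; nra.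
exists L => e e0.
exists (Num.min (r / 4) (e / (1 + K))); first by rewrite lt_min !divr_gt0 // ltr_wpDr.
move=> w; rewrite subr0 lt_min => /andP[w1]; rewrite ltr_pdivlMr ?ltr_wpDr // => w2.
rewrite scale0r addr0; apply: le_trans (main _ _) _; first by apply: ltW; apply: le_lt_trans (cmax_normc _) w1.
by rewrite expr2 mulrA ler_wpM2r ?normc_ge0 //; move: w2 (normc_ge0 w); clear; nra.
Qed.

Lemma holo_translate U f (v : Cd) : holomorphic_on U f ->
  holomorphic_on [set w | U (w + v)] (fun w => f (w + v)).
Proof.
move=> hf; apply: holo_intro => [z Uz|z j Uz].
  have /continuous_CdC cf := holo_cont hf Uz; apply/continuous_CdC => e /cf[r r0 hr].
  exists r => // w wr; apply: hr; rewrite (_ : w + v - (z + v) = w - z) //.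
  by rewrite opprD addrACA subrr addr0.
have := holo_slice0 j hf Uz; apply: cdiff_near ltr01 _ => w _.
by rewrite addrAC.
Qed.

(** Difference quotients with a fixed small step are holomorphic, and the Taylor remainder makes
    them uniformly close to the partial derivative; [holo_limit] concludes. *)
Lemma holo_pd U f j : open U -> holomorphic_on U f -> holomorphic_on U (pd f j).
Proof.
move=> /open_Cd oU hf; apply: holo_limit => z Uz.
have [r r0 zU] := oU z Uz.
have r2 : 0 < r / 2 by rewrite divr_gt0.
have cub w : qn (w - z) <= r / 2 -> U w.
  by move=> /= h; apply: zU; apply: le_lt_trans h _; rewrite ltr_pdivrMr // ltr_pMr // ltr1n.
have [||M M0 hM] := @compact_bound R d [set w | qn (w - z) <= r / 2] (fun w => normc (f w)).
- exact: compact_cube_at.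
- by move=> w /cub hw; apply/continuous_normc; exact: holo_cont hf hw.
have r4 : 0 < r / 4 by rewrite divr_gt0.
pose K := 16 * M / (r / 4) ^+ 2.
have K0 : 0 < K by rewrite /K divr_gt0 ?mulr_gt0 ?exprn_gt0.
exists (r / 4) => // e e0.
pose t := Num.min (r / 8) (e / K).
have t0 : 0 < t by rewrite lt_min (divr_gt0 e0 K0) divr_gt0.
pose h : C := (t%:C)%C.
have hn : normc h = t by rewrite normcR ger0_norm // ltW.
have h0 : h != 0 by rewrite -normc_gt0 hn.
have hc : cmax h <= r / 8 by apply: le_trans (cmax_normc _) _; rewrite hn /t ge_min lexx.
have hf4 : holomorphic_on [set w | qn (w - z) < r / 4] f.
  by apply: holo_sub hf => w /= wz; apply: cub; move: wz r0; clear; lra.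
have hft : holomorphic_on [set w | qn (w - z) < r / 4] (fun w => f (w + h *: 'e_j)).
  apply: (holo_sub _ (@holo_translate U f (h *: 'e_j) hf)) => w /= wz; apply: cub.
  have := qnD (w - z) (h *: 'e_j); rewrite addrAC qn_delta; move: hc wz r0; clear; lra.
exists (fun w => h^-1 * (f (w + h *: 'e_j) - f w)).
  exact: (holoZ h^-1 (holoB hft hf4)).
move=> w wz.
have near x : qn (x - w) <= r / 4 -> qn (x - z) <= r / 2.
  by move=> xw; have := qn_tri x w z; move: xw wz r0; clear; lra.
have [||_ tay] := pd_taylor j hf r4 (z := w) (M := M).
- by move=> x /near; exact: cub.
- by move=> x /near; exact: hM.
have := tay h; rewrite (_ : r / 4 / 2 = r / 8); last by field.
move=> /(_ hc) b.
rewrite (_ : _ - _ = - (h^-1 * (f (w + h *: 'e_j) - f w - pd f j w * h))); last by field.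
rewrite normcN normcM normcV hn mulrC ler_pdivrMr //; apply: le_trans b _.
rewrite hn (_ : 8 * M / (r / 4) ^+ 2 = K / 2); last by rewrite /K; field; rewrite gt_eqF.
have : t <= e / K by rewrite /t ge_min lexx orbT.
rewrite ler_pdivlMr // => tK; rewrite expr2 mulrA ler_wpM2r ?(ltW t0) //.
by move: tK (mulr_gt0 t0 K0); rewrite [K / 2 * t]mulrAC [K * t]mulrC; clear; lra.
Qed.

(** Strict differentiability: both points vary while the linear part stays the one at [z]. It rests
    on the continuity of the partial derivatives, and both local injectivity and the estimates
    behind Sard's theorem start from it. *)
Lemma holo_strict U f z : open U -> holomorphic_on U f -> U z ->
  forall e : R, 0 < e -> exists2 r : R, 0 < r & forall w w', qn (w - z) < r -> qn (w' - z) < r ->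
    normc (f w' - f w - \sum_(k < d) pd f k z * (w' 0 k - w 0 k)) <= e * qn (w' - w).
Proof.
move=> /[dup] opU /open_Cd oU hf Uz e e0.
have [r r0 zU] := oU z Uz.
have r2 : 0 < r / 2 by rewrite divr_gt0.
have cub w : qn (w - z) <= r / 2 -> U w.
  by move=> /= h; apply: zU; apply: le_lt_trans h _; rewrite ltr_pdivrMr // ltr_pMr // ltr1n.
have [||M M0 hM] := @compact_bound R d [set w | qn (w - z) <= r / 2] (fun w => normc (f w)).
- exact: compact_cube_at.
- by move=> w /cub hw; apply/continuous_normc; exact: holo_cont hf hw.
have r4 : 0 < r / 4 by rewrite divr_gt0.
pose K := 8 * M / (r / 4) ^+ 2.
have K0 : 0 < K by rewrite /K divr_gt0 ?mulr_gt0 ?exprn_gt0.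
pose e1 := e / (8 * (d%:R + 1)).
have d0 : 0 <= d%:R :> R by [].
have e10 : 0 < e1 by rewrite divr_gt0 // mulr_gt0 // ltr_wpDl.
have /choice[rho hrho] : forall k : 'I_d, exists r : R, 0 < r /\
    forall w, qn (w - z) < r -> normc (pd f k w - pd f k z) < e1.
  move=> k; have /continuous_CdC := holo_cont (holo_pd k opU hf) Uz.
  by move=> /(_ e1 e10)[s s0 hs]; exists s.
have [k _|s s0 hs] := @finite_min R _ (enum 'I_d) rho; first by have [] := hrho k.
pose t := Num.min (Num.min (r / 16) s) (e1 / (8 * K)).
have t0 : 0 < t by rewrite !lt_min s0 !divr_gt0 // mulr_gt0.
have tr : t <= r / 16 by rewrite /t !ge_min lexx.
have ts : t <= s by rewrite /t !ge_min lexx orbT.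
have te : t <= e1 / (8 * K) by rewrite /t !ge_min lexx !orbT.
exists (t / 2) => [|w w' wz wz']; first by rewrite divr_gt0.
have step (k : 'I_d) : normc (f (mix w w' k + (w' 0 k - w 0 k) *: 'e_k) - f (mix w w' k)
     - pd f k z * (w' 0 k - w 0 k)) <= 4 * e1 * qn (w' - w).
  set p := mix w w' k; set h := w' 0 k - w 0 k.
  have pz : qn (p - z) <= t / 2 by apply: qn_mix; exact: ltW.
  have near x : qn (x - p) <= r / 4 -> qn (x - z) <= r / 2.
    by move=> xp; have := qn_tri x p z; move: xp pz tr r0; clear; lra.
  have hq : cmax h <= qn (w' - w) by have := cmax_qn (w' - w) k; rewrite !mxE.
  have ww : qn (w' - w) <= t.
    by have := qn_tri w' z w; rewrite (qnB_sym z w); move: wz wz'; clear; lra.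
  have [||_ tay] := pd_taylor k hf r4 (z := p) (M := M).
  - by move=> x /near; exact: cub.
  - by move=> x /near; exact: hM.
  have := tay h; rewrite (_ : r / 4 / 2 = r / 8); last by field.
  have hr : cmax h <= r / 8 by move: hq ww tr r0; clear; lra.
  move=> /(_ hr); rewrite -/K => b.
  rewrite (_ : _ - _ = (f (p + h *: 'e_k) - f p - pd f k p * h) + (pd f k p - pd f k z) * h); last by ring.
  apply: le_trans (le_normcD _ _) _; rewrite normcM.
  have [_ /(_ p)] := hrho k; have := hs k (mem_enum _ _); move=> srho.
  have pr : qn (p - z) < rho k by move: pz ts srho t0; clear; lra.
  move=> /(_ pr) c.
  have hn : normc h <= 2 * qn (w' - w) by apply: le_trans (normc_cmax _) _; rewrite ler_pM2l.
  have b2 : K * normc h ^+ 2 <= e1 * normc h.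
    rewrite expr2 mulrA ler_wpM2r ?normc_ge0 //.
    have K8 : 0 < 8 * K by exact: mulr_gt0.
    move: te; rewrite ler_pdivlMr // => te.
    have : K * normc h <= K * (2 * t).
      by rewrite ler_wpM2l ?(ltW K0) //; move: hn ww; clear; lra.
    have := mulr_gt0 t0 K0; move: te; rewrite (_ : t * (8 * K) = 8 * (t * K)); last by ring.
    by rewrite (_ : K * (2 * t) = 2 * (t * K)); [clear; lra|ring].
  have b3 : normc (pd f k p - pd f k z) * normc h <= e1 * normc h.
    by rewrite ler_wpM2r ?normc_ge0 // ltW.
  have b4 : e1 * normc h <= e1 * (2 * qn (w' - w)) by rewrite ler_wpM2l // ltW.
  by move: b b2 b3 b4; clear; lra.
apply: le_trans (telescope_coord step) _.
rewrite sumr_const card_ord -[leLHS]mulr_natl mulrA ler_wpM2r ?qn_ge0 //.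
have -> : e = e1 * (8 * (d%:R + 1)) by rewrite /e1 divfK // gt_eqF // mulr_gt0 // ltr_wpDl.
by rewrite mulrA [leRHS]mulrC ler_wpM2r ?(ltW e10) //; move: d0; clear; lra.
Qed.

(** [cdiff_zero] is applied one coordinate at a time: after [k] steps [f] vanishes where the first
    [k] coordinates range over discs of radius [r] and the remaining ones over squares of size
    [s]. *)
Lemma holo_zero_cube U f z r s : holomorphic_on U f -> 0 < s -> 
  (forall w, qn (w - z) <= r -> U w) -> (forall w, qn (w - z) < s -> f w = 0) ->
  forall w : Cd, (forall j, normc (w 0 j - z 0 j) < r) -> f w = 0.
Proof.
move=> hf s0 zU f0.
have [||M M0 hM] := @compact_bound R d [set w | qn (w - z) <= r] (fun w => normc (f w)).
- exact: compact_cube_at.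
- by move=> w /zU hw; apply/continuous_normc; exact: holo_cont hf hw.
have [sr|rs] := ltP s r; last first.
  move=> w hw; have [[j _]|nj] := pselect (exists j : 'I_d, true); last first.
    by apply: f0; apply/qn_ltP => // j; case: nj; exists j.
  apply: f0; apply/qn_ltP => // k; rewrite !mxE.
  by apply: le_lt_trans (cmax_normc _) _; apply: lt_le_trans (hw k) rs.
have r0 : 0 < r by exact: lt_trans s0 sr.
suff key k (w : Cd) : (k <= d)%N -> (forall j : 'I_d, (j < k)%N -> normc (w 0 j - z 0 j) < r) ->
    (forall j : 'I_d, (k <= j)%N -> cmax (w 0 j - z 0 j) < s) -> f w = 0.
  by move=> w hw; apply: (key d) => // j; rewrite leqNgt ltn_ord.
elim: k w => [|k IH] w kd h1 h2.
  by apply: f0; apply/qn_ltP => // j; rewrite !mxE; exact: h2.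
pose o := Ordinal kd.
pose g (u : C) := f (w + (u - w 0 o) *: 'e_o).
have wE u j : (w + (u - w 0 o) *: 'e_o) 0 j = if j == o then u else w 0 j.
  by rewrite !mxE eqxx /=; case: eqVneq => [->|_]; rewrite ?mulr1 ?mulr0 ?addr0 // addrC subrK.
have <- : g (w 0 o) = f w by rewrite /g subrr scale0r addr0.
have dom u : cmax (u - z 0 o) <= r -> qn (w + (u - w 0 o) *: 'e_o - z) <= r.
  move=> ur; apply/qn_leP => [|j]; first exact: ltW.
  rewrite mxE wE mxE; case: eqVneq => [-> //|jo].
  have [jk|kj] := ltnP j k.+1; first by apply: le_trans (cmax_normc _) _; apply/ltW/h1.
  by apply/ltW; apply: lt_trans (h2 j kj) sr.
apply: (@cdiff_zero R g (z 0 o) r s M) => //; last by apply: h1; rewrite /= ltnSn.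
- move=> u ur; have := holo_slice hf (zU _ (dom u ur)).
  by move=> h; apply: (@cdiff_shift (fun v => f (w + v *: 'e_o))); exact: h.
- by move=> u ur; apply: hM; apply: dom; rewrite ur.
- move=> u us; apply: IH; first exact: ltnW.
    move=> j jk; rewrite wE; case: eqVneq => [jo|_]; last by apply: h1; exact: ltnW.
    by move: jk; rewrite jo /= ltnn.
  move=> j kj; rewrite wE; case: eqVneq => [-> //|jo]; apply: h2.
  by rewrite ltn_neqAle kj andbT eq_sym -(inj_eq val_inj) in jo *.
Qed.

Lemma connected_open_closed U A : connected U -> A !=set0 -> A `<=` U -> open A ->
  (forall z, U z -> closure A z -> A z) -> A = U.
Proof.
move=> cU A0 AU oA clA; apply: cU => //.
  by exists A => //; apply/seteqP; split=> [z Az|z []//]; split => //; exact: AU.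
exists (closure A); first exact: closed_closure.
apply/seteqP; split=> [z Az|z [Uz Az]]; last exact: clA.
by split; [exact: AU|exact: subset_closure].
Qed.

(** The points near which [f] vanishes form an open set. It is closed in [U]: around such a point
    close to a given limit point, [holo_zero_cube] spreads the zeros over a polydisc that contains a
    neighbourhood of the limit point. *)
Lemma identity_theorem U f z s : open U -> connected U -> holomorphic_on U f -> U z -> 0 < s ->
  (forall w, qn (w - z) < s -> f w = 0) -> forall w, U w -> f w = 0.
Proof.
move=> /open_Cd oU cU hf Uz s0 f0.
pose A := [set z | U z /\ exists2 s : R, 0 < s & forall w, qn (w - z) < s -> f w = 0].
suff <- : A = U by move=> w [_ [t t0 ht]]; apply: ht; rewrite subrr qn0.
apply: connected_open_closed => //.
- by exists z; split => //; exists s.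
- by move=> w [].
- apply/open_Cd => w [Uw [t t0 ht]]; have [r r0 hr] := oU w Uw.
  exists (Num.min r (t / 2)); first by rewrite lt_min r0 divr_gt0.
  move=> v; rewrite lt_min => /andP[/hr Uv vt]; split => //.
  exists (t / 2) => [|x xv]; first by rewrite divr_gt0.
  by apply: ht; have := qn_tri x v w; move: vt xv; clear; lra.
- move=> w Uw /closure_Cd cw; split => //; have [r r0 hr] := oU w Uw.
  have [|a [Ua [t t0 ht]] aw] := cw (r / 8); first by rewrite divr_gt0.
  exists (r / 8) => [|v vw]; first by rewrite divr_gt0.
  apply: (@holo_zero_cube U f a (r / 2) t) => // [x xa|j].
    by apply: hr; have := qn_tri x a w; move: xa aw r0; clear; lra.
  have := normc_qn (v - a) j; rewrite !mxE => h; apply: le_lt_trans h _.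
  have := qn_tri v w a; rewrite (qnB_sym w a); move: vw aw r0; clear; lra.
Qed.

(** From a^2 - 1 = (a - 1)(a + 1) and |a + 1| >= 3/2, each squaring multiplies the distance to 1 by
    at least 3/2, which cannot go on unless that distance is zero. *)
Lemma near1_powers (a : C) : (forall n, normc (a ^+ n - 1) <= 1 / 2) -> a = 1.
Proof.
move=> h; apply/eqP; rewrite -subr_eq0; apply/eqP/eq0_normc/eqP.
rewrite eq_le normc_ge0 andbT leNgt; apply/negP => n0.
have key k : (3 / 2) ^+ k * normc (a - 1) <= normc (a ^+ (2 ^ k) - 1).
  elim: k => [|k IH]; first by rewrite expr0 mul1r expn0 expr1.
  rewrite expnS mulnC exprM subr_sqr_1 normcM exprS -mulrA.
  have h1 := h (2 ^ k)%N.
  have h2 : 3 / 2 <= normc (a ^+ (2 ^ k) + 1).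
    have : normc (2 : C) = 2 :> R.
      by rewrite (_ : (2 : C) = (2%:C)%C) ?normcR ?ger0_norm // rmorph_nat.
    have := normcB_tri (2 : C) (a ^+ (2 ^ k) + 1).
    rewrite (_ : 2 - (a ^+ (2 ^ k) + 1) = - (a ^+ (2 ^ k) - 1)); last by ring.
    by rewrite normcN; move: h1; clear; lra.
  by rewrite [leRHS]mulrC; apply: ler_pM => //; rewrite mulr_ge0 ?exprn_ge0 ?normc_ge0.
have [|n] := @geom_small R (2 / 3) 1 (normc (a - 1)) _ n0; first by lra.
apply/negP; rewrite -leNgt mul1r (_ : 2 / 3 = (3 / 2)^-1); last by field.
have P : 0 < (3 / 2) ^+ n :> R by rewrite exprn_gt0 //; lra.
rewrite exprVn -[leRHS]mul1r ler_pdivlMr // mulrC.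
by apply: le_trans (key n) _; apply: le_trans (h _) _; lra.
Qed.

(* All powers of f are bounded by 1, hence equicontinuous at a maximum point. *)
Lemma max_principle U f z : open U -> connected U -> holomorphic_on U f -> U z ->
  (forall w, U w -> normc (f w) <= normc (f z)) -> forall w, U w -> f w = f z.
Proof.
move=> opU cU hf Uz fz w Uw.
have [fz0|fz0] := eqVneq (f z) 0.
  by rewrite fz0; apply: eq0_normc; apply/eqP; rewrite eq_le normc_ge0 -normc0 -fz0 fz.
have /open_Cd/(_ z Uz)[r r0 zU] := opU.
pose g v := (f z)^-1 * f v.
have hg : holomorphic_on U g by exact: (holoZ (f z)^-1 hf).
have g1 v : U v -> normc (g v) <= 1.
  by move=> /fz h; rewrite normcM normcV mulrC ler_pdivrMr ?normc_gt0 // mul1r.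
have gz : g z = 1 by rewrite /g mulVf.
have r2 : 0 < r / 2 by rewrite divr_gt0.
have cub v : qn (v - z) <= r / 2 -> U v.
  by move=> /= h; apply: zU; apply: le_lt_trans h _; rewrite ltr_pdivrMr // ltr_pMr // ltr1n.
pose K := d%:R * (48 * 1 / (r / 2)).
have K0 : 0 <= K by rewrite /K mulr_ge0 // divr_ge0 // ltW.
(* [r / 16] is the range of [holo_lip]. The other bound makes [K * t] at most 1/2, and [K] serves
   all powers of [g] at once because they are all bounded by 1. *)
pose t := Num.min (r / 16) (2 * (1 + K))^-1.
have t0 : 0 < t by rewrite lt_min divr_gt0 //= invr_gt0 mulr_gt0 // ltr_wpDr.
have loc v : qn (v - z) < t -> g v = 1.
  rewrite lt_min => /andP[v1 v2]; apply: near1_powers => n.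
  have hgn := holoX n hg.
  have hb x : qn (x - z) <= r / 2 -> normc (g x ^+ n) <= 1.
    by move=> /cub /g1 h; rewrite normcX exprn_ile1 ?normc_ge0.
  have := @holo_lip _ _ z (r / 2) 1 hgn r2 cub hb z v.
  rewrite subrr qn0 gz expr1n -/K => h; apply: le_trans (h _ _) _.
  - by apply: ltW; rewrite divr_gt0.
  - by move: v1; rewrite (_ : r / 2 / 8 = r / 16); [exact: ltW|field].
  apply: (@le_trans _ _ (K * (2 * (1 + K))^-1)); first by rewrite ler_wpM2l // ltW.
  rewrite ler_pdivrMr ?mulr_gt0 ?ltr_wpDr //; move: K0; clear; lra.
have h0 v : qn (v - z) < t -> f v - f z = 0.
  move=> /loc; rewrite /g => h; apply/eqP; rewrite subr_eq0; apply/eqP.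
  by rewrite -[f v](mulVKf fz0) h mulr1.
apply/eqP; rewrite -subr_eq0; apply/eqP.
exact: (identity_theorem opU cU (holoB hf (@holo_cst U (f z))) Uz t0 h0).
Qed.
End Holomorphic.

(** * The integral of nonnegative continuous functions *)

Section Boxes.
Variables (R : realType) (d : nat).
Local Notation C := (Cx R).
Local Notation Cd := (Cd R d).
Local Notation box := (box R d).
Implicit Types (B : box) (D : set Cd) (g : Cd -> R).
Local Notation Re := complex.Re.
Local Notation Im := complex.Im.

(** On an empty box the infimum is +oo, which [fine] turns into 0; such a box has volume 0, so its
    term in a lower sum is 0 either way. *)
Definition minf g B : R := fine (ereal_inf [set (g z)%:E | z in box_set B]).
Definition bterm g B : R := vol B * minf g B.

Lemma vol_ge0 B : 0 <= vol B.
Proof.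
case: B => [[[a b] c] e]; apply: prodr_ge0 => j _.
by rewrite mulr_ge0 // le_max lexx.
Qed.

Lemma vol_gt0_nonempty B : 0 < vol B -> box_set B !=set0.
Proof.
case: B => [[[a b] c] e] /= h; exists (\row_j (a j +i* c j)%C) => j.
rewrite mxE /= !lexx /=; split; rewrite ltNge; apply/negP => le; move: h.
  by rewrite (bigD1 j) //= (max_l (y := b j - a j)) ?mul0r ?ltxx // subr_le0.
by rewrite (bigD1 j) //= (max_l (y := e j - c j)) ?mulr0 ?mul0r ?ltxx // subr_le0.
Qed.

Lemma ereal_inf_box_ge0 g B : (forall z, box_set B z -> 0 <= g z) ->
  (0 <= ereal_inf [set (g z)%:E | z in box_set B])%E.
Proof. by move=> g0; apply: le_ereal_inf_tmp => _ [z /g0 gz <-]; rewrite lee_fin. Qed.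

Lemma minfE g B : (forall z, box_set B z -> 0 <= g z) -> box_set B !=set0 ->
  ereal_inf [set (g z)%:E | z in box_set B] = (minf g B)%:E.
Proof.
move=> g0 [z Bz]; rewrite /minf fineK // ge0_fin_numE ?ereal_inf_box_ge0 //.
by apply: le_lt_trans (ereal_inf_lbound _) (ltry (g z)); exists z.
Qed.

Lemma minf_ge0 g B : (forall z, box_set B z -> 0 <= g z) -> 0 <= minf g B.
Proof. by move=> g0; rewrite /minf fine_ge0 // ereal_inf_box_ge0. Qed.

Lemma minf_le g B z : (forall z, box_set B z -> 0 <= g z) -> box_set B z -> minf g B <= g z.
Proof.
move=> g0 Bz; rewrite -lee_fin -minfE //; last by exists z.
by apply: ereal_inf_lbound; exists z.
Qed.

Lemma minf_ge g B m : (forall z, box_set B z -> 0 <= g z) -> box_set B !=set0 ->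
  (forall z, box_set B z -> m <= g z) -> m <= minf g B.
Proof.
move=> g0 B0 h; rewrite -lee_fin -minfE //.
by apply: le_ereal_inf_tmp => _ [z /h gz <-]; rewrite lee_fin.
Qed.

Lemma btermE g B : (forall z, box_set B z -> 0 <= g z) ->
  ((vol B)%:E * ereal_inf [set (g z)%:E | z in box_set B])%E = (bterm g B)%:E.
Proof.
move=> g0; have := vol_ge0 B; rewrite le_eqVlt => /predU1P[v0|v0].
  by rewrite /bterm -v0 !mul0e mul0r.
by rewrite (minfE g0) //; exact: vol_gt0_nonempty.
Qed.

Lemma lower_sumE D g s : (forall z, D z -> 0 <= g z) -> admissible D s ->
  lower_sum g s = (\sum_(B <- s) bterm g B)%:E.
Proof.
move=> g0 [sD _]; rewrite /lower_sum -sumEFin big_seq [RHS]big_seq.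
by apply: eq_bigr => B /sD BD; rewrite btermE // => z /BD; exact: g0.
Qed.

Lemma integral_ge D g s : (forall z, D z -> 0 <= g z) -> admissible D s ->
  ((\sum_(B <- s) bterm g B)%:E <= integral_open D g)%E.
Proof. by move=> g0 sD; rewrite -(lower_sumE g0 sD); apply: ereal_sup_ubound; exists s. Qed.

Lemma integral_le D g (c : \bar R) : (forall z, D z -> 0 <= g z) ->
  (forall s, admissible D s -> ((\sum_(B <- s) bterm g B)%:E <= c)%E) ->
  (integral_open D g <= c)%E.
Proof.
move=> g0 h; apply: ub_ereal_sup => _ [s sD <-].
by rewrite (lower_sumE g0 sD); exact: h.
Qed.

Lemma admissible_nil D : admissible D [::].
Proof. by split => [B|i j]; rewrite ?in_nil. Qed.

Lemma integral_ge0 D g : (forall z, D z -> 0 <= g z) -> (0 <= integral_open D g)%E.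
Proof.
by move=> g0; apply: le_trans (integral_ge g0 (admissible_nil D)); rewrite big_nil.
Qed.

Lemma integral_mono D g1 g2 : (forall z, D z -> 0 <= g1 z) ->
  (forall z, D z -> g1 z <= g2 z) -> (integral_open D g1 <= integral_open D g2)%E.
Proof.
move=> g0 g12; have g20 z : D z -> 0 <= g2 z by move=> Dz; apply: le_trans (g0 z Dz) (g12 z Dz).
apply: integral_le => // s sD; apply: le_trans (integral_ge g20 sD).
rewrite lee_fin big_seq [leRHS]big_seq; apply: ler_sum => B Bs.
have BD := sD.1 B Bs; have g0' z (Bz : box_set B z) := g0 z (BD z Bz).
have := vol_ge0 B; rewrite /bterm le_eqVlt => /predU1P[<-|v0]; first by rewrite !mul0r.
rewrite ler_wpM2l ?(ltW v0) //; apply: minf_ge; first by move=> z /BD /g20.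
  exact: vol_gt0_nonempty.
by move=> z Bz; apply: le_trans (minf_le g0' Bz) (g12 z (BD z Bz)).
Qed.

Lemma eq_integral_open D g1 g2 : (forall z, D z -> 0 <= g1 z) ->
  (forall z, D z -> g1 z = g2 z) -> integral_open D g1 = integral_open D g2.
Proof.
move=> g0 g12; apply/eqP; rewrite eq_le !integral_mono // => z Dz; rewrite -?g12 //.
exact: g0.
Qed.

Lemma integral_box_ge D g B m : (forall z, D z -> 0 <= g z) -> box_set B `<=` D -> 0 <= m ->
  (forall z, box_set B z -> m <= g z) -> ((vol B * m)%:E <= integral_open D g)%E.
Proof.
move=> g0 BD m0 mg; have sD : admissible D [:: B].
  split=> [B'|[|i] [|j]] //=; first by rewrite inE => /eqP ->.
apply: le_trans (integral_ge g0 sD); rewrite big_seq1 lee_fin /bterm.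
have := vol_ge0 B; rewrite le_eqVlt => /predU1P[<-|v0]; first by rewrite !mul0r.
rewrite ler_wpM2l ?(ltW v0) //; apply: minf_ge => //; first by move=> z /BD /g0.
exact: vol_gt0_nonempty.
Qed.

(** Sides may become negative; [vol] counts them as 0. *)
Definition shrink (t : R) B : box := let: (a, b, c, e) := B in
  (fun j => a j + t, fun j => b j - t, fun j => c j + t, fun j => e j - t).

Lemma vol_shrink B (eps : R) : 0 < eps ->
  exists2 t0 : R, 0 < t0 & forall t, 0 <= t <= t0 -> vol B - eps <= vol (shrink t B).
Proof.
case: B => [[[a b] c] e] e0.
have : (fun t => vol (shrink t (a, b, c, e))) @ (0 : R) --> vol (a, b, c, e).
  rewrite /vol /=.
  have F j : (fun t : R => Num.max 0 (b j - t - (a j + t)) * Num.max 0 (e j - t - (c j + t))) @ (0 : R)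
      --> Num.max 0 (b j - a j) * Num.max 0 (e j - c j).
    have G (x y : R) : (fun t : R => Num.max 0 (y - t - (x + t))) @ (0 : R) --> Num.max 0 (y - x).
      have -> : Num.max 0 (y - x) = Num.max 0 (y - 0 - (x + 0)) by rewrite subr0 addr0.
      apply: (@cvg_comp _ _ _ (fun t : R => y - t - (x + t)) (fun u => Num.max 0 u)).
        apply: cvgB; first by apply: cvgB; [exact: cvg_cst|exact: cvg_id].
        by apply: cvgD; [exact: cvg_cst|exact: cvg_id].
      move=> A /nbhs_ballP[q /= q0 hA]; apply/nbhs_ballP; exists q => //= u.
      rewrite -ball_normE /= => hu; apply: hA; rewrite -ball_normE /=.
      apply: le_lt_trans hu; rewrite ler_norml !maxEle.
      move: (y - 0 - (x + 0)) => v; have := ler_norm (v - u); have := ler_norm (u - v); rewrite distrC.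
      by case: ifP => h1; case: ifP => h2; move: h1 h2; clear; lra.
    by apply: cvgM; exact: G.
  elim: (index_enum _) => [|j r IH].
    under eq_fun do rewrite big_nil; rewrite big_nil; exact: cvg_cst.
  under eq_fun do rewrite big_cons; rewrite big_cons; exact: cvgM.
move=> /cvgrPdist_lt /(_ eps e0) /nbhs_ballP[t /= t0 ht].
exists (t / 2) => [|u /andP[u0 ut]]; first by rewrite divr_gt0.
have := ht u; rewrite -ball_normE /= sub0r normrN ger0_norm // => /(_ _).
move=> h; have {h} : `|vol (a, b, c, e) - vol (shrink u (a, b, c, e))| < eps.
  by apply: h; move: ut t0; clear; lra.
by rewrite ltr_norml => /andP[_ h]; move: h; rewrite lerBlDr -lerBlDl; exact: ltW.
Qed.

(** * Grids refining all families of boxes at once *)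

Section Grid.
Variable n : nat.
Let N : R := n.+1%:R.
(** With N = n + 1, the grid has mesh 1/N and covers [-N, N) in each real coordinate, so that as [n]
    grows it refines and exhausts the space simultaneously. *)
Definition gcells := (2 * n.+1 ^ 2)%N.
Definition gpt (i : nat) : R := i%:R / N - N.

Lemma gN_gt0 : 0 < N. Proof. by rewrite /N. Qed.

Lemma gptS i : gpt i.+1 = gpt i + N^-1.
Proof. by rewrite /gpt -addn1 natrD mulrDl mul1r addrAC. Qed.

Lemma gpt_lt i j : (i < j)%N -> gpt i < gpt j.
Proof. by move=> ij; rewrite /gpt ltrD2r ltr_pM2r ?invr_gt0 ?gN_gt0 // ltr_nat. Qed.

Lemma gpt0 : gpt 0 = - N. Proof. by rewrite /gpt mul0r sub0r. Qed.

Lemma gptM : gpt gcells = N.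
Proof. by rewrite /gpt /gcells natrM natrX -/N; have := gN_gt0 => h; field; rewrite gt_eqF. Qed.

Definition gind (a b : R) (i : nat) : bool := (a <= gpt i) && (gpt i.+1 <= b).
Definition glen (a b : R) : R := \sum_(i < gcells) (gind a b i)%:R / N.

Lemma glen_ge0 a b : 0 <= glen a b.
Proof. by apply: sumr_ge0 => i _; rewrite divr_ge0 // ltW // gN_gt0. Qed.

(** The length of the part of [a, b] inside [-N, N], written as the sum of the lengths that the
    single cells cut out. [glen] is compared with it cell by cell. *)
Lemma clamp_sum (a b : R) : a <= b ->
  \sum_(i < gcells) (Num.max a (Num.min b (gpt i.+1)) - Num.max a (Num.min b (gpt i))) =
  Num.max a (Num.min b N) - Num.max a (Num.min b (- N)).
Proof.
move=> ab; transitivity (Num.max a (Num.min b (gpt gcells)) - Num.max a (Num.min b (gpt 0))).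
  by rewrite -(telescope_sumr (fun i => Num.max a (Num.min b (gpt i)))) // big_mkord.
by rewrite gptM gpt0.
Qed.

Lemma glen_le a b : glen a b <= Num.max 0 (b - a).
Proof.
have [ab|ba] := leP a b; last first.
  rewrite /glen big1 ?le_max ?lexx // => i _; rewrite /gind.
  case: (boolP (_ && _)) => [/andP[h1 h2]|_]; last by rewrite mul0r.
  have := lt_le_trans (gpt_lt (ltnSn i)) h2; move/(le_lt_trans h1).
  by move/lt_trans/(_ ba); rewrite ltxx.
rewrite max_r ?subr_ge0 //.
apply: (@le_trans _ _ (Num.max a (Num.min b N) - Num.max a (Num.min b (- N)))).
  rewrite -clamp_sum //; apply: ler_sum => i _.
  have h := gptS i; have N1 : 0 < N^-1 by rewrite invr_gt0 gN_gt0.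
  rewrite /gind; case: (boolP (a <= gpt i)) => /= h1; [case: (boolP (gpt i.+1 <= b)) => /= h2|];
    rewrite ?mul1r ?mul0r.
  - rewrite (@min_r _ _ b (gpt i.+1)) // (@min_r _ _ b (gpt i)); last by move: (N^-1) h h2 N1 => q; clear; lra.
    by rewrite !max_r //; move: (N^-1) h h1 N1 => q; clear; lra.
  - rewrite h !maxEle !minEle; move: (N^-1) N1 => q; move: (gpt i) => x.
    by do !case: ifP; clear; lra.
  - rewrite h !maxEle !minEle; move: (N^-1) N1 => q; move: (gpt i) => x.
    by do !case: ifP; clear; lra.
rewrite lerB // ?ge_max ?ab ?ge_min ?lexx // le_max lexx //.
Qed.

(** After moving both ends inwards by one mesh, a cell that meets the smaller interval in positive
    length lies in [a, b], and is thus counted by [glen]. *)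
Lemma glen_ge a b : - N <= a -> b <= N -> b - a - 2 / N <= glen a b.
Proof.
move=> Na bN; have N1 : 0 < N^-1 by rewrite invr_gt0 gN_gt0.
have [ba|ab] := leP (b - N^-1) (a + N^-1).
  by apply: le_trans (glen_ge0 a b); move: (N^-1) ba => q; clear; lra.
set a' := a + N^-1 in ab *; set b' := b - N^-1 in ab *.
have -> : b - a - 2 / N = Num.max a' (Num.min b' N) - Num.max a' (Num.min b' (- N)).
  rewrite (@min_l _ _ b' N) ?(@min_r _ _ b' (- N)) ?(@max_r _ _ a' b') ?(@max_l _ _ a' (- N)) //.
  - by rewrite /a' /b'; move: (N^-1) => q; ring.
  - by rewrite /a'; move: (N^-1) Na N1 => q; clear; lra.
  - exact: ltW.
  - by move: ab; rewrite /a' /b'; move: (N^-1) Na N1 => q; clear; lra.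
  - by rewrite /b'; move: (N^-1) bN N1 => q; clear; lra.
rewrite -clamp_sum; last exact: ltW.
apply: ler_sum => i _; have h := gptS i.
rewrite /gind; case: (boolP (a <= gpt i)) => /= h1; [case: (boolP (gpt i.+1 <= b)) => /= h2|];
  rewrite ?mul1r ?mul0r.
- rewrite h !maxEle !minEle; move: (N^-1) N1 => q; move: (gpt i) => x.
  by do !case: ifP; clear; lra.
- rewrite (@min_l _ _ b' (gpt i.+1)) ?(@min_l _ _ b' (gpt i)) ?subrr //;
  by move: h h2; rewrite /b' -ltNge; move: (N^-1) N1 => q; clear; lra.
- rewrite (@max_l _ _ a' (Num.min b' (gpt i.+1))) ?(@max_l _ _ a' (Num.min b' (gpt i))) ?subrr //;
  by rewrite ge_min /a'; apply/orP; right; move: h h1; rewrite -ltNge; move: (N^-1) N1 => q; clear; lra.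
Qed.

Definition gidx := {ffun 'I_d -> 'I_gcells * 'I_gcells}.

Definition gbox (k : gidx) : box :=
  (fun j => gpt (k j).1, fun j => gpt (k j).1.+1, fun j => gpt (k j).2, fun j => gpt (k j).2.+1).

Definition gvol : R := \prod_(j < d) (N^-1 * N^-1).

Lemma vol_gbox k : vol (gbox k) = gvol.
Proof.
apply: eq_bigr => j _; rewrite !gptS ![_ + N^-1 - _]addrAC !subrr !add0r.
by rewrite max_r // ltW // invr_gt0 gN_gt0.
Qed.

Lemma gvol_ge0 : 0 <= gvol.
Proof. by apply: prodr_ge0 => j _; rewrite mulr_ge0 // ltW // invr_gt0 gN_gt0. Qed.

Definition ginb (k : gidx) B : bool := let: (a, b, c, e) := B in
  [forall j, gind (a j) (b j) (k j).1 && gind (c j) (e j) (k j).2].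

Lemma ginb_sub k B : ginb k B -> box_set (gbox k) `<=` box_set B.
Proof.
case: B => [[[a b] c] e] /forallP h z zk j; have [/andP[z1 z2] /andP[z3 z4]] := zk j.
have /andP[/andP[a1 b1] /andP[c1 e1]] := h j.
by split; apply/andP; split; [exact: le_trans a1 z1|exact: lt_le_trans z2 b1|
  exact: le_trans c1 z3|exact: lt_le_trans z4 e1].
Qed.

Lemma gbox_nonempty k : box_set (gbox k) (\row_j (gpt (k j).1 +i* gpt (k j).2)%C).
Proof. by move=> j; rewrite mxE /= !lexx !gpt_lt. Qed.

Lemma gbox_disj k k' : k != k' -> box_set (gbox k) `&` box_set (gbox k') = set0.
Proof.
move=> kk; apply/seteqP; split=> // z [h h'].
case/negP: kk; apply/eqP/ffunP => j.
have [/andP[z1 z2] /andP[z3 z4]] := h j; have [/andP[z1' z2'] /andP[z3' z4']] := h' j.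
have aux (i i' : nat) x : gpt i <= x -> x < gpt i'.+1 -> (i <= i')%N.
  move=> h1 h2; rewrite -ltnS ltnNge; apply/negP; rewrite leq_eqVlt => /predU1P[e|e].
    by have := le_lt_trans h1 h2; rewrite e ltxx.
  by have := lt_trans (le_lt_trans h1 h2) (gpt_lt e); rewrite ltxx.
have e1 : (k j).1 = (k' j).1.
  by apply/val_inj/eqP; rewrite eqn_leq (aux _ _ _ z1 z2') (aux _ _ _ z1' z2).
have e2 : (k j).2 = (k' j).2.
  by apply/val_inj/eqP; rewrite eqn_leq (aux _ _ _ z3 z4') (aux _ _ _ z3' z4).
by move: e1 e2; case: (k j) => ? ?; case: (k' j) => ? ? /= -> ->.
Qed.

Definition gmeas B : R := \sum_k (ginb k B)%:R * gvol.

(** A cell lies in a box as soon as this holds in each real coordinate, so the count factorizes by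
    distributivity. *)
Lemma gmeasE B : gmeas B = let: (a, b, c, e) := B in
  \prod_(j < d) (glen (a j) (b j) * glen (c j) (e j)).
Proof.
case: B => [[[a b] c] e]; rewrite /gmeas.
have -> : \prod_(j < d) (glen (a j) (b j) * glen (c j) (e j)) =
  \prod_(j < d) \sum_(p : 'I_gcells * 'I_gcells)
     ((gind (a j) (b j) p.1)%:R / N * ((gind (c j) (e j) p.2)%:R / N)).
  apply: eq_bigr => j _; rewrite /glen big_distrlr /= pair_bigA /=.
  by apply: eq_bigr => -[p q].
rewrite bigA_distr_bigA /=; apply: eq_bigr => k _.
rewrite (eq_bigr (fun j => ((gind (a j) (b j) (k j).1 && gind (c j) (e j) (k j).2)%:R : R) * (N^-1 * N^-1))).
  rewrite big_split -/gvol; congr (_ * _).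
  case: (boolP [forall j, gind (a j) (b j) (k j).1 && gind (c j) (e j) (k j).2]) => [/forallP h|].
    by rewrite big1 // => j _; rewrite h.
  by rewrite negb_forall => /existsP[j nj]; rewrite (bigD1 j) //= (negbTE nj) mul0r.
by move=> j _; rewrite -mulnb natrM mulrACA.
Qed.

Lemma gmeas_le B : gmeas B <= vol B.
Proof.
rewrite gmeasE; case: B => [[[a b] c] e]; apply: ler_prod => j _.
by rewrite mulr_ge0 ?glen_ge0 //= ler_pM ?glen_ge0 ?glen_le.
Qed.

Lemma gmeas_ge B : (let: (a, b, c, e) := B in
   forall j, - N <= a j /\ b j <= N /\ - N <= c j /\ e j <= N) ->
  vol (shrink N^-1 B) <= gmeas B.
Proof.
rewrite gmeasE; case: B => [[[a b] c] e] h; apply: ler_prod => j _.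
have [h1 [h2 [h3 h4]]] := h j.
have aux x y : - N <= x -> y <= N -> Num.max 0 (y - N^-1 - (x + N^-1)) <= glen x y.
  move=> hx hy; rewrite ge_max glen_ge0 /=; apply: le_trans (glen_ge hx hy).
  by move: (N^-1) => q; clear; lra.
by rewrite mulr_ge0 ?le_max ?lexx //= ler_pM ?le_max ?lexx ?aux.
Qed.

(** Cells are nonempty and the boxes of an admissible family disjoint, so a cell lies in at most one
    of them. *)
Lemma ginb_sum D (s : seq box) k : admissible D s ->
  (\sum_(B <- s) (ginb k B)%:R : R) <= (`[< box_set (gbox k) `<=` D >])%:R.
Proof.
move=> [sD dis].
have [/hasP[B Bs kB]|/hasPn h] := boolP (has (ginb k) s); last first.
  by rewrite big_seq big1 // => B /h /negbTE ->.
rewrite asboolT; last by apply: subset_trans (ginb_sub kB) (sD _ Bs).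
set x0 : box := (0, 0, 0, 0).
rewrite (big_nth x0) big_mkord.
have ilt : (index B s < size s)%N by rewrite index_mem.
rewrite (bigD1 (Ordinal ilt)) //= nth_index // kB big1 ?addr0 // => i ni.
case: (boolP (ginb k _)) => // ki; exfalso.
have ne : nat_of_ord i <> index B s.
  by move=> e; case/negP: ni; apply/eqP/val_inj.
have := dis i (index B s) (ltn_ord i) ilt ne; rewrite nth_index //.
by move/seteqP => [/(_ _ (conj (ginb_sub ki (gbox_nonempty k)) (ginb_sub kB (gbox_nonempty k))))].
Qed.

Definition gsum D g : R := \sum_(k | `[< box_set (gbox k) `<=` D >]) bterm g (gbox k).

Lemma gsum_le D g : (forall z, D z -> 0 <= g z) -> ((gsum D g)%:E <= integral_open D g)%E.
Proof.
move=> g0; pose t := [seq k <- enum gidx | `[< box_set (gbox k) `<=` D >]].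
have -> : gsum D g = \sum_(B <- [seq gbox k | k <- t]) bterm g B.
  by rewrite big_map big_filter /gsum big_enum_cond.
have ut : uniq t by rewrite filter_uniq ?enum_uniq.
apply: integral_ge => //; split=> [B /mapP[k]|i j].
  by rewrite mem_filter => /andP[/asboolP h _] ->.
rewrite size_map => hi hj ij.
have [k0 _] : exists k0 : gidx, true by case: (t) hi => // k0; exists k0.
by rewrite !(nth_map k0) //; apply: gbox_disj; rewrite nth_uniq //; apply/eqP.
Qed.

(** Redistributes a weighted sum over boxes to the grid cells, each of which is charged at most once
    by [ginb_sum]. It is used with [f] the identity or a shrinking of boxes, and [t] the oscillation
    tolerated on one cell. *)
Lemma gmeas_sum_le D (s : seq box) (w : box -> R) (v : gidx -> R) (t : R) :
  admissible D s -> (forall k, 0 <= v k) -> 0 <= t ->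
  forall f : box -> box, (forall k B, ginb k (f B) -> ginb k B) ->
  (forall B k, B \in s -> ginb k (f B) -> w B <= v k + t) ->
  \sum_(B <- s) gmeas (f B) * w B <=
  (\sum_(k | `[< box_set (gbox k) `<=` D >]) gvol * v k) + t * \sum_(B <- s) gmeas (f B).
Proof.
move=> sD v0 t0 f fB h.
apply: (@le_trans _ _ (\sum_(B <- s) \sum_k ((ginb k B)%:R * (gvol * v k) + t * ((ginb k (f B))%:R * gvol)))).
  rewrite big_seq [leRHS]big_seq; apply: ler_sum => B Bs.
  rewrite /gmeas mulr_suml; apply: ler_sum => k _.
  case: (boolP (ginb k (f B))) => [kB|_]; last first.
    by rewrite !mul0r mulr0 addr0 mulr_ge0 // mulr_ge0 // gvol_ge0.
  by rewrite (fB _ _ kB) !mul1r [t * _]mulrC -mulrDr ler_wpM2l ?gvol_ge0 // h.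
rewrite exchange_big [X in _ <= X + _]big_mkcond.
have -> : t * \sum_(B <- s) gmeas (f B) = \sum_k \sum_(B <- s) t * ((ginb k (f B))%:R * gvol).
  by rewrite exchange_big mulr_sumr; apply: eq_bigr => B _; rewrite /gmeas mulr_sumr.
rewrite -big_split; apply: ler_sum => k _; rewrite big_split lerD2r -mulr_suml.
apply: le_trans (ler_wpM2r _ (ginb_sum k sD)) _; first by rewrite mulr_ge0 ?gvol_ge0.
by case: (asbool _); rewrite ?mul1r ?mul0r.
Qed.
End Grid.

Lemma inv_small (e : R) : 0 < e -> exists n0, forall n, (n0 <= n)%N -> (n.+1%:R : R)^-1 < e.
Proof.
move=> e0; exists (Num.bound e^-1) => n hn.
rewrite invf_plt ?posrE //; apply: lt_le_trans (archi_boundP _) _; first by rewrite invr_ge0 ltW.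
by rewrite ler_nat; apply: leq_trans hn _.
Qed.

Lemma big_nat_ge (M : R) : exists n0, forall n, (n0 <= n)%N -> M <= n.+1%:R.
Proof.
exists (Num.bound `|M|) => n hn; apply: le_trans (ler_norm _) _; apply: ltW.
apply: lt_le_trans (archi_boundP _) _ => //.
by rewrite ler_nat; apply: leq_trans hn _.
Qed.

Lemma gmeas_lim B (e : R) : 0 < e -> exists n0, forall n, (n0 <= n)%N -> vol B - e <= gmeas n B.
Proof.
move=> e0; have [t t0 ht] := vol_shrink B e0.
have [n1 h1] := inv_small t0.
have [n2 h2] : exists n2, forall n, (n2 <= n)%N -> (let: (a, b, c, e) := B in
   forall j, - (n.+1%:R : R) <= a j /\ b j <= n.+1%:R /\ - (n.+1%:R : R) <= c j /\ e j <= n.+1%:R).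
  case: (B) => [[[a b] c] e'].
  pose M := \sum_j (`|a j| + `|b j| + `|c j| + `|e' j|).
  have [n2 h2] := big_nat_ge M; exists n2 => n /h2 Mn j.
  have : `|a j| + `|b j| + `|c j| + `|e' j| <= n.+1%:R.
    by apply: le_trans Mn; rewrite /M (bigD1 j) //= lerDl; apply: sumr_ge0 => i _; rewrite !addr_ge0.
  have := ler_norm (- a j); have := ler_norm (b j); have := ler_norm (- c j); have := ler_norm (e' j).
  rewrite !normrN; have := normr_ge0 (a j); have := normr_ge0 (b j); have := normr_ge0 (c j).
  by have := normr_ge0 (e' j); move: (n.+1%:R) => x; clear; do !split; lra.
exists (maxn n1 n2) => n; rewrite geq_max => /andP[/h1 l1 /h2 l2].
by apply: le_trans (gmeas_ge l2); apply: ht; rewrite invr_ge0 ler0n ltW.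
Qed.

Lemma seq_lim (s : seq box) (w : box -> R) (f : box -> box) (e : R) :
  (forall B, B \in s -> 0 <= w B) -> 0 < e ->
  exists n0, forall n, (n0 <= n)%N ->
    \sum_(B <- s) vol (f B) * w B - e <= \sum_(B <- s) gmeas n (f B) * w B.
Proof.
elim: s e => [|B s IH] e w0 e0; first by exists 0%N => n _; rewrite !big_nil sub0r oppr_le0 ltW.
have wB : 0 <= w B by apply: w0; rewrite inE eqxx.
have e2 : 0 < e / 2 by rewrite divr_gt0.
have [|n1 h1] := IH (e / 2) _ e2; first by move=> B' B's; apply: w0; rewrite inE B's orbT.
have [n2 h2] := @gmeas_lim (f B) (e / 2 / (1 + w B)) ltac:(by rewrite divr_gt0 // ltr_wpDr).
exists (maxn n1 n2) => n; rewrite geq_max => /andP[/h1 l1 /h2 l2].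
rewrite !big_cons.
have : (vol (f B) - e / 2 / (1 + w B)) * w B <= gmeas n (f B) * w B by rewrite ler_wpM2r.
have : e / 2 / (1 + w B) * w B <= e / 2.
  rewrite mulrAC ler_pdivrMr ?ltr_wpDr // ler_wpM2l ?(ltW e2) //; move: wB; clear; lra.
rewrite mulrBl; move: l1; move: (\sum_(_ <- _) _) (\sum_(_ <- _) _) => x y; clear; lra.
Qed.

Lemma ginb_shrink n k t B : 0 <= t -> ginb (n:=n) k (shrink t B) -> ginb k B.
Proof.
case: B => [[[a b] c] e] t0 /forallP h; apply/forallP => j.
have /andP[/andP[a1 b1] /andP[c1 e1]] := h j.
rewrite /gind; apply/andP; split; apply/andP; split.
- by apply: le_trans a1; rewrite lerDl.
- by apply: le_trans b1 _; rewrite gerBl.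
- by apply: le_trans c1; rewrite lerDl.
- by apply: le_trans e1 _; rewrite gerBl.
Qed.

(** Grid sums recover every lower sum up to [e]. Thus the integrals of several functions are
    approached on one and the same grid, as additivity requires. *)
Lemma gsum_lim D g s (e : R) : (forall z, D z -> 0 <= g z) -> admissible D s -> 0 < e ->
  exists n0, forall n, (n0 <= n)%N -> \sum_(B <- s) bterm g B - e <= gsum n D g.
Proof.
move=> g0 sD e0.
have w0 B : B \in s -> 0 <= minf g B by move=> /sD.1 BD; apply: minf_ge0 => z /BD /g0.
have [n0 h] := seq_lim id w0 e0; exists n0 => n /h l; apply: le_trans l _.
pose v (k : gidx n) := if `[< box_set (gbox k) `<=` D >] then minf g (gbox k) else 0.
have := @gmeas_sum_le n D s (minf g) v 0 sD _ (lexx 0) id _ _.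
rewrite mul0r addr0 => l; apply: le_trans (l _ _ _) _ => //.
- move=> k; rewrite /v; case: ifP => // /asboolP kD; apply: minf_ge0 => z /kD; exact: g0.
- move=> B k Bs kB; rewrite addr0 /v; have kB' := ginb_sub kB.
  have BD := sD.1 B Bs; have kD := subset_trans kB' BD; rewrite asboolT //.
  apply: minf_ge => [z /kD /g0 //||z /kB' Bz]; first by eexists; exact: gbox_nonempty.
  by apply: minf_le => // x /BD /g0.
- rewrite /gsum le_eqVlt; apply/orP; left; apply/eqP; apply: eq_bigr => k kD.
  by rewrite /bterm vol_gbox /v kD.
Qed.

Lemma bterm_gsumD n D g1 g2 : (forall z, D z -> 0 <= g1 z) -> (forall z, D z -> 0 <= g2 z) ->
  gsum n D g1 + gsum n D g2 <= gsum n D (fun z => g1 z + g2 z).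
Proof.
move=> g10 g20; rewrite -big_split /=; apply: ler_sum => k /asboolP kD.
rewrite /bterm -mulrDr ler_wpM2l ?vol_ge0 //; apply: minf_ge.
- by move=> z /kD Dz; rewrite addr_ge0 ?g10 ?g20.
- by eexists; exact: gbox_nonempty.
- by move=> z kz; rewrite lerD // minf_le // => x /kD; [exact: g10|exact: g20].
Qed.

(** On a common grid the infimum of a sum is at least the sum of the infima. *)
Lemma integralD_ge D g1 g2 : (forall z, D z -> 0 <= g1 z) -> (forall z, D z -> 0 <= g2 z) ->
  (integral_open D g1 + integral_open D g2 <= integral_open D (fun z => (g1 z + g2 z)%R))%E.
Proof.
move=> g10 g20.
have g0 z : D z -> 0 <= g1 z + g2 z by move=> Dz; rewrite addr_ge0 ?g10 ?g20.
have := integral_ge0 g0; case Ec : (integral_open D (fun z => g1 z + g2 z)) => [c| |] // _; last by rewrite leey.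
have key s1 s2 : admissible D s1 -> admissible D s2 ->
    \sum_(B <- s1) bterm g1 B + \sum_(B <- s2) bterm g2 B <= c.
  move=> a1 a2; apply/ler_addgt0Pr => e e0; have e2 : 0 < e / 2 by rewrite divr_gt0.
  have [n1 h1] := gsum_lim g10 a1 e2; have [n2 h2] := gsum_lim g20 a2 e2.
  have l1 := h1 _ (leq_maxl n1 n2); have l2 := h2 _ (leq_maxr n1 n2).
  have := bterm_gsumD (maxn n1 n2) g10 g20.
  have := gsum_le (maxn n1 n2) g0; rewrite Ec lee_fin.
  move: l1 l2; move: (\sum_(_ <- _) _) (\sum_(_ <- _) _) (gsum _ _ _) (gsum _ _ _) (gsum _ _ _).
  by move=> x y u v w; clear; lra.
have b1 s1 : admissible D s1 -> (integral_open D g2 <= (c - \sum_(B <- s1) bterm g1 B)%:E)%E.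
  by move=> a1; apply: integral_le => // s2 a2; rewrite lee_fin lerBrDl key.
have := b1 _ (admissible_nil D); rewrite big_nil subr0.
have := integral_ge0 g20; case E2 : (integral_open D g2) => [c2| |] // _ _.
rewrite -leeBrDr // -EFinB; apply: integral_le => // s1 a1.
by have := b1 _ a1; rewrite E2 !lee_fin; lra.
Qed.

Definition cbox (B : box) : set Cd := let: (a, b, c, e) := B in
  [set z | forall j, (a j <= Re (z 0 j) <= b j) /\ (c j <= Im (z 0 j) <= e j)].

Lemma box_cbox B : box_set B `<=` cbox B.
Proof.
case: B => [[[a b] c] e] z h j; have [/andP[h1 h2] /andP[h3 h4]] := h j.
by rewrite h1 h3 !ltW.
Qed.

Lemma cbox_shrink B t : 0 < t -> cbox (shrink t B) `<=` box_set B.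
Proof.
case: B => [[[a b] c] e] t0 z h j; have [/andP[h1 h2] /andP[h3 h4]] := h j.
by split; apply/andP; split; move: h1 h2 h3 h4 t0; clear; lra.
Qed.

Lemma compact_cbox B : compact (cbox B).
Proof.
case: B => [[[a b] c] e].
pose M := \sum_j (`|a j| + `|b j| + `|c j| + `|e j|).
apply: (@closed_bounded_compact R d _ M).
  apply/closed_Cd => z h j.
  have aux (r : R) : 0 < r -> [/\ a j - r <= Re (z 0 j), Re (z 0 j) <= b j + r,
     c j - r <= Im (z 0 j) & Im (z 0 j) <= e j + r].
    move=> r0; have [w hw wz] := h r r0.
    have := le_lt_trans (cmax_qn (w - z) j) wz; rewrite !mxE cmax_lt ReD ImD ReN ImN !ltr_norml.
    have [/andP[h1 h2] /andP[h3 h4]] := hw j.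
    by move=> /andP[/andP[? ?] /andP[? ?]]; split; lra.
  split; apply/andP; split; apply/ler_addgt0Pr => r /aux[? ? ? ?]; lra.
move=> z h; apply/qn_leP => [|j].
  by apply: sumr_ge0 => j _; rewrite !addr_ge0.
apply: (@le_trans _ _ (`|a j| + `|b j| + `|c j| + `|e j|)); last first.
  by rewrite /M (bigD1 j) //= lerDl sumr_ge0 // => i _; rewrite !addr_ge0.
have [/andP[h1 h2] /andP[h3 h4]] := h j.
have := ler_norm (- a j); have := ler_norm (b j); have := ler_norm (- c j); have := ler_norm (e j).
rewrite !normrN; have := normr_ge0 (a j); have := normr_ge0 (b j); have := normr_ge0 (c j).
have := normr_ge0 (e j); rewrite cmax_le !ler_norml; move: h1 h2 h3 h4; clear => *.
by apply/andP; split; apply/andP; split; lra.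
Qed.

Definition contD D g := forall z, D z -> {for z, continuous g}.

Lemma finite_compact_union (s : seq (set Cd)) : (forall K, K \in s -> compact K) ->
  compact (\bigcup_(K in [set K | K \in s]) K).
Proof.
elim: s => [|K s IH] h.
  have -> : \bigcup_(K in [set K : set Cd | K \in [::]]) K = set0.
    by apply/seteqP; split=> z // -[K].
  exact: compact0.
have -> : \bigcup_(L in [set L : set Cd | L \in K :: s]) L = K `|` \bigcup_(L in [set L | L \in s]) L.
  apply/seteqP; split=> z.
    by move=> [L /=]; rewrite inE => /predU1P[->|Ls] Lz; [left|right; exists L].
  case=> [Kz|[L Ls Lz]]; first by exists K => //=; rewrite inE eqxx.
  by exists L => //=; rewrite inE Ls orbT.
by apply: compactU; [apply: h; rewrite inE eqxx|apply: IH => L Ls; apply: h; rewrite inE Ls orbT].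
Qed.

(* A half-open box may touch the boundary of D; shrinking makes its closure compact in D. *)
Lemma shrink_family D (s : seq box) (w : box -> R) (e : R) : admissible D s ->
  (forall B, B \in s -> 0 <= w B) -> 0 < e ->
  exists t, [/\ 0 < t, \sum_(B <- s) vol B * w B - e <= \sum_(B <- s) vol (shrink t B) * w B,
    compact (\bigcup_(B in [set B | B \in s]) cbox (shrink t B)) &
    \bigcup_(B in [set B | B \in s]) cbox (shrink t B) `<=` D].
Proof.
move=> sD w0 e0.
have [t t0 ht] : exists2 t : R, 0 < t &
    forall u, 0 <= u <= t -> \sum_(B <- s) vol B * w B - e <= \sum_(B <- s) vol (shrink u B) * w B.
  elim: s w0 e e0 {sD} => [|B s IH] w0 e e0.
    by exists 1 => // u _; rewrite !big_nil sub0r oppr_le0 ltW.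
  have wB : 0 <= w B by apply: w0; rewrite inE eqxx.
  have e2 : 0 < e / 2 by rewrite divr_gt0.
  have [|t t0 ht] := IH _ (e / 2) e2; first by move=> B' B's; apply: w0; rewrite inE B's orbT.
  have e4 : 0 < e / 2 / (1 + w B) by rewrite divr_gt0 // ltr_wpDr.
  have [t1 t10 ht1] := vol_shrink B e4.
  exists (Num.min t t1) => [|u]; first by rewrite lt_min t0.
  rewrite le_min => /and3P[u0 ut ut1].
  have l1 := ht u ltac:(by rewrite u0); have l2 := ht1 u ltac:(by rewrite u0).
  rewrite !big_cons.
  have : (vol B - e / 2 / (1 + w B)) * w B <= vol (shrink u B) * w B by rewrite ler_wpM2r.
  have : e / 2 / (1 + w B) * w B <= e / 2.
    rewrite mulrAC ler_pdivrMr ?ltr_wpDr // ler_wpM2l ?(ltW e2) //; move: wB; clear; lra.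
  rewrite mulrBl; move: l1; move: (\sum_(_ <- _) _) (\sum_(_ <- _) _) => x y; clear; lra.
exists t; split => //; first by apply: ht; rewrite lexx ltW.
  have := @finite_compact_union [seq cbox (shrink t B) | B <- s].
  rewrite (_ : bigcup _ _ = \bigcup_(B in [set B | B \in s]) cbox (shrink t B)).
    by apply=> K /mapP[B _ ->]; exact: compact_cbox.
  apply/seteqP; split=> z; first by move=> [K /mapP[B Bs ->] Kz]; exists B.
  by move=> [B Bs Bz]; exists (cbox (shrink t B)) => //=; apply/mapP; exists B.
by move=> z [B Bs /(cbox_shrink t0) Bz]; exact: sD.1 B Bs z Bz.
Qed.

Lemma gbox_diam n k z w : box_set (gbox (n:=n) k) z -> box_set (gbox k) w ->
  qn (w - z) <= n.+1%:R^-1.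
Proof.
move=> hz hw; have N1 : 0 < n.+1%:R^-1 :> R by rewrite invr_gt0.
apply/qn_leP => [|j]; first exact: ltW.
have [/andP[z1 z2] /andP[z3 z4]] := hz j; have [/andP[w1 w2] /andP[w3 w4]] := hw j.
move: z2 z4 w2 w4; rewrite !gptS !mxE cmax_le ReD ImD ReN ImN !ler_norml.
move: (n.+1%:R^-1) N1 z1 z3 w1 w3 => q; clear => *.
by apply/andP; split; apply/andP; split; lra.
Qed.

(** Continuity enters here: on shrunken boxes, whose closures are compact in [D], both functions
    vary by less than [eta] over a fine cell, so the infimum of the sum exceeds the sum of the
    infima by at most [2 * eta]. *)
Lemma integralD_le D g1 g2 : contD D g1 -> contD D g2 ->
  (forall z, D z -> 0 <= g1 z) -> (forall z, D z -> 0 <= g2 z) ->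
  (integral_open D (fun z => (g1 z + g2 z)%R) <= integral_open D g1 + integral_open D g2)%E.
Proof.
move=> c1 c2 g10 g20.
have g0 z : D z -> 0 <= g1 z + g2 z by move=> Dz; rewrite addr_ge0 ?g10 ?g20.
have := integral_ge0 g10; case E1 : (integral_open D g1) => [i1| |] // _; last first.
  by rewrite addye ?leey //; have := integral_ge0 g20; case: (integral_open D g2).
have := integral_ge0 g20; case E2 : (integral_open D g2) => [i2| |] // _; last by rewrite addey // leey.
apply: integral_le => // s sD; rewrite -EFinD lee_fin.
apply/ler_addgt0Pr => e e0; have e3 : 0 < e / 3 by rewrite divr_gt0.
pose w B := minf (fun z => g1 z + g2 z) B.
have w0 B : B \in s -> 0 <= w B by move=> /sD.1 BD; apply: minf_ge0 => z /BD /g0.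
have [t [t0 ht cK KD]] := shrink_family sD w0 e3.
have [n1 h1] := seq_lim (shrink t) w0 e3.
set V := \sum_(B <- s) vol B; have V0 : 0 <= V by apply: sumr_ge0 => B _; exact: vol_ge0.
(* The oscillation [2 * eta], spread over a total volume of at most [V], costs at most e/3. *)
pose eta := e / 3 / (2 * (1 + V)).
have eta0 : 0 < eta by rewrite divr_gt0 // mulr_gt0 // ltr_wpDr.
have [r1 r10 u1] := unif_continuous cK (fun z Kz => c1 z (KD z Kz)) eta0.
have [r2 r20 u2] := unif_continuous cK (fun z Kz => c2 z (KD z Kz)) eta0.
have [n2 h2] := inv_small r10; have [n3 h3] := inv_small r20.
pose n := maxn n1 (maxn n2 n3).
have l1 := h1 n (leq_maxl _ _).
have l2 : (n.+1%:R : R)^-1 < r1 by apply: h2; rewrite /n; rewrite leq_max leq_maxl orbT.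
have l3 : (n.+1%:R : R)^-1 < r2 by apply: h3; rewrite /n; rewrite leq_max leq_maxr orbT.
pose v (k : gidx n) := if `[< box_set (gbox k) `<=` D >] then
   minf g1 (gbox k) + minf g2 (gbox k) else 0.
have main := @gmeas_sum_le n D s w v (2 * eta) sD _ _ (shrink t) _ _.
have {main} main : \sum_(B <- s) gmeas n (shrink t B) * w B <=
    gsum n D g1 + gsum n D g2 + 2 * eta * \sum_(B <- s) gmeas n (shrink t B).
  apply: le_trans (main _ _ _ _) _.
  - move=> k; rewrite /v; case: ifP => // /asboolP kD.
    by rewrite addr_ge0 // minf_ge0 // => z /kD; [exact: g10|exact: g20].
  - by rewrite mulr_ge0 // ltW.
  - by move=> k B; apply: ginb_shrink; exact: ltW.
  - move=> B k Bs kB; have kB' := ginb_sub (ginb_shrink (ltW t0) kB).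
    have BD := sD.1 B Bs; have kD := subset_trans kB' BD; rewrite /v asboolT //.
    have kK z : box_set (gbox k) z -> (\bigcup_(B in [set B | B \in s]) cbox (shrink t B)) z.
      by move=> /(ginb_sub kB) /box_cbox h; exists B.
    have p0 := gbox_nonempty k; set p := (\row_j _) in p0.
    have wp : w B <= g1 p + g2 p by apply: minf_le => [z /BD /g0 //|]; exact: kB'.
    have m1 : g1 p - eta <= minf g1 (gbox k).
      apply: minf_ge => [z /kD /g10 //||z kz]; first by exists p.
      have := u1 p z (kK p p0) (le_lt_trans (gbox_diam p0 kz) l2).
      by rewrite ltr_norml => /andP[+ _]; clear; lra.
    have m2 : g2 p - eta <= minf g2 (gbox k).
      apply: minf_ge => [z /kD /g20 //||z kz]; first by exists p.
      have := u2 p z (kK p p0) (le_lt_trans (gbox_diam p0 kz) l3).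
      by rewrite ltr_norml => /andP[+ _]; clear; lra.
    by move: wp m1 m2; clear; lra.
  rewrite lerD2r /gsum -big_split /= le_eqVlt; apply/orP; left; apply/eqP.
  by apply: eq_bigr => k kD; rewrite /bterm !vol_gbox -mulrDr /v kD.
have s1 : gsum n D g1 <= i1 by rewrite -lee_fin -E1 gsum_le.
have s2 : gsum n D g2 <= i2 by rewrite -lee_fin -E2 gsum_le.
have gv : \sum_(B <- s) gmeas n (shrink t B) <= V.
  apply: ler_sum => B _; apply: le_trans (gmeas_le _ _) _.
  case: (B) => [[[a b] c] c']; apply: ler_prod => j _.
  have aux (x y : R) : 0 <= Num.max 0 (y - t - (x + t)) <= Num.max 0 (y - x).
    rewrite le_max lexx /= ge_max !le_max lexx /=; apply/orP; right.
    by move: t0; clear; lra.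
  have /andP[p1 p2] := aux (a j) (b j); have /andP[p3 p4] := aux (c j) (c' j).
  by rewrite mulr_ge0 //= ler_pM.
have gv2 : 2 * eta * \sum_(B <- s) gmeas n (shrink t B) <= e / 3.
  apply: (@le_trans _ _ (2 * eta * (1 + V))).
    apply: ler_wpM2l; first by apply: mulr_ge0 => //; exact: ltW.
    by apply: le_trans gv _; rewrite lerDr.
  by rewrite /eta le_eqVlt; apply/orP; left; apply/eqP; field; rewrite gt_eqF // ltr_wpDr.
rewrite -[leLHS]/(\sum_(B <- s) vol B * w B).
move: main ht l1 s1 s2 gv2.
move: (\sum_(B <- s) vol B * w B) (\sum_(B <- s) vol (shrink t B) * w B) => x1 x2.
move: (\sum_(B <- s) gmeas n (shrink t B) * w B) (2 * eta * _) (gsum _ _ _) (gsum _ _ _) => x3 x4 x5 x6.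
by clear; lra.
Qed.

Lemma integralD D g1 g2 : contD D g1 -> contD D g2 ->
  (forall z, D z -> 0 <= g1 z) -> (forall z, D z -> 0 <= g2 z) ->
  integral_open D (fun z => (g1 z + g2 z)%R) = (integral_open D g1 + integral_open D g2)%E.
Proof.
by move=> c1 c2 g10 g20; apply/eqP; rewrite eq_le integralD_le ?integralD_ge.
Qed.

Lemma integralZ D g (c : R) : (forall z, D z -> 0 <= g z) -> 0 < c ->
  integral_open D (fun z => c * g z) = (c%:E * integral_open D g)%E.
Proof.
move=> g0 c0.
have le (k : R) (f : Cd -> R) : (forall z, D z -> 0 <= f z) -> 0 < k ->
    (integral_open D (fun z => k * f z)%R <= k%:E * integral_open D f)%E.
  move=> f0 k0; have kf0 z : D z -> 0 <= k * f z by move=> /f0 h; rewrite mulr_ge0 // ltW.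
  apply: integral_le => // s sD; apply: le_trans (lee_wpmul2l _ (integral_ge f0 sD)); last first.
    by rewrite lee_fin ltW.
  rewrite -EFinM lee_fin mulr_sumr big_seq [leRHS]big_seq; apply: ler_sum => B Bs.
  have BD := sD.1 B Bs; rewrite /bterm mulrCA.
  have := vol_ge0 B; rewrite le_eqVlt => /predU1P[<-|v0]; first by rewrite !mul0r.
  have B0 := vol_gt0_nonempty v0; rewrite ler_wpM2l ?(ltW v0) // mulrC -ler_pdivrMr //.
  apply: minf_ge => [z /BD /f0 //||z Bz] //.
  by rewrite ler_pdivrMr // mulrC minf_le // => x /BD /kf0.
apply/eqP; rewrite eq_le le //=.
have cg0 z : D z -> 0 <= c * g z by move=> /g0 h; rewrite mulr_ge0 // ltW.
have := @le c^-1 (fun z => c * g z) cg0; rewrite invr_gt0 => /(_ c0).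
rewrite (@eq_integral_open D _ g) => [h|z Dz|z _]; last 2 first.
- by rewrite mulKf ?gt_eqF // g0.
- by rewrite mulKf ?gt_eqF.
have := lee_wpmul2l _ h; move=> /(_ c%:E); rewrite lee_fin (ltW c0) => /(_ isT).
by rewrite muleA -EFinM mulfV ?gt_eqF // mul1e.
Qed.

Lemma integral_bounded D (M m : R) : (forall z, D z -> qn z <= M) -> 0 <= m ->
  (integral_open D (fun=> m) < +oo)%E.
Proof.
move=> DM m0.
(* The upper corner of a half-open cell in [D] need not lie in [D], but it is within the mesh, at
   most 1, of the lower corner: hence [M + 1]. *)
pose B1 : box := (fun=> - M, fun=> M + 1, fun=> - M, fun=> M + 1).
apply: (@le_lt_trans _ _ (vol B1 * m + 1)%:E); last exact: ltry.
apply: integral_le => // s sD; rewrite lee_fin.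
have [n0 h] := gsum_lim (g := fun=> m) (fun _ _ => m0) sD ltr01.
have := h n0 (leqnn _); rewrite lerBlDr => /le_trans; apply; rewrite lerD2r.
apply: (@le_trans _ _ (gmeas n0 B1 * m)); last by rewrite ler_wpM2r // gmeas_le.
rewrite /gsum /gmeas mulr_suml big_mkcond; apply: ler_sum => k _.
case: ifP => [/asboolP kD|_]; last by rewrite !mulr_ge0 // gvol_ge0.
have p0 := gbox_nonempty k; have /kD/DM hp := p0.
suff -> : ginb k B1.
  rewrite mul1r /bterm vol_gbox ler_wpM2l ?gvol_ge0 //.
  by have := @minf_le (fun=> m) (gbox k) _ (fun _ _ => m0) p0.
apply/forallP => j; have := le_trans (cmax_qn _ j) hp.
have N1 : (n0.+1%:R : R)^-1 <= 1 by rewrite invf_le1 ?ler1n.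
rewrite mxE cmax_le !ler_norml /gind !gptS /=; move: (n0.+1%:R^-1) N1 => q N1.
by move=> /andP[/andP[h1 h2] /andP[h3 h4]]; apply/andP; split; apply/andP; split;
  move: h1 h2 h3 h4 N1; clear; lra.
Qed.

(** A form of Fatou's lemma: after shrinking its boxes, a lower sum sees only a compact part of [D],
    where [g] is almost dominated by a function of integral at most [c]. *)
Lemma integral_fatou D g (c : R) : (forall z, D z -> 0 <= g z) ->
  (forall K, compact K -> K `<=` D -> forall e : R, 0 < e -> exists g',
     [/\ forall z, D z -> 0 <= g' z, (integral_open D g' <= c%:E)%E &
      forall z, K z -> g z <= g' z + e]) ->
  (integral_open D g <= c%:E)%E.
Proof.
move=> g0 H; apply: integral_le => // s sD; rewrite lee_fin.
apply/ler_addgt0Pr => e e0; have e2 : 0 < e / 2 by rewrite divr_gt0.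
have w0 B : B \in s -> 0 <= minf g B by move=> /sD.1 BD; apply: minf_ge0 => z /BD /g0.
have [t [t0 ht cK KD]] := shrink_family sD w0 e2.
set V := \sum_(B <- s) vol (shrink t B); have V0 : 0 <= V by apply: sumr_ge0 => B _; exact: vol_ge0.
have [|g' [g'0 g'c gg']] := H _ cK KD (e / 2 / (1 + V)); first by rewrite divr_gt0 // ltr_wpDr.
have sD' : admissible D [seq shrink t B | B <- s].
  split=> [B' /mapP[B Bs ->] z /box_cbox Bz|i j]; first by apply: KD; exists B.
  rewrite size_map => hi hj ij.
  rewrite !(nth_map (0, 0, 0, 0)) //; apply/seteqP; split=> // z [z1 z2].
  have := sD.2 i j hi hj ij => /seteqP[/(_ z) h _]; apply: h.
  by split; apply: (cbox_shrink t0); exact: box_cbox.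
have l1 := integral_ge g'0 sD'; have := le_trans l1 g'c; rewrite lee_fin big_map => l2.
have l3 : \sum_(B <- s) vol (shrink t B) * minf g B <=
    \sum_(B <- s) bterm g' (shrink t B) + e / 2 / (1 + V) * V.
  rewrite /V mulr_sumr -big_split /= big_seq [leRHS]big_seq; apply: ler_sum => B Bs.
  have BD := sD.1 B Bs; rewrite /bterm [_ / _ * vol _]mulrC -mulrDr.
  have := vol_ge0 (shrink t B); rewrite le_eqVlt => /predU1P[<-|v0]; first by rewrite !mul0r.
  rewrite ler_wpM2l ?(ltW v0) // -lerBlDr; have B0 := vol_gt0_nonempty v0.
  have sB z : box_set (shrink t B) z -> box_set B z by move=> /box_cbox /(cbox_shrink t0).
  apply: minf_ge => [z /sB /BD /g'0 //||z Bz] //.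
  rewrite lerBlDr; apply: (@le_trans _ _ (g z)); last by apply: gg'; exists B => //; exact: box_cbox.
  by apply: minf_le; [move=> x /BD /g0|exact: sB].
have l4 : e / 2 / (1 + V) * V <= e / 2.
  rewrite mulrAC ler_pdivrMr ?ltr_wpDr // ler_wpM2l ?(ltW e2) //; move: V0; clear; lra.
move: ht l2 l3 l4; rewrite /bterm; move: (\sum_(_ <- _) _) => x1; move: (\sum_(_ <- _) _) => x2.
move: (\sum_(_ <- _) _) => x3; move: (_ * V) => x4; clear; lra.
Qed.
End Boxes.

(** * Integrals of signed functions *)

Section Lebesgue.
Variables (R : realType) (d : nat) (D : set (Cd R d)).
Local Notation C := (Cx R).
Local Notation Cd := (Cd R d).
Implicit Types (u v h : Cd -> R) (f g F G : Cd -> C).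
Local Notation Re := complex.Re.
Local Notation Im := complex.Im.
Local Notation I := (integral_open D).

Definition L1pos u := [/\ contD D u, forall z, D z -> 0 <= u z & (I u < +oo)%E].
Definition fI u : R := fine (I u).

Lemma fIK u : L1pos u -> (fI u)%:E = I u.
Proof.
by move=> [_ u0 fu]; rewrite /fI fineK // ge0_fin_numE // integral_ge0.
Qed.

Lemma L1pos_fin u : L1pos u -> (I u < +oo)%E. Proof. by case. Qed.

Lemma fI_ge0 u : (forall z, D z -> 0 <= u z) -> 0 <= fI u.
Proof. by move=> u0; rewrite /fI fine_ge0 // integral_ge0. Qed.

Lemma eq_fI u v : (forall z, D z -> 0 <= u z) -> (forall z, D z -> u z = v z) -> fI u = fI v.
Proof. by move=> u0 uv; rewrite /fI (eq_integral_open u0 uv). Qed.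

Lemma contD_add u v : contD D u -> contD D v -> contD D (fun z => u z + v z).
Proof. by move=> cu cv z Dz; apply: continuousD; [exact: cu|exact: cv]. Qed.

Lemma contD_opp u : contD D u -> contD D (fun z => - u z).
Proof. by move=> cu z Dz; apply: continuousN; exact: cu. Qed.

Lemma contD_scale k u : contD D u -> contD D (fun z => k * u z).
Proof. by move=> cu z Dz; apply: continuousM; [exact: cst_continuous|exact: cu]. Qed.

Lemma contD_mul u v : contD D u -> contD D v -> contD D (fun z => u z * v z).
Proof. by move=> cu cv z Dz; apply: continuousM; [exact: cu|exact: cv]. Qed.

Lemma contD_lip (phi : R -> R) u : (forall x y, `|phi x - phi y| <= `|x - y|) ->
  contD D u -> contD D (fun z => phi (u z)).
Proof.
move=> lip cu z Dz; have /continuous_CdR h := cu z Dz; apply/continuous_CdR => e /h[r r0 hr].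
by exists r => // w /hr; apply: le_lt_trans.
Qed.

Definition pos u z : R := Num.max (u z) 0.
Definition neg u z : R := Num.max (- u z) 0.

Lemma contD_pos u : contD D u -> contD D (pos u).
Proof.
move=> cu; apply: (@contD_lip (fun x => Num.max x 0)) cu => x y.
rewrite !maxEle; case: (lerP 0 (x - y)) => h; [rewrite (ger0_norm h)|rewrite (ltr0_norm h)];
  rewrite ler_norml; case: ifP; case: ifP; move: h; clear; move=> ? ? ?; apply/andP; split; lra.
Qed.

Lemma contD_abs u : contD D u -> contD D (fun z => `|u z|).
Proof. by apply: (@contD_lip (fun x => `|x|)) => x y; exact: ler_dist_dist. Qed.

Lemma contD_neg u : contD D u -> contD D (neg u).
Proof. by move=> /contD_opp /contD_pos. Qed.

Lemma L1pos_le u v : contD D u -> (forall z, D z -> 0 <= u z) -> (forall z, D z -> u z <= v z) ->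
  L1pos v -> L1pos u.
Proof. by move=> cu u0 uv [_ _ fv]; split => //; apply: le_lt_trans (integral_mono u0 uv) fv. Qed.

Lemma L1posD u v : L1pos u -> L1pos v -> L1pos (fun z => u z + v z).
Proof.
move=> [cu u0 fu] [cv v0 fv]; split; first exact: contD_add.
  by move=> z Dz; rewrite addr_ge0 ?u0 ?v0.
by rewrite integralD // lte_add_pinfty.
Qed.

Lemma fID u v : L1pos u -> L1pos v -> fI (fun z => u z + v z) = fI u + fI v.
Proof.
move=> hu hv; have hd := L1posD hu hv; apply: EFin_inj; rewrite EFinD !fIK //.
by case: hu => [cu u0 _]; case: hv => [cv v0 _]; rewrite integralD.
Qed.

Lemma L1posZ (k : R) u : 0 <= k -> L1pos u -> L1pos (fun z => k * u z).
Proof.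
move=> k0 [cu u0 fu]; split; first exact: contD_scale.
  by move=> z Dz; rewrite mulr_ge0 // u0.
move: k0; rewrite le_eqVlt => /predU1P[<-|k0].
  apply: le_lt_trans fu; apply: integral_mono => z Dz; rewrite mul0r //; exact: u0.
by rewrite integralZ // lte_mul_pinfty // ?lee_fin ?(ltW k0) //.
Qed.

Lemma fIZ (k : R) u : 0 < k -> L1pos u -> fI (fun z => k * u z) = k * fI u.
Proof.
move=> k0 hu; have hk := L1posZ (ltW k0) hu; apply: EFin_inj; rewrite EFinM !fIK //.
by case: hu => [cu u0 _]; rewrite integralZ.
Qed.

Lemma fI_le u v : (forall z, D z -> 0 <= u z) -> (forall z, D z -> u z <= v z) -> L1pos v -> fI u <= fI v.
Proof.
move=> u0 uv hv; rewrite /fI fine_le //; last exact: integral_mono.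
  rewrite ge0_fin_numE ?integral_ge0 //.
  by apply: le_lt_trans (integral_mono u0 uv) (L1pos_fin hv).
by case: hv => _ v0 fv; rewrite ge0_fin_numE ?integral_ge0.
Qed.

Definition L1 h := contD D h /\ (I (fun z => `|h z|%R) < +oo)%E.
Definition Iv h : R := fI (pos h) - fI (neg h).

Lemma pos_ge0 h z : 0 <= pos h z. Proof. by rewrite /pos le_max lexx orbT. Qed.
Lemma neg_ge0 h z : 0 <= neg h z. Proof. by rewrite /neg le_max lexx orbT. Qed.

Lemma posneg h z : h z = pos h z - neg h z.
Proof. by rewrite /pos /neg !maxEle; do !case: ifP; lra. Qed.

Lemma L1_abs h : L1 h -> L1pos (fun z => `|h z|).
Proof. by move=> [ch fh]; split => //; exact: contD_abs. Qed.

Lemma L1_pos h : L1 h -> L1pos (pos h).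
Proof.
move=> hh; apply: L1pos_le (L1_abs hh) => [|z _|z _]; [by apply: contD_pos; case: hh|exact: pos_ge0|].
by rewrite /pos ge_max ler_norm normr_ge0.
Qed.

Lemma L1_neg h : L1 h -> L1pos (neg h).
Proof.
move=> hh; apply: L1pos_le (L1_abs hh) => [|z _|z _]; [by apply: contD_neg; case: hh|exact: neg_ge0|].
by rewrite /neg ge_max -normrN ler_norm normr_ge0.
Qed.

Lemma L1_dom h u : contD D h -> (forall z, D z -> `|h z| <= u z) -> (I u < +oo)%E -> L1 h.
Proof. by move=> ch hu fu; split => //; apply: le_lt_trans fu; exact: integral_mono. Qed.

Lemma L1pos_L1 u : L1pos u -> L1 u.
Proof.
move=> [cu u0 fu]; apply: (L1_dom cu) fu => z Dz.
by rewrite ger0_norm // u0.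
Qed.

(** The integral does not depend on how the function is written as a difference of nonnegative ones;
    linearity follows by choosing convenient differences. *)
Lemma Iv_diff h u v : L1 h -> L1pos u -> L1pos v -> (forall z, D z -> h z = u z - v z) ->
  Iv h = fI u - fI v.
Proof.
move=> hh hu hv huv; have hp := L1_pos hh; have hn := L1_neg hh.
have : fI (fun z => pos h z + v z) = fI (fun z => u z + neg h z).
  apply: eq_fI => [z Dz|z Dz]; first by case: hv => _ v0 _; rewrite addr_ge0 ?pos_ge0 ?v0.
  by have := posneg h z; rewrite huv //; lra.
by rewrite !fID // /Iv; lra.
Qed.

Lemma L1D h k : L1 h -> L1 k -> L1 (fun z => h z + k z).
Proof.
move=> hh hk; have := L1posD (L1_abs hh) (L1_abs hk) => -[_ _ fin].
case: hh => ch _; case: hk => ck _; apply: (L1_dom _ _ fin) => [|z _]; first exact: contD_add.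
exact: ler_normD.
Qed.

Lemma IvD h k : L1 h -> L1 k -> Iv (fun z => h z + k z) = Iv h + Iv k.
Proof.
move=> hh hk; rewrite (@Iv_diff _ (fun z => pos h z + pos k z) (fun z => neg h z + neg k z)).
- by rewrite !fID; try exact: L1_pos; try exact: L1_neg; rewrite /Iv; lra.
- exact: L1D.
- by apply: L1posD; exact: L1_pos.
- by apply: L1posD; exact: L1_neg.
- by move=> z _; rewrite [h z]posneg [k z]posneg; lra.
Qed.

Lemma eq_Iv h k : (forall z, D z -> h z = k z) -> Iv h = Iv k.
Proof.
move=> hk; rewrite /Iv (@eq_fI (pos h) (pos k)) ?(@eq_fI (neg h) (neg k)) // => z Dz;
  by rewrite ?pos_ge0 ?neg_ge0 // /pos /neg hk.
Qed.

Lemma L1Z (k : R) h : L1 h -> L1 (fun z => k * h z).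
Proof.
move=> hh; have [_ _ fin] := L1posZ (normr_ge0 k) (L1_abs hh).
case: hh => ch _; apply: (L1_dom _ _ fin) => [|z _]; first exact: contD_scale.
by rewrite normrM.
Qed.

Lemma IvN h : Iv (fun z => - h z) = - Iv h.
Proof.
rewrite /Iv opprB; congr (fI _ - fI _).
by rewrite funeqE => z; rewrite /neg /pos opprK.
Qed.

Lemma IvZ (k : R) h : L1 h -> Iv (fun z => k * h z) = k * Iv h.
Proof.
have P (l : R) h' : L1 h' -> 0 < l -> Iv (fun z => l * h' z) = l * Iv h'.
  move=> hh l0; rewrite (@Iv_diff _ (fun z => l * pos h' z) (fun z => l * neg h' z)).
  - by rewrite !fIZ //; [rewrite /Iv; lra|exact: L1_neg|exact: L1_pos].
  - exact: L1Z.
  - by apply: L1posZ; [exact: ltW|exact: L1_pos].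
  - by apply: L1posZ; [exact: ltW|exact: L1_neg].
  - by move=> z _; rewrite {1}[h' z]posneg mulrBr.
move=> hh; have [k0|k0|->] := ltgtP k 0; last 2 first.
- exact: P.
- rewrite mul0r (@Iv_diff _ (pos h) (pos h)) ?subrr //; [|exact: L1_pos|exact: L1_pos|].
    exact: L1Z.
  by move=> z _; rewrite mul0r subrr.
have := P (- k) h hh; rewrite oppr_gt0 => /(_ k0).
rewrite (_ : (fun z => - k * h z) = fun z => - (k * h z)); first by rewrite IvN; lra.
by rewrite funeqE => z; rewrite mulNr.
Qed.

Lemma Iv_ge0E h : L1pos h -> Iv h = fI h.
Proof.
move=> hh; have h1 := L1pos_L1 hh; have hn := L1_neg h1.
rewrite (@Iv_diff h (fun z => h z + neg h z) (neg h)) //; first by rewrite fID //; lra.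
  exact: L1posD.
by move=> z _; lra.
Qed.

Lemma fI0 : fI (fun=> 0) = 0.
Proof.
rewrite /fI (_ : I (fun=> 0) = 0%E) //; apply/eqP; rewrite eq_le integral_ge0 // andbT.
apply: integral_le => // s sD; rewrite lee_fin big_seq big1 // => B Bs.
have := vol_ge0 B; rewrite /bterm le_eqVlt => /predU1P[<-|v0]; first by rewrite mul0r.
have [z Bz] := vol_gt0_nonempty v0.
have := @minf_le R d (fun=> 0) B z (fun _ _ => lexx 0) Bz.
have := @minf_ge0 R d (fun=> 0) B (fun _ _ => lexx 0) => a b.
by rewrite (_ : minf _ _ = 0) ?mulr0 //; apply/eqP; rewrite eq_le a b.
Qed.

End Lebesgue.

(** * Inner products of square integrable functions *)

Section L2.
Variables (R : realType) (d : nat) (D : set (Cd R d)).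
Local Notation C := (Cx R).
Local Notation Cd := (Cd R d).
Implicit Types (u v h : Cd -> R) (f g F G : Cd -> C).
Local Notation Re := complex.Re.
Local Notation Im := complex.Im.

Definition ccontD F := forall z, D z -> {for z, continuous F}.

Lemma contD_Re F : ccontD F -> contD D (fun z => Re (F z)).
Proof.
move=> cF z Dz; have /continuous_CdC h := cF z Dz; apply/continuous_CdR => e /h[r r0 hr].
exists r => // w /hr; apply: le_lt_trans.
by have := normc_Re (F w - F z); rewrite ReD ReN.
Qed.

Lemma contD_Im F : ccontD F -> contD D (fun z => Im (F z)).
Proof.
move=> cF z Dz; have /continuous_CdC h := cF z Dz; apply/continuous_CdR => e /h[r r0 hr].
exists r => // w /hr; apply: le_lt_trans.
by have := normc_Im (F w - F z); rewrite ImD ImN.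
Qed.

Lemma ccontD_ReIm F : contD D (fun z => Re (F z)) -> contD D (fun z => Im (F z)) -> ccontD F.
Proof.
move=> c1 c2 z Dz; apply/continuous_CdC => e e0.
have /continuous_CdR/(_ (e / 2))[|r r0 hr] := c1 z Dz; first by rewrite divr_gt0.
have /continuous_CdR/(_ (e / 2))[|s s0 hs] := c2 z Dz; first by rewrite divr_gt0.
exists (Num.min r s) => [|w]; first by rewrite lt_min r0.
rewrite lt_min => /andP[/hr h1 /hs h2].
apply: le_lt_trans (normc_le_ReIm _) _; rewrite ReD ReN ImD ImN.
by move: h1 h2; clear; lra.
Qed.

Lemma ccontD_conj F : ccontD F -> ccontD (fun z => (F z)^*%C).
Proof.
move=> cF z Dz; have /continuous_CdC h := cF z Dz; apply/continuous_CdC => e /h[r r0 hr].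
by exists r => // w /hr; rewrite -[X in X < _]normc_conj rmorphB.
Qed.

Lemma ccontDD F G : ccontD F -> ccontD G -> ccontD (fun z => F z + G z).
Proof. by move=> cF cG z Dz; apply: continuousD; [exact: cF|exact: cG]. Qed.

Lemma ccontDM F G : ccontD F -> ccontD G -> ccontD (fun z => F z * G z).
Proof. by move=> cF cG z Dz; apply: continuousMC; [exact: cF|exact: cG]. Qed.

Lemma ccontD_cst (k : C) : ccontD (fun=> k).
Proof. by move=> z _; exact: cst_continuous. Qed.

Lemma ccontDX F n : ccontD F -> ccontD (fun z => F z ^+ n).
Proof.
move=> cF; elim: n => [|n IH]; first by under eq_fun do rewrite expr0; exact: ccontD_cst.
by under eq_fun do rewrite exprS; exact: ccontDM.
Qed.

Lemma sqmod_ge0 (z : C) : 0 <= sqmod z. Proof. by rewrite addr_ge0 ?sqr_ge0. Qed.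

Lemma contD_sqmod F : ccontD F -> contD D (fun z => sqmod (F z)).
Proof.
move=> cF; have c1 := contD_Re cF; have c2 := contD_Im cF.
exact: contD_add (contD_mul c1 c1) (contD_mul c2 c2).
Qed.

Definition CL1 F := ccontD F /\ L1 D (fun z => normc (F z)).
Definition CI F : C := (Iv D (fun z => Re (F z)) +i* Iv D (fun z => Im (F z)))%C.

Lemma ccontD_normc F : ccontD F -> contD D (fun z => normc (F z)).
Proof.
move=> cF z Dz; have /continuous_CdC h := cF z Dz; apply/continuous_CdR => e /h[r r0 hr].
exists r => // w /hr; apply: le_lt_trans.
have := normcB_tri (F w) (F z); have := normcB_tri (F z) (F w); rewrite normcB_sym.
by rewrite ler_norml; clear; lra.
Qed.

Lemma CL1_Re F : CL1 F -> L1 D (fun z => Re (F z)).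
Proof.
move=> [cF [_ lF]]; split; first exact: contD_Re.
apply: le_lt_trans lF; apply: integral_mono => z _; first exact: normr_ge0.
by rewrite (ger0_norm (normc_ge0 _)) normc_Re.
Qed.

Lemma CL1_Im F : CL1 F -> L1 D (fun z => Im (F z)).
Proof.
move=> [cF [_ lF]]; split; first exact: contD_Im.
apply: le_lt_trans lF; apply: integral_mono => z _; first exact: normr_ge0.
by rewrite (ger0_norm (normc_ge0 _)) normc_Im.
Qed.

Lemma CL1_dom F u : ccontD F -> (forall z, D z -> normc (F z) <= u z) ->
  (integral_open D u < +oo)%E -> CL1 F.
Proof.
move=> cF Fu fu; split => //; split; first exact: ccontD_normc.
apply: le_lt_trans fu; apply: integral_mono => z Dz; first exact: normr_ge0.
by rewrite (ger0_norm (normc_ge0 _)) Fu.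
Qed.

Lemma CL1D F G : CL1 F -> CL1 G -> CL1 (fun z => F z + G z).
Proof.
move=> [cF lF] [cG lG]; have [_] := L1D lF lG; apply: CL1_dom; first exact: ccontDD.
move=> z _; rewrite ger0_norm ?addr_ge0 ?normc_ge0 //; exact: le_normcD.
Qed.

Lemma CL1_bounded F G m : ccontD G -> 0 <= m -> (forall z, D z -> normc (G z) <= m) ->
  CL1 F -> CL1 (fun z => G z * F z).
Proof.
move=> cG m0 hm [cF lF].
have [_ _] := L1posZ m0 (L1_abs lF); apply: CL1_dom; first exact: ccontDM.
by move=> z Dz; rewrite (ger0_norm (normc_ge0 _)) normcM ler_wpM2r ?normc_ge0 // hm.
Qed.

Lemma CL1Z (k : C) F : CL1 F -> CL1 (fun z => k * F z).
Proof. by apply: (@CL1_bounded _ _ (normc k)) => //; [exact: ccontD_cst|exact: normc_ge0]. Qed.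

Lemma complex_eqP (z w : C) : Re z = Re w -> Im z = Im w -> z = w.
Proof. by case: z => a b; case: w => c e /= -> ->. Qed.

Lemma CID F G : CL1 F -> CL1 G -> CI (fun z => F z + G z) = CI F + CI G.
Proof.
move=> lF lG; apply: complex_eqP; rewrite ?ReD ?ImD /CI /=.
  by rewrite -IvD; try exact: CL1_Re; apply: eq_Iv => z _; rewrite ReD.
by rewrite -IvD; try exact: CL1_Im; apply: eq_Iv => z _; rewrite ImD.
Qed.

Lemma CIZ (k : C) F : CL1 F -> CI (fun z => k * F z) = k * CI F.
Proof.
move=> lF; have lR := CL1_Re lF; have lI := CL1_Im lF.
apply: complex_eqP; rewrite ?ReM ?ImM /CI /=.
  rewrite -(IvZ _ lR) -[X in _ - X](IvZ _ lI) -IvN -IvD; [|exact: L1Z|].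
    by apply: eq_Iv => z _; rewrite ReM.
  have := L1Z (-1) (L1Z (Im k) lI); rewrite (_ : (fun z => -1 * _) = fun z => - (Im k * Im (F z))) //.
  by rewrite funeqE => z; rewrite mulN1r.
rewrite -(IvZ _ lR) -(IvZ _ lI) -IvD; [|exact: L1Z|exact: L1Z].
by apply: eq_Iv => z _; rewrite ImM.
Qed.

Lemma eq_CI F G : (forall z, D z -> F z = G z) -> CI F = CI G.
Proof.
by move=> FG; congr (_ +i* _)%C; apply: eq_Iv => z Dz; rewrite FG.
Qed.

Lemma conjM (z w : C) : (z * w)^*%C = z^*%C * w^*%C.
Proof. by apply: complex_eqP; case: z => a b; case: w => c e /=; ring. Qed.

Lemma CI_conj F : CI (fun z => (F z)^*%C) = (CI F)^*%C.
Proof.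
apply: complex_eqP => /=; first by apply: eq_Iv => z _; case: (F z).
by rewrite -IvN; apply: eq_Iv => z _; case: (F z).
Qed.

Definition L2 f := ccontD f /\ (sqnorm D f < +oo)%E.
Definition N f : R := fine (sqnorm D f).

Lemma L2_pos f : L2 f -> L1pos D (fun z => sqmod (f z)).
Proof. by move=> [cf nf]; split => //; [exact: contD_sqmod|move=> z _; exact: sqmod_ge0]. Qed.

Lemma N_ge0 f : 0 <= N f.
Proof. by apply: fI_ge0 => z _; exact: sqmod_ge0. Qed.

Lemma NE f : L2 f -> sqnorm D f = (N f)%:E.
Proof. by move=> /L2_pos /fIK. Qed.

Lemma N_le f c : L2 f -> (sqnorm D f <= c%:E)%E -> N f <= c.
Proof. by move=> /NE ->; rewrite lee_fin. Qed.

Lemma eq_N f g : (forall z, D z -> f z = g z) -> N f = N g.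
Proof. by move=> fg; apply: eq_fI => z Dz; rewrite ?sqmod_ge0 // fg. Qed.

Lemma sqmodM (z w : C) : sqmod (z * w) = sqmod z * sqmod w.
Proof. by rewrite !sqmodE normcM exprMn. Qed.

Lemma sqmodD_le (z w : C) : sqmod (z + w) <= 2 * sqmod z + 2 * sqmod w.
Proof.
case: z => a b; case: w => c e; rewrite /sqmod /=.
by have := sqr_ge0 (a - c); have := sqr_ge0 (b - e); clear; nra.
Qed.

Lemma L2D f g : L2 f -> L2 g -> L2 (fun z => f z + g z).
Proof.
move=> hf hg; have [_ _ fin] := L1posD (L1posZ (ler0n _ 2) (L2_pos hf)) (L1posZ (ler0n _ 2) (L2_pos hg)).
case: hf => cf _; case: hg => cg _; split; first exact: ccontDD.
apply: le_lt_trans fin; apply: integral_mono => z _; first exact: sqmod_ge0.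
exact: sqmodD_le.
Qed.

Lemma L2_bounded f g m : ccontD g -> 0 <= m -> (forall z, D z -> normc (g z) <= m) -> L2 f ->
  L2 (fun z => g z * f z) /\ N (fun z => g z * f z) <= m ^+ 2 * N f.
Proof.
move=> cg m0 hm hf; have mm : 0 <= m ^+ 2 by rewrite exprn_ge0.
have hle z : D z -> sqmod (g z * f z) <= m ^+ 2 * sqmod (f z).
  move=> Dz; rewrite sqmodM ler_wpM2r ?sqmod_ge0 // sqmodE ler_pXn2r ?nnegrE ?normc_ge0 //.
  exact: hm.
have hp := L1posZ mm (L2_pos hf); have [_ _ fin] := hp.
have hgf : L2 (fun z => g z * f z).
  split; first exact: ccontDM cg (proj1 hf).
  by apply: le_lt_trans fin; apply: integral_mono => // z _; exact: sqmod_ge0.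
split=> //; move: m0; rewrite le_eqVlt => /predU1P[m0|m0].
  rewrite -m0 expr0n mul0r -[X in _ <= X](_ : N (fun z => 0 * f z) = _).
    rewrite (_ : N _ = N (fun z => 0 * f z)) //; apply: eq_N => z Dz.
    by have := hm z Dz; rewrite -m0 => h; rewrite [g z]eq0_normc //; apply: le_anti; rewrite h normc_ge0.
  under [in LHS]eq_fun do rewrite mul0r.
  by rewrite -[RHS](fI0 D); apply: eq_fI => z _; rewrite ?sqmod_ge0 // /sqmod /= expr0n addr0.
rewrite -(fIZ _ (L2_pos hf)); last by rewrite exprn_gt0.
by apply: fI_le => // z _; exact: sqmod_ge0.
Qed.

Lemma L2Z (k : C) f : L2 f -> L2 (fun z => k * f z).
Proof. by move=> /(L2_bounded (ccontD_cst (k := k)) (normc_ge0 k) (fun _ _ => lexx _))[]. Qed.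

Lemma normc_mul_le (z w : C) : normc (z * w) <= sqmod z + sqmod w.
Proof.
rewrite normcM !sqmodE; have := normc_ge0 z; have := normc_ge0 w.
by move: (normc z) (normc w) => a b; clear; nra.
Qed.

Lemma L2_CL1 f g : L2 f -> L2 g -> CL1 (fun z => f z * (g z)^*%C).
Proof.
move=> hf hg; have [_ _ fin] := L1posD (L2_pos hf) (L2_pos hg).
case: hf => cf _; case: hg => cg _; apply: CL1_dom fin => [|z _].
  exact: ccontDM cf (ccontD_conj cg).
by apply: le_trans (normc_mul_le _ _) _; rewrite lerD2l !sqmodE normc_conj.
Qed.

Definition ip f g : C := CI (fun z => f z * (g z)^*%C).

Lemma sqmodD_expand (z w : C) : sqmod (z + w) = sqmod z + (sqmod w + 2 * Re (z * w^*%C)).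
Proof. by case: z => a b; case: w => c e; rewrite /sqmod /= ; ring. Qed.

Lemma ND f g : L2 f -> L2 g -> N (fun z => f z + g z) = N f + N g + 2 * Re (ip f g).
Proof.
move=> hf hg; have hp := L2_pos (L2D hf hg); have hF := CL1_Re (L2_CL1 hf hg).
rewrite {1}/N -/(fI D _) -Iv_ge0E // -addrA.
have lf := L1pos_L1 (L2_pos hf); have lg := L1pos_L1 (L2_pos hg).
rewrite (@eq_Iv _ _ D _ (fun z => sqmod (f z) + (sqmod (g z) + 2 * Re (f z * (g z)^*%C)))).
  rewrite IvD //; last by apply: L1D => //; exact: L1Z.
  rewrite IvD //; last exact: L1Z.
  by rewrite IvZ // (Iv_ge0E (L2_pos hf)) (Iv_ge0E (L2_pos hg)).
by move=> z _; exact: sqmodD_expand.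
Qed.

Lemma ipZr (k : C) f g : L2 f -> L2 g -> ip f (fun z => k * g z) = k^*%C * ip f g.
Proof.
move=> hf hg; rewrite /ip -CIZ; last exact: L2_CL1.
by apply: eq_CI => z _; rewrite conjM mulrCA.
Qed.

(** Polarization: after expanding the four norms, the terms [N f + N g] cancel since the powers of i
    sum to zero, and four copies of [ip f g] are left. *)
Lemma ip_innerE f g : L2 f -> L2 g -> inner D f g = ip f g.
Proof.
move=> hf hg; pose G (k : nat) : C := ('i ^+ k * (N (fun z => (f z + 'i ^+ k * g z)%R))%:C)%C.
have -> : inner D f g = 4^-1 * \sum_(k < 4) G k by [].
rewrite !big_ord_recr big_ord0 /= add0r /G.
have Nk (k : C) : normc k = 1 -> N (fun z => k * g z) = N g.
  move=> k1; apply: eq_fI => z _; first exact: sqmod_ge0.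
  by rewrite sqmodM [sqmod k]sqmodE k1 expr1n mul1r.
have n1 : normc (1 : C) = 1 by rewrite normc1.
have ni : normc ('i%C : C) = 1 by rewrite /normc /= expr0n expr1n add0r sqrtr1.
rewrite !ND ?Nk ?ipZr ?normcX ?ni ?expr1n //; try exact: L2Z.
case: (ip f g) => x y; move: (N f) (N g) => a b.
rewrite !exprS expr0.
apply/eqP; rewrite eq_complex /=; apply/andP; split; apply/eqP; by field.
Qed.

Lemma ipDl f g (h : Cd -> C) : L2 f -> L2 g -> L2 h -> ip (fun z => f z + g z) h = ip f h + ip g h.
Proof.
move=> hf hg hh; rewrite -CID; try exact: L2_CL1.
by apply: eq_CI => z _; rewrite mulrDl.
Qed.

Lemma ipZl (k : C) f g : L2 f -> L2 g -> ip (fun z => k * f z) g = k * ip f g.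
Proof.
move=> hf hg; rewrite -CIZ; last exact: L2_CL1.
by apply: eq_CI => z _; rewrite mulrA.
Qed.

Lemma ip_conj f g : (ip f g)^*%C = ip g f.
Proof. by rewrite -CI_conj; apply: eq_CI => z _; case: (f z) => ? ?; case: (g z) => ? ?; apply: complex_eqP => /=; ring. Qed.

Lemma eq_ip f f' g g' : (forall z, D z -> f z = f' z) -> (forall z, D z -> g z = g' z) -> ip f g = ip f' g'.
Proof. by move=> ff gg; apply: eq_CI => z Dz; rewrite ff ?gg. Qed.

Lemma NZ (k : C) f : L2 f -> N (fun z => k * f z) = sqmod k * N f.
Proof.
move=> hf; have [->|k0] := eqVneq k 0.
  apply/eqP; rewrite eq_le {2}/sqmod /= expr0n addr0 mul0r N_ge0 andbT.
  have [_] := L2_bounded (ccontD_cst (k := 0)) (lexx 0) (fun _ _ => ltac:(by rewrite normc0)) hf.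
  by rewrite /sqmod /= expr0n addr0.
rewrite -[RHS](fIZ _ (L2_pos hf)); last by rewrite sqmodE exprn_gt0 // normc_gt0.
by apply: eq_fI => z _; rewrite ?sqmod_ge0 ?sqmodM.
Qed.

(** Nonnegativity of the norm of sqrt(a) f - g / sqrt(a). The weighted additive form keeps square
    roots of norms out of the later estimates. *)
Lemma cauchy_schwarz_eps f g (a : R) : L2 f -> L2 g -> 0 < a ->
  2 * Re (ip f g) <= a * N f + N g / a.
Proof.
move=> hf hg a0.
have := N_ge0 (fun z => (Num.sqrt a)%:C%C * f z + (- (Num.sqrt a)^-1)%:C%C * g z).
rewrite ND ?NZ //; try exact: L2Z.
rewrite ipZl; try exact: L2Z; last exact: hf.
rewrite ipZr // mulrA.
have s0 : 0 < Num.sqrt a by rewrite sqrtr_gt0.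
have -> : ((Num.sqrt a)%:C%C * ((- (Num.sqrt a)^-1)%:C%C)^*%C : C) = -1.
  by apply: complex_eqP => /=; rewrite ?mul0r ?mulr0 ?oppr0 ?mulr0 ?subr0 ?addr0 // mulrN divff ?gt_eqF.
rewrite mulN1r ReN /sqmod /= expr0n !addr0 sqrrN exprVn (sqr_sqrtr (ltW a0)) (mulrC (N g)).
by move: (a * N f) (a^-1 * N g) (Iv D _) => x y q; clear; lra.
Qed.
End L2.

(** * Point evaluations and the Riesz representation *)

Section Bergman.
Variables (R : realType) (d : nat) (D : set (Cd R d)).
Local Notation C := (Cx R).
Local Notation Cd := (Cd R d).
Implicit Types (f g : Cd -> C).
Local Notation Re := complex.Re.
Local Notation Im := complex.Im.

Lemma bergman_L2 f : bergman D f -> L2 D f.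
Proof. by move=> [hf nf]; split => // z Dz; exact: holo_cont hf Dz. Qed.

Lemma bergman_intro f : holomorphic_on D f -> L2 D f -> bergman D f.
Proof. by move=> hf [_ nf]. Qed.

Lemma bergmanD f g : bergman D f -> bergman D g -> bergman D (fun z => f z + g z).
Proof.
move=> hf hg; apply: bergman_intro; first exact: holoD (proj1 hf) (proj1 hg).
exact: L2D (bergman_L2 hf) (bergman_L2 hg).
Qed.

Lemma bergmanM f g m : bergman D f -> holomorphic_on D g -> 0 <= m ->
  (forall z, D z -> normc (g z) <= m) -> bergman D (fun z => g z * f z).
Proof.
move=> hf hg m0 hm; apply: bergman_intro; first exact: holoM hg (proj1 hf).
by have [] := L2_bounded (fun z Dz => holo_cont hg Dz) m0 hm (bergman_L2 hf).
Qed.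

Lemma bergmanZ (k : C) f : bergman D f -> bergman D (fun z => k * f z).
Proof.
move=> hf; apply: (bergmanM hf (@holo_cst _ _ D k) (normc_ge0 k)) => z _; exact: lexx.
Qed.

Lemma bergman1 M : (forall z, D z -> qn z <= M) -> bergman D (fun=> 1).
Proof.
move=> bD; split; first exact: holo_cst.
apply: le_lt_trans (integral_bounded bD (@ler01 R)); apply: integral_mono => z _.
  exact: sqmod_ge0.
by rewrite /sqmod /= expr0n expr1n addr0.
Qed.

Definition cubebox (z : Cd) (t : R) : box R d :=
  (fun j => Re (z 0 j) - t, fun j => Re (z 0 j) + t, fun j => Im (z 0 j) - t, fun j => Im (z 0 j) + t).

Lemma cubebox_sub z t w : 0 <= t -> box_set (cubebox z t) w -> qn (w - z) <= t.
Proof.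
move=> t0 hw; apply/qn_leP => // j; rewrite !mxE cmax_le ReD ReN ImD ImN !ler_norml.
by have [/andP[h1 h2] /andP[h3 h4]] := hw j; apply/andP; split; apply/andP; split;
  move: h1 h2 h3 h4; clear; lra.
Qed.

Lemma vol_cubebox z t : 0 <= t -> vol (cubebox z t) = ((2 * t) ^+ 2) ^+ d.
Proof.
move=> t0; rewrite /vol /cubebox; under eq_bigr => j _.
  have E (x : R) : Num.max 0 (x + t - (x - t)) = 2 * t.
    by rewrite max_r; move: t0; clear; lra.
  rewrite !E -expr2; over.
by rewrite prodr_const card_ord.
Qed.

Lemma qn_continuous (v z : Cd) : {for z, continuous (fun w : Cd => qn (w - v))}.
Proof.
apply/continuous_CdR => e e0; exists e => // w.
have h1 := qn_tri w z v; have h2 := qn_tri z w v; rewrite (qnB_sym z w) in h2.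
by rewrite ltr_norml; move: h1 h2; clear => *; apply/andP; split; lra.
Qed.

Lemma contDX (E : set Cd) (u : Cd -> R) n : contD E u -> contD E (fun z => u z ^+ n).
Proof.
move=> cu; elim: n => [|n IH].
  by under eq_fun do rewrite expr0; move=> z _; exact: cst_continuous.
by under eq_fun do rewrite exprS; exact: contD_mul.
Qed.

(* Maximize |f(w)| (r - |w - z|)^d over the cube; near the maximum point [f] is comparable to its value there. *)
Lemma point_estimate z r : (0 < d)%N -> 0 < r -> (forall w, qn (w - z) <= r -> D w) ->
  exists2 K : R, 0 < K & forall f, bergman D f -> forall w, qn (w - z) <= r / 2 ->
    sqmod (f w) <= K * N D f.
Proof.
(* [ka <= 1/16] keeps the cube of size [ka * rho] within the range of [holo_lip], and
   [192 * d * 2^d * ka <= 1] makes [|f|] drop by at most half across that cube. *)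
move=> d0 r0 hD; pose ka : R := (16 + 192 * d%:R * 2 ^+ d)^-1.
have k16 : 16 <= 16 + 192 * d%:R * 2 ^+ d :> R.
  have : 0 <= d%:R * 2 ^+ d :> R by rewrite mulr_ge0 // exprn_ge0.
  by rewrite -mulrA; move: (_ * 2 ^+ d) => x; clear; lra.
have ka0 : 0 < ka by rewrite invr_gt0 (lt_le_trans _ k16).
have kr0 : 0 < (ka * r) ^+ 2 ^+ d by rewrite !exprn_gt0 // mulr_gt0.
exists (4 / (ka * r) ^+ 2 ^+ d); first by rewrite divr_gt0.
move=> f bf w wr; have hf := proj1 bf.
have [w0 w0r hmax] : exists2 w0, qn (w0 - z) <= r & forall w, qn (w - z) <= r ->
    normc (f w) * (r - qn (w - z)) ^+ d <= normc (f w0) * (r - qn (w0 - z)) ^+ d.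
  apply: (@compact_max _ _ [set w | qn (w - z) <= r] (fun w => normc (f w) * (r - qn (w - z)) ^+ d)).
  - by exists z; rewrite /= subrr qn0 ltW.
  - exact: compact_cube_at.
  - move=> v /hD Dv; apply: continuousM; first by apply: continuous_normc; exact: holo_cont hf Dv.
    have cq : contD setT (fun w : Cd => r - qn (w - z)).
      by move=> u _; apply: continuousB; [exact: cst_continuous|exact: qn_continuous].
    exact: (@contDX setT _ d cq v Logic.I).
set rho := r - qn (w0 - z) in hmax.
have rho0 : 0 <= rho by rewrite subr_ge0.
have hw : normc (f w) * (r / 2) ^+ d <= normc (f w0) * rho ^+ d.
  apply: le_trans (hmax w _); last by apply: le_trans wr _; move: r0; clear; lra.
  rewrite ler_wpM2l ?normc_ge0 // lerXn2r ?nnegrE; move: wr r0; clear; lra.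
have r2 : 0 < (r / 2) ^+ d by rewrite exprn_gt0 // divr_gt0.
(* Up to a constant, rho^(2d) is the volume of the cube about [w0] on which [|f|] is at least half
   of its value at [w0]; this is why the weight carries the exponent [d]. *)
have key : normc (f w0) ^+ 2 * rho ^+ 2 ^+ d <= 4 / ka ^+ 2 ^+ d / 4 ^+ d * N D f; last first.
  rewrite sqmodE -(ler_pM2r (exprn_gt0 2 r2)).
  rewrite -exprMn; apply: (@le_trans _ _ ((normc (f w0) * rho ^+ d) ^+ 2)).
    rewrite ler_pXn2r ?nnegrE ?mulr_ge0 ?normc_ge0 ?exprn_ge0 //; exact: ltW (divr_gt0 r0 _).
  rewrite [leLHS]exprMn [rho ^+ d ^+ 2]exprAC; apply: le_trans key _.
  have -> : (r / 2) ^+ d ^+ 2 = r ^+ 2 ^+ d / 4 ^+ d.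
    by rewrite exprAC !expr_div_n (_ : 2 ^+ 2 = 4 :> R) // -natrX.
  have -> : (ka * r) ^+ 2 ^+ d = ka ^+ 2 ^+ d * r ^+ 2 ^+ d by rewrite [(ka * r) ^+ 2]exprMn [LHS]exprMn.
  rewrite le_eqVlt; apply/orP; left; apply/eqP.
  have a1 : ka ^+ 2 ^+ d != 0 by rewrite gt_eqF // !exprn_gt0.
  have a2 : r ^+ 2 ^+ d != 0 by rewrite gt_eqF // !exprn_gt0.
  have a3 : (4 ^+ d : R) != 0 by rewrite gt_eqF // !exprn_gt0.
  by move: (ka ^+ 2 ^+ d) (r ^+ 2 ^+ d) (4 ^+ d) (N D f) a1 a2 a3 => x y u v; clear=> *; field; apply/and3P.
have [fw0|fw0] := eqVneq (f w0) 0.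
  rewrite fw0 normc0 expr0n mul0r mulr_ge0 ?N_ge0 // divr_ge0 ?exprn_ge0 //.
  by rewrite divr_ge0 ?exprn_ge0 // ltW.
have [rh|rh] := eqVneq rho 0.
  rewrite rh expr0n /= expr0n gtn_eqF // mulr0 mulr_ge0 ?N_ge0 // divr_ge0 ?exprn_ge0 //.
  by rewrite divr_ge0 ?exprn_ge0 // ltW.
have {rho0 rh} rho0 : 0 < rho by rewrite lt_neqAle eq_sym rh.
have nf0 : 0 < normc (f w0) by rewrite normc_gt0.
have inr v : qn (v - w0) <= rho / 2 -> qn (v - z) <= r - rho / 2.
  by move=> h; have := qn_tri v w0 z; rewrite /rho in h *; move: h; clear; lra.
have inD v : qn (v - w0) <= rho / 2 -> D v.
  by move=> /inr h; apply: hD; apply: le_trans h _; move: rho0; clear; lra.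
have inM v : qn (v - w0) <= rho / 2 -> normc (f v) <= 2 ^+ d * normc (f w0).
  move=> /inr h; have := hmax v; rewrite (le_trans h); last by move: rho0; clear; lra.
  move=> /(_ isT) h1.
  have h2 : normc (f v) * (rho / 2) ^+ d <= normc (f w0) * rho ^+ d.
    apply: le_trans h1; rewrite ler_wpM2l ?normc_ge0 // lerXn2r ?nnegrE; move: h rho0; clear; lra.
  have e0 : 0 < (rho / 2) ^+ d by rewrite exprn_gt0 // divr_gt0.
  rewrite -(ler_pM2r e0); apply: le_trans h2 _.
  rewrite [2 ^+ d * _]mulrC -mulrA -exprMn (_ : 2 * (rho / 2) = rho) //.
  by move: rho0; clear; lra.
have rho2 : 0 < rho / 2 by rewrite divr_gt0.
have lip := holo_lip hf rho2 inD inM.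
have kr : 0 <= ka * rho by rewrite mulr_ge0 // ltW.
have ka16 : ka <= 16^-1 by rewrite lef_pV2 ?posrE // (lt_le_trans _ k16).
have sub v : qn (v - w0) <= ka * rho -> qn (v - w0) <= rho / 2 / 8.
  move=> h; apply: le_trans h _; rewrite -mulrA [ka * rho]mulrC ler_wpM2l ?(ltW rho0) //.
  by move: ka16; clear; lra.
have low v : qn (v - w0) <= ka * rho -> normc (f w0) / 2 <= normc (f v).
  move=> h; have := lip w0 v _ (sub v h); rewrite subrr qn0 => /(_ (ltac:(by rewrite divr_ge0 ?ltW))).
  have -> : d%:R * (48 * (2 ^+ d * normc (f w0)) / (rho / 2)) = 96 * d%:R * 2 ^+ d / rho * normc (f w0).
    by field; rewrite gt_eqF.
  move=> h1.
  have h2 : 96 * d%:R * 2 ^+ d / rho * normc (f w0) * qn (v - w0) <= normc (f w0) / 2.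
    rewrite mulrAC [_ / 2]mulrC ler_wpM2r ?normc_ge0 //.
    have h3 : 192 * d%:R * 2 ^+ d * ka <= 1 :> R.
      rewrite /ka ler_pdivrMr ?mul1r; last exact: lt_le_trans k16.
      by rewrite lerDr.
    have h4 : 96 * d%:R * 2 ^+ d / rho * qn (v - w0) <= 96 * d%:R * 2 ^+ d / rho * (ka * rho).
      by rewrite ler_wpM2l // divr_ge0 ?(ltW rho0) // !mulr_ge0 ?exprn_ge0.
    apply: le_trans h4 _.
    have -> : 96 * d%:R * 2 ^+ d / rho * (ka * rho) = 192 * d%:R * 2 ^+ d * ka / 2.
      by field; rewrite gt_eqF.
    by move: h3; move: (192 * d%:R * 2 ^+ d * ka) => x; clear; lra.
  have h5 := normcB_tri (f w0) (f v); rewrite normcB_sym in h5.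
  by move: h1 h2 h5; move: (96 * d%:R * 2 ^+ d / rho * normc (f w0) * qn (v - w0)) => x; clear; lra.
have bsub : box_set (cubebox w0 (ka * rho)) `<=` D.
  move=> v /(cubebox_sub kr)/sub h; apply: inD; apply: le_trans h _; move: rho2; clear; lra.
have m0 : 0 <= (normc (f w0) / 2) ^+ 2 by rewrite exprn_ge0 // divr_ge0 // ltW.
have := integral_box_ge (g := fun z => sqmod (f z)) (fun z _ => sqmod_ge0 _) bsub m0.
rewrite vol_cubebox // -/(sqnorm D f) (NE (bergman_L2 bf)) lee_fin => H.
have {}H : (2 * (ka * rho)) ^+ 2 ^+ d * (normc (f w0) / 2) ^+ 2 <= N D f.
  apply: H => v /(cubebox_sub kr)/low h; rewrite sqmodE ler_pXn2r ?nnegrE ?normc_ge0 //.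
  by rewrite divr_ge0 // ltW.
rewrite -(ler_pM2l (_ : 0 < ka ^+ 2 ^+ d * 4 ^+ d / 4)); last first.
  by rewrite divr_gt0 // mulr_gt0 ?exprn_gt0.
have -> : ka ^+ 2 ^+ d * 4 ^+ d / 4 * (4 / ka ^+ 2 ^+ d / 4 ^+ d * N D f) = N D f.
  have a1 : ka ^+ 2 ^+ d != 0 by rewrite gt_eqF // !exprn_gt0.
  have a3 : (4 ^+ d : R) != 0 by rewrite gt_eqF // !exprn_gt0.
  by move: (ka ^+ 2 ^+ d) (4 ^+ d) (N D f) a1 a3 => x u v; clear=> *; field; apply/andP.
apply: le_trans H; rewrite le_eqVlt; apply/orP; left; apply/eqP.
rewrite [(2 * _) ^+ 2]exprMn [(2 ^+ 2 * _) ^+ d]exprMn [(ka * rho) ^+ 2]exprMn [(ka ^+ 2 * _) ^+ d]exprMn.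
by rewrite (_ : 2 ^+ 2 = 4 :> R) -?natrX //; field.
Qed.

Lemma ipBl f g (h : Cd -> C) : L2 D f -> L2 D g -> L2 D h ->
  ip D (fun z => f z - g z) h = ip D f h - ip D g h.
Proof.
move=> hf hg hh; rewrite -mulN1r -ipZl // -ipDl //; last exact: L2Z.
by apply: eq_ip => z _ //; rewrite mulN1r.
Qed.

Lemma N_sub f g : L2 D f -> L2 D g ->
  N D (fun z => f z - g z) = N D f + N D g - 2 * Re (ip D f g).
Proof.
move=> hf hg; transitivity (N D (fun z => f z + -1 * g z)).
  by apply: eq_N => z _; rewrite mulN1r.
rewrite ND //; last exact: L2Z.
rewrite NZ // ipZr // (_ : sqmod (-1 : C) = 1); last by rewrite /sqmod /= oppr0 expr0n sqrrN expr1n addr0.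
by rewrite mul1r (_ : (-1 : C)^*%C = -1) ?mulN1r ?ReN ?mulrN //; apply: complex_eqP; rewrite /= ?oppr0.
Qed.

Lemma bergmanB f g : bergman D f -> bergman D g -> bergman D (fun z => f z - g z).
Proof.
move=> hf hg; have := bergmanD hf (bergmanZ (-1) hg).
by under eq_fun do rewrite mulN1r.
Qed.

Lemma bergman0 M : (forall z, D z -> qn z <= M) -> bergman D (fun=> 0).
Proof. by move=> /bergman1/(bergmanZ 0); under eq_fun do rewrite mul0r. Qed.

Lemma ReZr (k : R) (z : C) : Re (k%:C%C * z) = k * Re z.
Proof. by rewrite ReM /= mul0r subr0. Qed.

Lemma sqmodR (k : R) : sqmod (k%:C%C : C) = k ^+ 2.
Proof. by rewrite /sqmod /= expr0n addr0. Qed.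

Lemma conjR (k : R) : (k%:C^* = k%:C :> C)%C.
Proof. by apply: complex_eqP; rewrite /= ?oppr0. Qed.

Lemma le_eps (x k : R) : 0 <= k -> (forall e : R, 0 < e -> x <= e * k) -> x <= 0.
Proof.
move=> k0 h; rewrite leNgt; apply/negP => x0.
have k1 : 0 < 2 * (k + 1) by move: k0; clear; lra.
have := h (x / (2 * (k + 1))); rewrite divr_gt0 // => /(_ isT).
rewrite mulrAC ler_pdivlMr // -ler_pdivrMl //.
rewrite mulKf ?gt_eqF //.
move: x0 k0; clear; lra.
Qed.

(** The rate is the one obtained from the parallelogram identity for a sequence that minimizes up to
    1/(n+1). *)
Definition fast_cauchy (u : nat -> Cd -> C) := (forall n, bergman D (u n)) /\
  forall m n, N D (fun z => u m z - u n z) <= 2 * m.+1%:R^-1 + 2 * n.+1%:R^-1.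

Lemma loc_cauchy u z : (0 < d)%N -> open D -> fast_cauchy u -> D z -> exists r : R, [/\ 0 < r, forall w, qn (w - z) <= r -> D w &
  forall e : R, 0 < e -> exists n0, forall m n, (n0 <= m)%N -> (n0 <= n)%N ->
    forall w, qn (w - z) <= r -> normc (u m w - u n w) < e].
Proof.
move=> d0 oD [hu uC] Dz; have /open_Cd/(_ z Dz)[r r0 hr] := oD.
have r2 : 0 < r / 2 by rewrite divr_gt0.
have hr2 w : qn (w - z) <= r / 2 -> D w by move=> h; apply: hr; move: h r0; clear; lra.
have [K K0 hK] := point_estimate d0 r2 hr2.
exists (r / 2 / 2); split; first by rewrite divr_gt0.
  by move=> w h; apply: hr2; move: h r0; clear; lra.
move=> e e0; have e1 : 0 < e ^+ 2 / (4 * K) by rewrite divr_gt0 ?exprn_gt0 ?mulr_gt0.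
have [n0 hn0] := inv_small e1; exists n0 => m n /hn0 hm /hn0 hn w hw.
have := hK _ (bergmanB (hu m) (hu n)) w hw => h.
rewrite -(ltr_pXn2r (_ : (0 < 2)%N)) ?nnegrE ?normc_ge0 ?(ltW e0) // -sqmodE.
apply: le_lt_trans h _; rewrite mulrC -ltr_pdivlMr //; apply: le_lt_trans (uC m n) _.
have -> : e ^+ 2 / K = 4 * (e ^+ 2 / (4 * K)) by field; rewrite gt_eqF.
by move: hm hn; move: (m.+1%:R^-1) (n.+1%:R^-1) (e ^+ 2 / _) => x y q; clear; lra.
Qed.

Lemma limit_exists u : (0 < d)%N -> open D -> fast_cauchy u -> exists f, forall z, D z -> exists r : R, [/\ 0 < r,
  forall w, qn (w - z) <= r -> D w &
  forall e : R, 0 < e -> exists n0, forall n, (n0 <= n)%N ->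
    forall w, qn (w - z) <= r -> normc (f w - u n w) < e].
Proof.
move=> d0 oD uC; have lim z : exists l, D z -> forall e : R, 0 < e -> exists n0, forall n, (n0 <= n)%N -> normc (u n z - l) < e.
  have [Dz|nDz] := pselect (D z); last by exists 0.
  have [r [r0 _ hr]] := loc_cauchy d0 oD uC Dz.
  have [|l hl] := @C_complete _ (fun n => u n z); last by exists l.
  move=> e /hr[n0 h]; exists n0 => m n hm hn; apply: h => //.
  by rewrite subrr qn0 ltW.
have [f hf] := choice lim; exists f => z Dz.
have [r [r0 rD hr]] := loc_cauchy d0 oD uC Dz; exists r; split => // e e0.
have e2 : 0 < e / 2 by rewrite divr_gt0.
have [n0 h] := hr _ e2; exists n0 => n hn w wr.
have [n1 h1] := hf w (rD w wr) _ e2.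
have := h1 (maxn n0 n1) (leq_maxr _ _); have := h (maxn n0 n1) n (leq_maxl _ _) hn w wr.
rewrite normcB_sym => a b; rewrite (_ : f w - u n w = (f w - u (maxn n0 n1) w) - (u n w - u (maxn n0 n1) w)); last by ring.
apply: le_lt_trans (le_normcD _ _) _; rewrite normcN [normc (f w - _)]normcB_sym; move: a b; clear; lra.
Qed.

(** Completeness of the Bergman space: by [point_estimate] the convergence is locally uniform, so
    the limit is holomorphic, and [integral_fatou] carries the norm bound over to it. *)
Lemma limit_bergman u : (0 < d)%N -> open D -> fast_cauchy u ->
  exists2 f, bergman D f & forall n, N D (fun z => f z - u n z) <= 4 * n.+1%:R^-1.
Proof.
move=> d0 oD fu; have [f hf] := limit_exists d0 oD fu; have [hu uC] := fu.
have hol : holomorphic_on D f.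
  apply: holo_limit => z /hf[r [r0 rD hr]]; exists r => // e /hr[n0 h].
  exists (u n0); last by move=> w /ltW wr; rewrite ltW // h.
  by apply: holo_sub (proj1 (hu n0)) => w /= /ltW /rD.
have unif (K : set Cd) : compact K -> K `<=` D -> forall e : R, 0 < e -> exists n0, forall n, (n0 <= n)%N ->
    forall w, K w -> normc (f w - u n w) < e.
  move=> cK KD e e0.
  have H z : exists rn : R * nat, D z -> 0 < rn.1 /\ forall n, (rn.2 <= n)%N ->
      forall w, qn (w - z) <= rn.1 -> normc (f w - u n w) < e.
    have [Dz|nDz] := pselect (D z); last by exists (0, 0%N).
    have [r [r0 rD /(_ e e0)[n0 h]]] := hf z Dz; by exists (r, n0).
  have [rn hrn] := choice H.
  have [|s sK hs] := compact_finite_cover (rho := fun z => (rn z).1) cK.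
    by move=> z /KD /hrn[].
  exists (\max_(z <- s) (rn z).2) => n hn w /hs[z zs wz].
  have [_ h] := hrn z (KD _ (sK _ zs)).
  apply: h (ltW wz); apply: leq_trans hn.
  by rewrite (big_rem z) //= leq_maxl.
have fat n : (sqnorm D (fun z => (f z - u n z)%R) <= (4 * n.+1%:R^-1)%R%:E)%E.
  apply: integral_fatou => [z _|K cK KD e e0]; first exact: sqmod_ge0.
  have [|A A0 hA] := @compact_bound _ _ K (fun z => normc (f z - u n z)) cK.
    move=> z /KD Dz; apply: continuous_normc; apply: continuousB.
      exact: holo_cont hol Dz.
    exact: holo_cont (proj1 (hu n)) Dz.
  have de : 0 < e / (2 * A) by rewrite divr_gt0 // mulr_gt0.
  have [n0 hn0] := unif K cK KD _ de; pose m := maxn n0 n.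
  exists (fun z => sqmod (u m z - u n z)); split => [z _||z Kz]; first exact: sqmod_ge0.
    rewrite -/(sqnorm D (fun z => u m z - u n z)) (NE (bergman_L2 (bergmanB (hu m) (hu n)))) lee_fin.
    apply: le_trans (uC m n) _.
    have : m.+1%:R^-1 <= n.+1%:R^-1 :> R by rewrite lef_pV2 ?posrE // ler_nat ltnS leq_maxr.
    by move: (m.+1%:R^-1) (n.+1%:R^-1) => x y; clear; lra.
  have h1 := hn0 m (leq_maxl _ _) z Kz; have h2 := hA z Kz.
  have h3 := normcB_tri (f z - u n z) (u m z - u n z).
  rewrite (_ : f z - u n z - (u m z - u n z) = f z - u m z) in h3; last by ring.
  rewrite !sqmodE; have p1 := normc_ge0 (f z - u n z); have p2 := normc_ge0 (u m z - u n z).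
  have p3 := normc_ge0 (f z - u m z).
  have {}h1 : normc (f z - u m z) * (2 * A) <= e by rewrite -ler_pdivlMr ?mulr_gt0 // ltW.
  have q := ler_wpM2l p3 h2; move: h1 h3 p1 p2 p3 q.
  move: (normc (f z - u n z)) (normc (f z - u m z)) (normc (u m z - u n z)) => x t y.
  clear => h1 h3 x0 y0 t0 q; have [xt|tx] := lerP x t; first by nra.
  have : (x - t) ^+ 2 <= y ^+ 2 by rewrite ler_pXn2r ?nnegrE //; lra.
  by have := sqr_ge0 t; nra.
have bf n : bergman D (fun z => f z - u n z).
  split; first exact: holoB hol (proj1 (hu n)).
  by apply: le_lt_trans (fat n) _; rewrite ltry.
exists f => [|n]; last exact: N_le (bergman_L2 (bf n)) (fat n).
by have := bergmanD (bf 0%N) (hu 0%N); under eq_fun do rewrite subrK.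
Qed.

(* The representing vector is the limit of a minimizing sequence for N f - 2 Re (L f). *)
Lemma riesz M (L : (Cd -> C) -> C) (c : R) : (0 < d)%N -> open D -> (forall z, D z -> qn z <= M) ->
  (forall f g, bergman D f -> bergman D g -> L (fun z => f z + g z) = L f + L g) ->
  (forall (k : C) f, bergman D f -> L (fun z => k * f z) = k * L f) ->
  (forall f, bergman D f -> 2 * Re (L f) <= N D f + c) ->
  exists2 h, bergman D h & forall f, bergman D f -> L f = ip D f h.
Proof.
move=> d0 oD bD LD LZ Lb.
pose J f := N D f - 2 * Re (L f).
pose S := [set J f | f in bergman D].
(* The last hypothesis on [L], a norm bound in additive form, says precisely that [J] is bounded
   below by [- c]. *)
have hS : has_inf S.
  split; first by exists (J (fun=> 0)); exists (fun=> 0) => //; exact: bergman0 bD.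
  by exists (- c) => _ [f bf <-]; have := Lb f bf; rewrite /J; clear; lra.
pose m := inf S.
have mJ f : bergman D f -> m <= J f by move=> bf; apply: ge_inf; [case: hS|exists f].
have mini (n : nat) : exists f, bergman D f /\ J f <= m + n.+1%:R^-1.
  have n0 : 0 < n.+1%:R^-1 :> R by rewrite invr_gt0.
  by have [_ [f bf <-] h] := inf_adherent n0 hS; exists f; split => //; exact: ltW.
have [u hu] := choice mini.
have bu n : bergman D (u n) by case: (hu n).
have uJ n : J (u n) <= m + n.+1%:R^-1 by case: (hu n).
(* [J] at the midpoint of [u i] and [u j] is at least [m]; in the expansion the linear terms cancel
   and the parallelogram identity remains. *)
have uC i j : N D (fun z => u i z - u j z) <= 2 * i.+1%:R^-1 + 2 * j.+1%:R^-1.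
  have bi := bu i; have bj := bu j.
  have := mJ _ (bergmanZ (2^-1)%:C%C (bergmanD bi bj)).
  rewrite /J NZ; last exact: L2D (bergman_L2 bi) (bergman_L2 bj).
  rewrite LZ; last exact: bergmanD.
  rewrite LD // ND; [|exact: bergman_L2|exact: bergman_L2].
  rewrite N_sub; [|exact: bergman_L2|exact: bergman_L2].
  rewrite ReZr ReD sqmodR.
  have := uJ i; have := uJ j; rewrite /J.
  move: (N D (u i)) (N D (u j)) (Re (L (u i))) (Re (L (u j))) (Re (ip _ _ _)) (i.+1%:R^-1) (j.+1%:R^-1).
  clear; move=> x1 x2 x3 x4 x5 x6 x7 h1 h2; lra.
have [f bf hf] := limit_bergman d0 oD (conj bu uC).
(* Variational inequality: [u n - e g] is compared with the infimum for [n] so large that 1/(n+1) <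
   e^2, then [f] replaces [u n] by Cauchy-Schwarz with weight 1/e. All errors are O(e) after
   division by [e]. *)
have half g : bergman D g -> Re (ip D f g) - Re (L g) <= 0.
  move=> bg; apply: (@le_eps _ (5 + 2 * N D g)).
    by have := N_ge0 D g; clear; lra.
  move=> e e0; have e2 : 0 < e ^+ 2 by rewrite exprn_gt0.
  have [n /(_ n (leqnn n)) hn] := inv_small e2.
  have := mJ _ (bergmanD (bu n) (bergmanZ (- e)%:C%C bg)).
  have hun := bergman_L2 (bu n); have hg := bergman_L2 bg.
  rewrite /J ND //; last exact: L2Z.
  rewrite NZ // LD //; last exact: bergmanZ.
  rewrite LZ // ipZr // ReD conjR !ReZr sqmodR.
  have e1 : 0 < e^-1 by rewrite invr_gt0.
  have := cauchy_schwarz_eps (bergman_L2 (bergmanB bf (bu n))) hg e1.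
  rewrite ipBl //; last exact: bergman_L2.
  rewrite ReD ReN invrK.
  have h3 : e^-1 * N D (fun z => f z - u n z) <= 4 * e.
    rewrite ler_pdivrMl //; apply: le_trans (hf n) _.
    by move: hn; rewrite expr2 mulrCA; move: (n.+1%:R^-1) (e * e) => x y; clear; lra.
  have := uJ n; rewrite /J; have := N_ge0 D g.
  move: h3 hn e0.
  move: (Re (ip D f g)) (Re (ip D (u n) g)) (Re (L g)) (Re (L (u n))) (N D (u n)) (N D g) (N D _) (n.+1%:R^-1).
  clear => a b l lu nu ng nn x h3 hn e0 ng0 h1 h2 h4.
  have {}h4 : 2 * e * (b - l) <= e ^+ 2 * (1 + ng) by move: h1 hn h4; clear; nra.
  have {}h4 : 2 * (b - l) <= e * (1 + ng).
    by rewrite -(ler_pM2l e0) (le_trans _ (le_trans h4 _)) // le_eqVlt; apply/orP; left; apply/eqP; ring.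
  have p := mulr_ge0 (ltW e0) ng0.
  by move: h2 h3 h4 p e0; move: (e^-1 * nn) => y; clear; nra.
have reE g : bergman D g -> Re (ip D f g) = Re (L g).
  move=> bg; apply/eqP; rewrite eq_le; have := half _ bg; rewrite subr_le0 => -> /=.
  have := half _ (bergmanZ (-1) bg); rewrite LZ // ipZr; [|exact: bergman_L2|exact: bergman_L2].
  by rewrite !ReM /= !oppr0 !mul0r !subr0 !mulN1r opprK addrC subr_le0.
exists f => // g bg; rewrite -ip_conj; apply: complex_eqP.
  by rewrite -reE //; case: (ip D f g).
have := reE _ (bergmanZ 'i%C bg); rewrite LZ // ipZr; [|exact: bergman_L2|exact: bergman_L2].
by rewrite !ReM /=; case: (ip D f g) => x y /=; clear; lra.
Qed.
End Bergman.

(** * Segments, and connectedness of cubes *)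

Section Convex.
Variables (R : realType) (d : nat).
Local Notation C := (Cx R).
Local Notation Cd := (Cd R d).

Lemma qnZ (t : R) (v : Cd) : qn (t%:C%C *: v) <= `|t| * qn v.
Proof.
have t0 := normr_ge0 t; apply/qn_leP => [|j]; first by rewrite mulr_ge0 ?qn_ge0.
have := cmax_qn v j; rewrite mxE !cmax_le ReM ImM /= !mul0r subr0 addr0 !normrM => /andP[h1 h2].
by rewrite !ler_wpM2l.
Qed.

Definition seg (a b : Cd) : set Cd := [set a + t%:C%C *: (b - a) | t in `[0, 1]].

Lemma seg_cont (a b : Cd) : continuous (fun t : R => a + t%:C%C *: (b - a)).
Proof.
move=> t A /nbhs_Cd[e e0 hA]; apply/nbhs_ballP.
have k0 : 0 < qn (b - a) + 1 by rewrite ltr_wpDl ?qn_ge0.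
exists (e / (qn (b - a) + 1)) => /=; first by rewrite divr_gt0.
move=> s; rewrite /ball /= => ts; apply: hA.
rewrite opprD addrACA subrr add0r -scalerBl -rmorphB.
apply: le_lt_trans (qnZ _ _) _; rewrite distrC in ts.
have : `|s - t| * (qn (b - a) + 1) < e by rewrite -ltr_pdivlMr.
by have := normr_ge0 (s - t); move: (`|s - t|) (qn _) => x y; clear; lra.
Qed.

Lemma connected_seg a b : connected (seg a b).
Proof.
apply: connected_continuous_connected; first exact: segment_connected.
by apply: continuous_subspaceT => t; exact: seg_cont.
Qed.

Lemma compact_seg a b : compact (seg a b).
Proof.
apply: continuous_compact; last exact: segment_compact.
by apply: continuous_subspaceT => t; exact: seg_cont.
Qed.

Lemma seg_start a b : seg a b a.
Proof. by exists 0; rewrite /= ?in_itv /= ?lexx ?ler01 // (_ : (0 : R)%:C%C = 0) // scale0r addr0. Qed.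

Lemma seg_end a b : seg a b b.
Proof.
exists 1; rewrite /= ?in_itv /= ?lexx ?ler01 // (_ : (1 : R)%:C%C = 1) // scale1r.
by rewrite addrC subrK.
Qed.

Lemma convex_connected (A : set Cd) : (forall a b, A a -> A b -> seg a b `<=` A) -> connected A.
Proof.
move=> cA; have [[a Aa]|A0] := pselect (A !=set0); last first.
  have -> : A = set0 by apply/seteqP; split => // z Az; case: A0; exists z.
  exact: connected0.
have -> : A = \bigcup_(b in A) seg a b.
  apply/seteqP; split => [z Az|z [b Ab]]; first by exists z => //; exact: seg_end.
  exact: cA.
apply: bigcup_connected => [|b _]; last exact: connected_seg.
by exists a => b _; exact: seg_start.
Qed.

Lemma seg_qn a b v w : seg a b w -> forall r, qn (a - v) <= r -> qn (b - v) <= r -> qn (w - v) <= r.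
Proof.
move=> [t /=]; rewrite in_itv /= => /andP[t0 t1] <- r ar br.
rewrite (_ : _ - v = (1 - t)%:C%C *: (a - v) + t%:C%C *: (b - v)); last first.
  apply/rowP => j; rewrite !mxE (_ : (1 - t)%:C%C = 1 - t%:C%C); first by ring.
  by apply: complex_eqP; rewrite /= ?subr0.
apply: le_trans (qnD _ _) _; have h1 := qnZ (1 - t) (a - v); have h2 := qnZ t (b - v).
rewrite ger0_norm ?subr_ge0 // in h1; rewrite ger0_norm // in h2.
by move: h1 h2 ar br t0 t1; move: (qn _) (qn _) (qn (a - v)) (qn (b - v)) => x y a' b'; clear; nra.
Qed.

Lemma connected_ccube z r : connected [set w : Cd | qn (w - z) <= r].
Proof. by apply: convex_connected => a b /= ar br w /seg_qn h; exact: h. Qed.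

Lemma connected_cube z r : connected [set w : Cd | qn (w - z) < r].
Proof.
apply: convex_connected => a b /= ar br w /seg_qn h.
apply: le_lt_trans (h z (Num.max (qn (a - z)) (qn (b - z))) _ _) _.
- by rewrite le_max lexx.
- by rewrite le_max lexx orbT.
- by rewrite gt_max ar br.
Qed.

Lemma open_cube z r : open [set w : Cd | qn (w - z) < r].
Proof.
apply/open_Cd => w /= wr; exists (r - qn (w - z)); first by rewrite subr_gt0.
by move=> v; have := qn_tri v w z; clear; lra.
Qed.
End Convex.

(** * Operators commuting with the multiplications *)

Section Peak.
Variables (R : realType) (d : nat) (D : set (Cd R d)).
Local Notation C := (Cx R).
Local Notation Cd := (Cd R d).
Implicit Types (f g k F G : Cd -> C).
Local Notation Re := complex.Re.
Local Notation Im := complex.Im.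

(** If h(mu) > 0, the integral of p^n h near [mu] is at least a constant times q'^n, whereas farther
    away its negative part is at most q^n times the integral of |h|, with q < q'. As the total is 0,
    (q'/q)^n would stay bounded. *)
Lemma peak_le0 (h p : Cd -> R) mu : open D -> D mu -> L1 D h -> contD D p ->
  (forall z, D z -> 0 <= p z <= 1) -> p mu = 1 ->
  (forall r : R, 0 < r -> exists2 q : R, 0 < q < 1 & forall z, D z -> r <= qn (z - mu) -> p z <= q) ->
  (forall n, Iv D (fun z => p z ^+ n * h z) = 0) -> h mu <= 0.
Proof.
move=> oD Dmu hh cp p01 pmu hq hI; rewrite leNgt; apply/negP => h0.
have ch : contD D h by case: hh.
have /continuous_CdR/(_ (h mu / 2))[|r1 r10 hr1] := ch mu Dmu; first by rewrite divr_gt0.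
have /open_Cd/(_ mu Dmu)[r2 r20 hr2] := oD.
pose r := Num.min r1 r2; have r0 : 0 < r by rewrite lt_min r10.
have [q /andP[q0 q1] hpq] := hq r r0.
pose q' := (q + 1) / 2; have qq' : q < q' by rewrite /q'; move: q1; clear; lra.
have q'1 : q' < 1 by rewrite /q'; move: q1; clear; lra.
have /continuous_CdR/(_ (1 - q'))[|r3 r30 hr3] := cp mu Dmu; first by rewrite subr_gt0.
pose s := Num.min r r3 / 2; have s0 : 0 < s by rewrite divr_gt0 // lt_min r0.
have sr w : qn (w - mu) <= s -> [/\ qn (w - mu) < r1, qn (w - mu) < r2 & qn (w - mu) < r3].
  move=> ws; have : qn (w - mu) < Num.min r r3.
    by apply: le_lt_trans ws _; rewrite /s; move: s0; rewrite /s; move: (Num.min _ _) => x; clear; lra.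
  by rewrite !lt_min => /andP[/andP[-> ->] ->].
pose V := vol (cubebox mu s).
have V0 : 0 < V by rewrite /V vol_cubebox ?(ltW s0) // !exprn_gt0 // mulr_gt0.
have bsub : box_set (cubebox mu s) `<=` D by move=> w /(cubebox_sub (ltW s0))/sr[_ /hr2].
have ha := L1_abs hh; have A0 := fI_ge0 (fun z (_ : D z) => normr_ge0 (h z)).
have key n : V * (h mu / 2 * q' ^+ n) <= q ^+ n * fI D (fun z => `|h z|).
  have lp : L1 D (fun z => p z ^+ n * h z).
    have [_ _ fin] := ha; apply: L1_dom fin => [|z Dz].
      exact: contD_mul (contDX (n := n) cp) ch.
    have /andP[p0 p1] := p01 z Dz.
    by rewrite normrM ler_piMl // ger0_norm ?exprn_ge0 // exprn_ile1.
  have lq := L1Z (q ^+ n) (L1pos_L1 ha).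
  have := IvD lp lq; rewrite hI add0r IvZ; last exact: L1pos_L1.
  rewrite (Iv_ge0E ha) => <-.
  (* The added term makes the integrand nonnegative: within [r] of [mu] because h > 0 there,
     elsewhere because p <= q. It can then be bounded below on a single box. *)
  have pos0 z : D z -> 0 <= p z ^+ n * h z + q ^+ n * `|h z|.
    move=> Dz; have /andP[p0 p1] := p01 z Dz.
    have qn0 : 0 <= q ^+ n by rewrite exprn_ge0 // ltW.
    have pn0 : 0 <= p z ^+ n by rewrite exprn_ge0.
    have [zr|zr] := ltP (qn (z - mu)) r.
      have : 0 <= h z.
        have : qn (z - mu) < r1 by move: zr; rewrite lt_min => /andP[].
        by move=> /hr1; rewrite ltr_norml => /andP[+ _]; move: h0; clear; lra.
      by move=> hz; rewrite addr_ge0 // mulr_ge0.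
    have : p z ^+ n <= q ^+ n by rewrite lerXn2r ?nnegrE ?(ltW q0) // hpq.
    have := ler_norm (h z); have := ler_norm (- h z); rewrite normrN.
    have := normr_ge0 (h z).
    move: pn0 qn0; move: (h z) (`|h z|) (p z ^+ n) (q ^+ n) => x y u v; clear; nra.
  have lpos : L1pos D (fun z => p z ^+ n * h z + q ^+ n * `|h z|).
    have [cl fl] := L1D lp lq; split => //; apply: le_lt_trans fl.
    by apply: integral_mono => // z Dz; exact: ler_norm.
  rewrite (Iv_ge0E lpos) -lee_fin fIK //; apply: integral_box_ge => //.
    by rewrite mulr_ge0 ?divr_ge0 ?exprn_ge0 // ltW // (lt_trans q0).
  move=> z /(cubebox_sub (ltW s0))/sr[z1 z2 z3].
  have := hr1 z z1; have := hr3 z z3; rewrite pmu !ltr_norml => /andP[h1 _] /andP[h2 _].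
  have hp : q' <= p z by move: h1; clear; lra.
  have hz : h mu / 2 <= h z by move: h2; clear; lra.
  have q'0 : 0 <= q' by rewrite ltW // (lt_trans q0).
  apply: le_trans (_ : p z ^+ n * h z <= _); last by rewrite lerDl mulr_ge0 ?exprn_ge0 // ltW.
  rewrite [leLHS]mulrC; apply: ler_pM => //; [exact: exprn_ge0|by rewrite divr_ge0 // ltW|].
  by rewrite lerXn2r ?nnegrE // (le_trans q'0).
pose x := q' / q; have x1 : 1 < x by rewrite /x ltr_pdivlMr // mul1r.
pose A := fI D (fun z => `|h z|) / (V * (h mu / 2)).
have VA0 : 0 < V * (h mu / 2) by rewrite mulr_gt0 // divr_gt0.
have bx n : x ^+ n <= A.
  rewrite /x expr_div_n ler_pdivrMr ?exprn_gt0 // /A mulrAC ler_pdivlMr //.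
  by rewrite [leLHS]mulrC -mulrA [leRHS]mulrC; exact: key.
have bern n : 1 + n%:R * (x - 1) <= x ^+ n.
  elim: n => [|n IH]; first by rewrite mul0r addr0 expr0.
  rewrite exprS; apply: le_trans (_ : x * (1 + n%:R * (x - 1)) <= _); last first.
    by rewrite ler_wpM2l // ltW // (lt_trans ltr01).
  have n0 : 0 <= n%:R :> R by [].
  rewrite -subr_ge0 (_ : _ - _ = n%:R * (x - 1) ^+ 2); last by rewrite -natr1; ring.
  by rewrite mulr_ge0 ?sqr_ge0.
have [n0 hn0] := big_nat_ge (A / (x - 1)).
have := le_trans (bern n0.+1) (bx n0.+1); have := hn0 n0 (leqnn _).
rewrite ler_pdivrMr ?subr_gt0 //; move: (_ * (x - 1)) => y; clear; lra.
Qed.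
End Peak.

Section Vstar.
Variables (R : realType) (d : nat) (D : set (Cd R d)).
Local Notation C := (Cx R).
Local Notation Cd := (Cd R d).
Implicit Types (f g k F G : Cd -> C).
Local Notation Re := complex.Re.
Local Notation Im := complex.Im.

(** The real inequality is applied to the real parts of F, -F, iF and -iF. *)
Lemma peak_eq0 F (p : Cd -> R) mu : open D -> D mu -> CL1 D F -> contD D p ->
  (forall z, D z -> 0 <= p z <= 1) -> p mu = 1 ->
  (forall r : R, 0 < r -> exists2 q : R, 0 < q < 1 & forall z, D z -> r <= qn (z - mu) -> p z <= q) ->
  (forall n, CI D (fun z => (p z)%:C%C ^+ n * F z) = 0) -> F mu = 0.
Proof.
move=> oD Dmu lF cp p01 pmu hq hI.
have E (k : C) n : Iv D (fun z => p z ^+ n * Re (k * F z)) = 0.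
  transitivity (Re (CI D (fun z => k * ((p z)%:C%C ^+ n * F z)))).
    by apply: eq_Iv => z _; rewrite mulrCA -rmorphXn ReZr.
  rewrite CIZ ?hI ?mulr0 //; apply: (@CL1_bounded _ _ _ _ _ 1) => //.
    move=> z Dz; have /= := ccontDX (D := D) (F := fun z => (p z)%:C%C) (n := n) _ Dz; apply.
    by apply: ccontD_ReIm => //= u _; exact: cst_continuous.
  move=> z Dz; have /andP[p0 p1] := p01 z Dz.
  by rewrite normcX normcR ger0_norm // exprn_ile1.
have P (k : C) : Re (k * F mu) <= 0.
  apply: (peak_le0 oD Dmu (h := fun z => Re (k * F z)) _ cp p01 pmu hq (E k)).
  exact: CL1_Re (CL1Z k lF).
have := P 1; have := P (-1); have := P 'i%C; have := P (- 'i%C).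
rewrite !ReM /= !oppr0 !mul0r !mul1r !mulN1r !sub0r !subr0 opprK => h1 h2 h3 h4.
by apply: complex_eqP => /=; apply/eqP; rewrite eq_le; move: h1 h2 h3 h4; clear => *; apply/andP; split; lra.
Qed.

Variables (T : (Cd -> C) -> (Cd -> C)) (M : R).
Hypothesis d0 : (0 < d)%N.
Hypothesis oD : open D.
Hypothesis bD : forall z, D z -> qn z <= M.
Hypothesis bT : bounded_op D T.

Lemma bergT f : bergman D f -> bergman D (T f).
Proof. by case: bT => h _ _ _; exact: h. Qed.

Lemma eqT f g : bergman D f -> bergman D g -> (forall z, D z -> f z = g z) ->
  forall z, D z -> T f z = T g z.
Proof. by case: bT => _ h _ _; exact: h. Qed.

Lemma TD f g : bergman D f -> bergman D g -> forall z, D z -> T (fun z => f z + g z) z = T f z + T g z.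
Proof.
move=> hf hg z Dz; case: bT => _ _ h _; have := h 1 f g hf hg z Dz.
by rewrite mul1r => <-; under [in RHS]eq_fun do rewrite mul1r.
Qed.

Lemma T0 z : D z -> T (fun=> 0) z = 0.
Proof.
move=> Dz; have b0 := bergman0 bD; have := TD b0 b0 Dz.
under eq_fun do rewrite addr0.
by move=> h; apply: (addrI (T (fun=> 0) z)); rewrite -h addr0.
Qed.

Lemma TZ (c : C) f : bergman D f -> forall z, D z -> T (fun z => c * f z) z = c * T f z.
Proof.
move=> hf z Dz; case: bT => _ _ h _; have := h c f _ hf (bergman0 bD) z Dz.
by rewrite T0 // addr0 => <-; under [in RHS]eq_fun do rewrite addr0.
Qed.

(** [k] is T^* g; a relation suffices, with existence from [adj_exists]. *)
Definition adj g k := [/\ bergman D g, bergman D k & forall f, bergman D f -> ip D (T f) g = ip D f k].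

Lemma NT_bound : exists2 c : R, 0 < c & forall f, bergman D f -> N D (T f) <= c * N D f.
Proof.
case: bT => hb _ _ [c hc]; exists (`|c| + 1) => [|f bf]; first by rewrite ltr_wpDl.
have := hc f bf; rewrite (NE (bergman_L2 bf)) (NE (bergman_L2 (hb f bf))) -EFinM lee_fin => h.
apply: le_trans h _; by rewrite ler_wpM2r ?N_ge0 // ler_wpDr ?ler_norm.
Qed.

Lemma adj_exists g : bergman D g -> exists k, adj g k.
Proof.
move=> bg; have [c c0 hc] := NT_bound.
have [f1 g1|a f1|f1|k bk hk] := @riesz _ _ D M (fun f => ip D (T f) g) (c * N D g) d0 oD bD.
- move=> b1 b2; rewrite -ipDl; [|exact: bergman_L2 (bergT b1)|exact: bergman_L2 (bergT b2)|exact: bergman_L2].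
  by apply: eq_ip => z Dz //; exact: TD.
- move=> b1; rewrite -ipZl; [|exact: bergman_L2 (bergT b1)|exact: bergman_L2].
  by apply: eq_ip => z Dz //; exact: TZ.
- move=> b1; have c1 : 0 < c^-1 by rewrite invr_gt0.
  apply: le_trans (cauchy_schwarz_eps (bergman_L2 (bergT b1)) (bergman_L2 bg) c1) _.
  by rewrite invrK [N D g * c]mulrC lerD2r ler_pdivrMl //; exact: hc.
by exists k.
Qed.

(** [in_Vstar] speaks of the adjoint of a multiplication only through functions representing its
    values; Riesz supplies such a function for every [f], so that the hypothesis can be put to
    use. *)
Lemma mult_adj_exists (phi : Cd -> C) B f : holomorphic_on D phi -> 0 <= B ->
  (forall z, D z -> normc (phi z) <= B) -> bergman D f -> exists h, adjoint_mult D phi f h.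
Proof.
move=> hp B0 hB bf.
have bp g : bergman D g -> bergman D (fun z => phi z * g z) by move=> bg; exact: bergmanM bg hp B0 hB.
have c0 : 0 < B ^+ 2 + 1 by rewrite ltr_wpDl // exprn_ge0.
have [f1 g1|a f1|f1|k bk hk] := @riesz _ _ D M (fun g => ip D (fun z => phi z * g z) f) ((B ^+ 2 + 1) * N D f) d0 oD bD.
- move=> b1 b2; rewrite -ipDl; [|exact: bergman_L2 (bp _ b1)|exact: bergman_L2 (bp _ b2)|exact: bergman_L2].
  by apply: eq_ip => z Dz //; rewrite mulrDr.
- move=> b1; rewrite -ipZl; [|exact: bergman_L2 (bp _ b1)|exact: bergman_L2].
  by apply: eq_ip => z Dz //; rewrite mulrCA.
- move=> b1; have c1 : 0 < (B ^+ 2 + 1)^-1 by rewrite invr_gt0.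
  apply: le_trans (cauchy_schwarz_eps (bergman_L2 (bp _ b1)) (bergman_L2 bf) c1) _.
  rewrite invrK [N D f * _]mulrC lerD2r ler_pdivrMl //.
  have [_ h] := L2_bounded (fun z Dz => holo_cont hp Dz) B0 hB (bergman_L2 b1).
  by apply: le_trans h _; rewrite ler_wpM2r ?N_ge0 // lerDl.
exists k; split; first exact: bk.
move=> g bg; by rewrite (ip_innerE (bergman_L2 (bp _ bg)) (bergman_L2 bf)) (ip_innerE (bergman_L2 bg) (bergman_L2 bk)) hk.
Qed.

Variables (phi : 'I_d -> Cd -> C) (B : R).
Hypothesis hphi : forall j, holomorphic_on D (phi j).
Hypothesis B0 : 0 <= B.
Hypothesis hB : forall j z, D z -> normc (phi j z) <= B.
Hypothesis Tphi : forall j, (forall f, bergman D f -> forall z, D z ->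
        T (fun x => phi j x * f x) z = phi j z * T f z) /\
    (forall f h, bergman D f -> adjoint_mult D (phi j) f h ->
        adjoint_mult D (phi j) (T f) (T h)).

Lemma bergphi j g : bergman D g -> bergman D (fun z => phi j z * g z).
Proof. by move=> bg; exact: bergmanM bg (hphi j) B0 (hB j). Qed.

(** The adjoint of the second commutation relation: as T commutes with the adjoint of multiplication
    by phi_j, T^* commutes with multiplication by phi_j. *)
Lemma adj_phi j g k : adj g k -> adj (fun z => phi j z * g z) (fun z => phi j z * k z).
Proof.
move=> [bg bk hk]; split; [exact: bergphi|exact: bergphi|move=> f bf].
have [h ah] := mult_adj_exists (hphi j) B0 (hB j) bf.
have [_ /(_ f h bf ah) [bTh aT]] := Tphi j; have [bh hh] := ah.
have E1 f' g' h' : bergman D f' -> adjoint_mult D (phi j) f' h' -> bergman D g' ->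
    ip D (fun z => phi j z * g' z) f' = ip D g' h'.
  move=> b1 [b3 a] b2; have := a g' b2.
  by rewrite (ip_innerE (bergman_L2 (bergphi j b2)) (bergman_L2 b1)) (ip_innerE (bergman_L2 b2) (bergman_L2 b3)).
rewrite -ip_conj (E1 _ _ _ (bergT bf) (conj bTh aT) bg) ip_conj hk //.
by rewrite -ip_conj -(E1 _ _ _ bf ah bk) ip_conj.
Qed.

Variable c : 'I_d -> C.
(** [c] will be the value of [phi] at the peak, so that all [psi j] vanish there. *)
Let psi j z := phi j z - c j.

Lemma bergpsi j g : bergman D g -> bergman D (fun z => psi j z * g z).
Proof.
move=> bg; rewrite (_ : (fun z => psi j z * g z) = fun z => phi j z * g z - c j * g z).
  by apply: bergmanB; [exact: bergphi|exact: bergmanZ].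
by rewrite funeqE => z; rewrite /psi mulrBl.
Qed.

Lemma Tpsi j f : bergman D f -> forall z, D z -> T (fun z => psi j z * f z) z = psi j z * T f z.
Proof.
move=> bf z Dz; have [+ _] := Tphi j => /(_ f bf z Dz) h.
have := TD (bergphi j bf) (bergmanZ (- c j) bf) Dz; rewrite h (TZ _ bf Dz).
rewrite /psi mulrBl -mulNr => <-; congr (T _ z).
by rewrite funeqE => w; rewrite mulrBl mulNr.
Qed.

Lemma adj_psi j g k : adj g k -> adj (fun z => psi j z * g z) (fun z => psi j z * k z).
Proof.
move=> agk; have [b1 b2 h] := adj_phi j agk; have [bg bk hk] := agk.
split; [exact: bergpsi|exact: bergpsi|move=> f bf].
have E (f' g' : Cd -> C) : bergman D f' -> bergman D g' ->
    ip D f' (fun z => psi j z * g' z) = ip D f' (fun z => phi j z * g' z) - (c j)^*%C * ip D f' g'.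
  move=> b3 b4; rewrite -ip_conj.
  rewrite (eq_ip (f' := fun z => phi j z * g' z - c j * g' z) (g' := f') _ (fun _ _ => erefl)); last first.
    by move=> z _; rewrite /psi mulrBl.
  rewrite ipBl; [|exact: bergman_L2 (bergphi j b4)|exact: bergman_L2 (bergmanZ _ b4)|exact: bergman_L2].
  rewrite ipZl; [|exact: bergman_L2|exact: bergman_L2].
  have conjB (z w : C) : (z - w)^*%C = z^*%C - w^*%C.
    by apply: complex_eqP; case: z => x y; case: w => u v /=; ring.
  by rewrite conjB conjM !ip_conj.
by rewrite (E _ _ (bergT bf) bg) (E _ _ bf bk) (h f bf) (hk f bf).
Qed.

Variable ka : R.
Let p z : R := 1 - ka * \sum_j sqmod (psi j z).

Lemma contD_p : contD D p.
Proof.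
have cs (s : seq 'I_d) : contD D (fun z => \sum_(j <- s) sqmod (psi j z)).
  elim: s => [|j s IH].
    by under eq_fun do rewrite big_nil; move=> z _; exact: cst_continuous.
  under eq_fun do rewrite big_cons; apply: contD_add IH; apply: contD_sqmod => z Dz.
  apply: continuousB; last exact: cst_continuous.
  exact: holo_cont (hphi j) Dz.
have := contD_scale (k := ka) (cs (index_enum 'I_d)) => h z Dz.
by apply: continuousB; [exact: cst_continuous|exact: h].
Qed.

Hypothesis p01 : forall z, D z -> 0 <= p z <= 1.

Lemma CI_pow_bounded n F : CL1 D F -> CL1 D (fun z => (p z)%:C%C ^+ n * F z).
Proof.
apply: (@CL1_bounded _ _ _ _ _ 1) => //.
  move=> z Dz; have /= := ccontDX (D := D) (F := fun z => (p z)%:C%C) (n := n) _ Dz; apply.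
  by apply: ccontD_ReIm => /= [|u _]; [exact: contD_p|exact: cst_continuous].
move=> z Dz; have /andP[p0 p1] := p01 Dz.
by rewrite normcX normcR ger0_norm // exprn_ile1.
Qed.

Lemma CI_sum (s : seq 'I_d) (G : 'I_d -> Cd -> C) : (forall j, CL1 D (G j)) -> 
  CL1 D (fun z => \sum_(j <- s) G j z) /\
  CI D (fun z => \sum_(j <- s) G j z) = \sum_(j <- s) CI D (G j).
Proof.
move=> hG; elim: s => [|j s [IH1 IH2]].
  under eq_fun do rewrite big_nil; rewrite big_nil.
  have l0 : CL1 D (fun=> 0).
    have b0 := bergman_L2 (bergman0 bD); have := L2_CL1 b0 b0.
    by under eq_fun do rewrite mul0r.
  split => //; rewrite -[RHS](mul0r (CI D (fun=> 0))) -(CIZ 0 l0).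
  by apply: eq_CI => z _; rewrite mul0r.
under eq_fun do rewrite big_cons; rewrite big_cons; split; first exact: CL1D.
by rewrite CID // IH2.
Qed.

(** One factor [p] multiplies u conj(v) into u conj(v) minus [ka] times the sum of (psi_j u)
    conj(psi_j v). The factor psi_j moves through T by [Tpsi], its conjugate through the adjoint by
    [adj_psi]; hence the induction has to run over all [f], [g] and [k]. *)
Lemma CI_pow n : forall f g k, bergman D f -> adj g k ->
  CI D (fun z => (p z)%:C%C ^+ n * (T f z * (g z)^*%C)) =
  CI D (fun z => (p z)%:C%C ^+ n * (f z * (k z)^*%C)).
Proof.
elim: n => [|n IH] f g k bf agk; have [bg bk hk] := agk.
  under eq_fun do rewrite expr0 mul1r; under [in RHS]eq_fun do rewrite expr0 mul1r.
  exact: hk.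
have E (f' g' : Cd -> C) : bergman D f' -> bergman D g' ->
    CI D (fun z => (p z)%:C%C ^+ n.+1 * (f' z * (g' z)^*%C)) =
    CI D (fun z => (p z)%:C%C ^+ n * (f' z * (g' z)^*%C)) -
    (ka%:C)%C * \sum_j CI D (fun z => (p z)%:C%C ^+ n * (psi j z * f' z * (psi j z * g' z)^*%C)).
  move=> b1 b2; pose G j z := (p z)%:C%C ^+ n * (psi j z * f' z * (psi j z * g' z)^*%C).
  have lG j : CL1 D (G j).
    by apply: CI_pow_bounded; apply: L2_CL1; exact: bergman_L2 (bergpsi j _).
  have [l1 e1] := CI_sum (index_enum 'I_d) lG.
  have l2 := CI_pow_bounded n (L2_CL1 (bergman_L2 b1) (bergman_L2 b2)).
  rewrite -e1 -mulNr -CIZ // -CID //; last exact: CL1Z.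
  apply: eq_CI => z _; rewrite exprS /G -mulr_sumr.
  have -> : \sum_j psi j z * f' z * (psi j z * g' z)^*%C = (\sum_j sqmod (psi j z))%:C%C * (f' z * (g' z)^*%C).
    rewrite rmorph_sum mulr_suml; apply: eq_bigr => j _.
    rewrite conjM mulrACA; congr (_ * _).
    by case: (psi j z) => x y; apply: complex_eqP; rewrite /sqmod /=; ring.
  rewrite {1}/p rmorphB rmorphM rmorph1; move: (_ ^+ n) (_ * (g' z)^*%C) => u v; ring.
rewrite (E _ _ (bergT bf) bg) (E _ _ bf bk) (IH _ _ _ bf agk).
congr (_ - _ * _); apply: eq_bigr => j _.
rewrite -(IH _ _ _ (bergpsi j bf) (adj_psi j agk)).
by apply: eq_CI => z Dz; rewrite Tpsi.
Qed.
End Vstar.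

Section Trivial.
Variables (R : realType) (d : nat).
Local Notation C := (Cx R).
Local Notation Cd := (Cd R d).

(** With u = conj(v), the holomorphic function 1 - (u - u(z0))(v - v(z0)) equals 1 - |u - u(z0)|^2.
    Where |u - u(z0)| < 1 it lies in [0, 1] and attains 1 at [z0], so it is constant by the maximum
    principle. *)
Lemma conj_holo_const (U : set Cd) (u v : Cd -> C) z0 r : holomorphic_on U u -> holomorphic_on U v ->
  0 < r -> (forall w, qn (w - z0) < r -> U w) -> (forall w, qn (w - z0) < r -> u w = (v w)^*%C) ->
  exists2 s : R, 0 < s <= r & forall w, qn (w - z0) < s -> u w = u z0.
Proof.
move=> hu hv r0 rU uv; have zz t : 0 < t -> qn (z0 - z0) < t by rewrite subrr qn0.
have Uz := rU _ (zz r r0).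
have /continuous_CdC/(_ 1 ltr01)[s1 s10 hs1] := holo_cont hu Uz.
pose s := Num.min r s1; have s0 : 0 < s by rewrite lt_min r0.
have sr w : qn (w - z0) < s -> qn (w - z0) < r /\ qn (w - z0) < s1 by rewrite lt_min => /andP[].
exists s; first by rewrite s0 ge_min lexx.
pose f w := 1 - (u w - u z0) * (v w - v z0).
have fE w : qn (w - z0) < s -> f w = (1 - sqmod (u w - u z0))%:C%C.
  move=> /sr[h _]; rewrite /f (uv w h) (uv z0 (zz r r0)).
  case: (v w) => x1 y1; case: (v z0) => x2 y2.
  by apply: complex_eqP; rewrite /sqmod /=; ring.
have hf : holomorphic_on [set w | qn (w - z0) < s] f.
  apply: holo_sub (_ : holomorphic_on U f) => [w /sr[/rU]//|].
  apply: holoB; first exact: holo_cst.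
  exact: holoM (holoB hu (@holo_cst _ _ U (u z0))) (holoB hv (@holo_cst _ _ U (v z0))).
have f1 : f z0 = 1 by rewrite /f !subrr mul0r subr0.
have n01 w : qn (w - z0) < s -> 0 <= 1 - sqmod (u w - u z0) <= 1.
  move=> /sr[_ /hs1 h]; have := sqmod_ge0 (u w - u z0).
  have : sqmod (u w - u z0) <= 1 by rewrite sqmodE exprn_ile1 ?normc_ge0 // ltW.
  by clear => a b; apply/andP; split; lra.
have mx := max_principle (@open_cube R d z0 s) (@connected_cube R d z0 s) hf (zz s s0).
move=> w ws; have := mx _ w ws; rewrite f1 normc1 => h.
have : f w = 1.
  apply: h => v' v's; rewrite fE // normcR ger0_norm; by have /andP[] := n01 v' v's.
rewrite fE // => -[] h2; have : sqmod (u w - u z0) = 0 by move: h2; clear; lra.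
by rewrite sqmodE => /eqP; rewrite expf_eq0 /= normc_eq0 subr_eq0 => /eqP.
Qed.

(* Integrating powers of a peak function of the phi_j against T f conj(g) - f conj(T^* g)
   localizes the identity <T f, g> = <f, T^* g> at the points where the phi_j take a value
   that is not approached elsewhere in [D]. *)
Theorem Vstar_trivial_of_peak (phi : 'I_d -> Cd -> C) (D : set Cd) (M B : R) z0 (r0 : R) :
  (0 < d)%N -> open D -> connected D -> (forall z, D z -> qn z <= M) ->
  (forall j, holomorphic_on D (phi j)) -> (forall j z, D z -> normc (phi j z) <= B) ->
  0 < r0 -> (forall w, qn (w - z0) < r0 -> D w) ->
  (forall mu, qn (mu - z0) < r0 -> forall r : R, 0 < r -> exists2 de : R, 0 < de &
     forall z, D z -> r <= qn (z - mu) -> de <= \sum_j sqmod (phi j z - phi j mu)) ->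
  Vstar_trivial phi D.
Proof.
move=> d0 oD cD bD hphi hB r00 r0D peak T [bT Tphi].
have zz : qn (z0 - z0) < r0 by rewrite subrr qn0.
have Dz0 := r0D _ zz.
have B0 : 0 <= B by apply: le_trans (hB (Ordinal d0) z0 Dz0); exact: normc_ge0.
have b1 := bergman1 bD.
have [k ak] := adj_exists d0 oD bD bT b1; have [_ bk _] := ak.
(* On [D] the sum of the |phi_j - c_j|^2 is at most [d * (2 * B)^2], so this factor keeps [p] in
   [0, 1]; the added 1 keeps the inverse meaningful for [B = 0]. *)
pose ka : R := (d%:R * (2 * B) ^+ 2 + 1)^-1.
have K0 : 0 < d%:R * (2 * B) ^+ 2 + 1 :> R by rewrite ltr_wpDl // mulr_ge0 // sqr_ge0.
have ka0 : 0 < ka by rewrite invr_gt0.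
have key f mu : bergman D f -> qn (mu - z0) < r0 -> T f mu = f mu * (k mu)^*%C.
  move=> bf mur; have Dmu := r0D _ mur.
  pose c j := phi j mu.
  pose p z := 1 - ka * \sum_j sqmod (phi j z - c j).
  have sum0 z : 0 <= \sum_j sqmod (phi j z - c j) by apply: sumr_ge0 => j _; exact: sqmod_ge0.
  have sumB z : D z -> \sum_j sqmod (phi j z - c j) <= d%:R * (2 * B) ^+ 2.
    move=> Dz; rewrite -[d in d%:R]card_ord mulr_natl -sumr_const.
    apply: ler_sum => j _; rewrite sqmodE ler_pXn2r ?nnegrE ?normc_ge0 ?mulr_ge0 //.
    apply: le_trans (le_normcD _ _) _; rewrite normcN mulr_natl mulr2n.
    by apply: lerD; exact: hB.
  have p01 z : D z -> 0 <= p z <= 1.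
    move=> Dz; apply/andP; split; last by rewrite gerBl mulr_ge0 // ltW.
    rewrite subr_ge0 mulrC ler_pdivrMr // mul1r.
    by apply: le_trans (sumB z Dz) _; rewrite lerDl.
  have pmu : p mu = 1.
    rewrite /p big1 ?mulr0 ?subr0 // => j _; by rewrite /c subrr /sqmod /= expr0n addr0.
  have hq r : 0 < r -> exists2 q : R, 0 < q < 1 & forall z, D z -> r <= qn (z - mu) -> p z <= q.
    move=> rr; have [de de0 hde] := peak mu mur r rr.
    (* The maximum with 1/2 ensures [q > 0], since [peak_le0] divides by [q]. *)
    exists (Num.max (1 - ka * de) 2^-1).
      rewrite lt_max gt_max invr_gt0 ltr0n orbT /= gtrBl mulr_gt0 //= invf_lt1 ?ltr1n //.
    move=> z Dz zr; rewrite le_max lerB // ler_wpM2l ?(ltW ka0) //; exact: hde.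
  have l1 := L2_CL1 (bergman_L2 (bergT bT bf)) (bergman_L2 b1).
  have l2 := L2_CL1 (bergman_L2 bf) (bergman_L2 bk).
  have l3 := CL1Z (-1) l2; have lF := CL1D l1 l3.
  have cp : contD D p by exact: contD_p.
  have hI n : CI D (fun z => (p z)%:C%C ^+ n * (T f z * (1 : C)^*%C + -1 * (f z * (k z)^*%C))) = 0.
    have h1 := CI_pow_bounded hphi p01 n l1; have h2 := CI_pow_bounded hphi p01 n l2.
    transitivity (CI D (fun z => (p z)%:C%C ^+ n * (T f z * (1 : C)^*%C)) +
                  -1 * CI D (fun z => (p z)%:C%C ^+ n * (f z * (k z)^*%C))).
      rewrite -(CIZ (-1) h2) -(CID h1 (CL1Z (-1) h2)).
      by apply: eq_CI => z _; rewrite mulrDr !mulN1r mulrN.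
    by rewrite (CI_pow d0 oD bD bT hphi B0 hB Tphi p01 n bf ak) mulN1r subrr.
  have /eqP := peak_eq0 oD Dmu lF cp p01 pmu hq hI.
  rewrite mulN1r subr_eq0 => /eqP <-.
  rewrite (_ : (1 : C)^*%C = 1) ?mulr1 //; by apply: complex_eqP; rewrite /= ?oppr0.
have T1 w : qn (w - z0) < r0 -> T (fun=> 1) w = (k w)^*%C.
  by move=> /(key _ _ b1); rewrite mul1r.
have [s /andP[s0 sr] hs] := conj_holo_const (proj1 (bergT bT b1)) (proj1 bk) r00 r0D T1.
exists (T (fun=> 1) z0) => f bf z Dz; apply/eqP; rewrite -subr_eq0; apply/eqP.
apply: (identity_theorem (f := fun w => T f w - T (fun=> 1) z0 * f w) oD cD _ Dz0 s0 _ Dz).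
  exact: holoB (proj1 (bergT bT bf)) (holoZ _ (proj1 bf)).
move=> w ws; have wr := lt_le_trans ws sr.
by rewrite (key f w bf wr) -(T1 w wr) (hs w ws) mulrC subrr.
Qed.
End Trivial.

(** * Finite unions of cubes *)

Section Cubes.
Variables (R : realType) (d : nat).
Local Notation C := (Cx R).
Local Notation Cd := (Cd R d).
Implicit Types (s : seq (Cd * R)).

Definition co (b : bool) (x : C) : R := if b then complex.Re x else complex.Im x.

Lemma co_ltP (w x : Cd) (r : R) : 0 < r ->
  (qn (w - x) < r) <-> (forall j b, `|co b (w 0 j) - co b (x 0 j)| < r).
Proof.
move=> r0; split=> [h j b|h].
  have := le_lt_trans (cmax_qn (w - x) j) h; rewrite !mxE cmax_lt ReD ReN ImD ImN.
  by case: b => /andP[].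
apply/qn_ltP => // j; rewrite !mxE cmax_lt ReD ReN ImD ImN.
by rewrite (h j true) (h j false).
Qed.

Definition cubes s : set Cd := [set w | exists2 c, c \in s & qn (w - c.1) < c.2].

Lemma open_cubes s : open (cubes s).
Proof.
have -> : cubes s = \bigcup_(c in [set c | c \in s]) [set w | qn (w - c.1) < c.2].
  by apply/seteqP; split => w [c]; exists c.
by apply: bigcup_open => c _; exact: open_cube.
Qed.

(** Each cube meets the connected set [K] at its centre, so attaching the cubes to [K] one by one
    keeps the union connected. *)
Lemma connected_cubes s (K : set Cd) : connected K -> K !=set0 -> (forall c, c \in s -> K c.1 /\ 0 < c.2) ->
  K `<=` cubes s -> connected (cubes s).
Proof.
move=> cK [p Kp] Ks Kc.
have -> : cubes s = \bigcup_(c in [set c | c \in s]) (K `|` [set w | qn (w - c.1) < c.2]).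
  apply/seteqP; split => [w [c cs wc]|w [c cs [/Kc//|wc]]]; first by exists c => //; right.
  by exists c.
apply: bigcup_connected; first by exists p => c _; left.
move=> c /Ks[Kc1 c20]; apply: connectedU => //; last exact: connected_cube.
by exists c.1; split => //=; rewrite subrr qn0.
Qed.

Lemma closure_cubes s w : closure (cubes s) w -> exists2 c, c \in s & qn (w - c.1) <= c.2.
Proof.
move=> /closure_Cd h; apply: contrapT => H.
have [|r r0 hr] := @finite_min _ _ s (fun c => qn (w - c.1) - c.2).
  move=> c cs; rewrite subr_gt0 ltNge; apply/negP => wc; apply: H; by exists c.
have [v [c cs vc] vw] := h r r0; have := hr c cs.
have := qn_tri w v c.1; rewrite qnB_sym in vw; move: vc vw; clear; lra.
Qed.

(** No right face lies in the hyperplane of a left face. Two cubes touching along a face would leave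
    a slit of boundary points without any ball of the complement nearby, against [property2]. *)
Definition generic s := forall c c', c \in s -> c' \in s -> forall j b,
  co b (c.1 0 j) + c.2 != co b (c'.1 0 j) - c'.2.

(* Leave a point outside all the cubes by moving up the coordinates which are on a
   right face of some cube and down the other ones. *)
Lemma property2_cubes s : (forall c, c \in s -> 0 < c.2) -> generic s -> property2 (cubes s).
Proof.
move=> s0 gs z [_ nz] O oO Oz.
have {}nz : ~ cubes s z.
  by move=> h; apply: nz; apply/interior_Cd; have /open_Cd := open_cubes (s := s); apply.
have /open_Cd/(_ z Oz)[r r0 hr] := oO.
pose up j b := has (fun c : Cd * R => co b (c.1 0 j) + c.2 == co b (z 0 j)) s.
pose sg j b : R := if up j b then 1 else -1.
pose e : Cd := \row_j (sg j true +i* sg j false)%C.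
have coe t j b : co b ((z + t%:C%C *: e) 0 j) = co b (z 0 j) + t * sg j b.
  by case: b; rewrite !mxE /co ?ReD ?ImD ?ReM ?ImM /= mul0r ?subr0 ?addr0.
have qe (t : R) : 0 <= t -> qn (t%:C%C *: e) <= t.
  move=> t0; apply/qn_leP => // j; have s1 b : `|t * sg j b| <= t.
    by rewrite normrM (ger0_norm t0) /sg; case: ifP; rewrite ?normrN normr1 mulr1.
  have := s1 true; have := s1 false.
  by rewrite !mxE cmax_le ReM ImM /= !mul0r subr0 addr0 => -> ->.
have far c : exists tau : R, c \in s -> 0 < tau /\ forall t, 0 < t -> t < tau ->
    forall w, qn (w - (z + t%:C%C *: e)) < t / 2 -> ~ qn (w - c.1) < c.2.
  have [cs|ncs] := boolP (c \in s); last by exists 0.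
  have c0 := s0 c cs.
  have [j [b]] : exists j b, c.2 <= `|co b (z 0 j) - co b (c.1 0 j)|.
    apply: contrapT => H; apply: nz; exists c => //; apply/(co_ltP _ _ c0) => j b.
    by rewrite ltNge; apply/negP => h; apply: H; exists j, b.
  have main (t : R) w : 0 < t -> qn (w - (z + t%:C%C *: e)) < t / 2 -> qn (w - c.1) < c.2 ->
      `|co b (z 0 j) + t * sg j b - co b (c.1 0 j)| < c.2 + t / 2.
    move=> t0 h1 h2; have t2 : 0 < t / 2 by rewrite divr_gt0.
    have := (co_ltP _ _ t2).1 h1 j b; rewrite coe; have := (co_ltP _ _ c0).1 h2 j b.
    by rewrite !ltr_norml => /andP[a1 a2] /andP[a3 a4]; move: a1 a2 a3 a4; clear => *; apply/andP; split; lra.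
  (* If [z] is on a face hyperplane of [c], then [e] points outwards: on a right face [up] holds by
     definition, on a left face it fails by genericity. Otherwise there is a gap, which short steps
     preserve. *)
  rewrite le_eqVlt => /predU1P[E|gap].
    exists 1 => _; split => // t t0 _ w h1 h2.
    have := main t w t0 h1 h2; rewrite /sg.
    have [u|/hasPn nu] := boolP (up j b).
      have [c' c's /eqP c'E] := hasP u.
      have : co b (z 0 j) != co b (c.1 0 j) - c.2 by rewrite -c'E; apply: gs.
      move: E; rewrite /= ltr_norml; case: ler0P => a E ne /andP[_ h3].
        by move/eqP: ne; apply; move: E; clear; lra.
      by move: E h3 t0; clear; lra.
    have := nu c cs; move: E; rewrite ltr_norml; case: ler0P => a E ne /andP[h3 _].
      by move: E h3 t0; clear; lra.
    by move/eqP: ne; apply; move: E; clear; lra.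
  exists ((`|co b (z 0 j) - co b (c.1 0 j)| - c.2) / 2) => _.
  split; first by rewrite divr_gt0 // subr_gt0.
  move=> t t0 tt w h1 h2; have := main t w t0 h1 h2.
  have st : `|t * sg j b| <= t.
    by rewrite normrM (ger0_norm (ltW t0)) /sg; case: ifP; rewrite ?normrN normr1 mulr1.
  have := ler_normB (co b (z 0 j) + t * sg j b - co b (c.1 0 j)) (t * sg j b).
  rewrite (_ : _ - _ - t * sg j b = co b (z 0 j) - co b (c.1 0 j)); last by ring.
  move: st tt t0; move: (`|co b (z 0 j) - co b (c.1 0 j)|) (`|t * sg j b|).
  move: (`|co b (z 0 j) + t * sg j b - co b (c.1 0 j)|) => x y u; clear; lra.
have [tau htau] := choice far.
have [|t1 t10 ht1] := @finite_min _ _ s tau; first by move=> c cs; case: (htau c cs).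
pose t := Num.min (r / 2) (t1 / 2).
have t0 : 0 < t by rewrite lt_min !divr_gt0.
have tr : t <= r / 2 by rewrite ge_min lexx.
have tt1 : t <= t1 / 2 by rewrite ge_min lexx orbT.
exists (z + t%:C%C *: e), (t / 2); split; first by rewrite divr_gt0.
move=> w; rewrite /eball /= => h.
have {}h : qn (w - (z + t%:C%C *: e)) < t / 2.
  by rewrite qnB_sym; apply: le_lt_trans (qn_le_edist _ _) h.
split.
  apply: hr; rewrite -(subrKA (z + t%:C%C *: e)); apply: le_lt_trans (qnD _ _) _.
  rewrite [z + _]addrC addrK [_ *: e + z]addrC; have := qe t (ltW t0); move: h t0 tr; clear; lra.
move=> [c cs wc]; have [_ hc] := htau c cs.
have tc : t < tau c by have := ht1 c cs; move: tt1 t10; clear; lra.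
exact: hc t t0 tc w h wc.
Qed.

(** Content zero: finite families of boxes, which simply concatenate in unions. [fnull_null] pads
    them to the sequences of [lebesgue_null]. *)
Definition fnull (A : set Cd) := forall e : R, 0 < e -> exists s : seq (box R d),
  (forall z, A z -> exists2 B, B \in s & box_set B z) /\ \sum_(B <- s) vol B <= e.

Lemma fnull_union (T : eqType) (s : seq T) (A : T -> set Cd) : (forall t, t \in s -> fnull (A t)) ->
  fnull [set z | exists2 t, t \in s & A t z].
Proof.
elim: s => [|t s IH] h e e0; first by exists [::]; rewrite big_nil (ltW e0); split => // z [].
have e2 : 0 < e / 2 by rewrite divr_gt0.
have [s1 [h1 v1]] := h t (mem_head _ _) _ e2.
have [|s2 [h2 v2]] := IH _ _ e2; first by move=> t' ts; apply: h; rewrite inE ts orbT.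
exists (s1 ++ s2); rewrite big_cat /=; split; last by move: v1 v2; clear; lra.
move=> z [t']; rewrite inE => /predU1P[->|ts] Az.
  by have [B B1 Bz] := h1 z Az; exists B => //; rewrite mem_cat B1.
have [|B B1 Bz] := h2 z; first by exists t'.
by exists B => //; rewrite mem_cat B1 orbT.
Qed.

Lemma fnull_sub (A B : set Cd) : A `<=` B -> fnull B -> fnull A.
Proof. by move=> AB hB e /hB[s [h v]]; exists s; split => // z /AB/h. Qed.

Lemma fnull_null (A : set Cd) : (0 < d)%N -> fnull A -> lebesgue_null A.
Proof.
move=> d0 hA e e0; have [s [h v]] := hA e e0.
pose b0 : box R d := (0, 0, 0, 0).
(* Positive dimension matters for the padding: in dimension 0 the volume is an empty product, that
   is 1. *)
have vb0 : vol b0 = 0.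
  by rewrite /vol /b0 (bigD1 (Ordinal d0)) //= subrr maxxx mul0r mul0r.
exists (nth b0 s); split.
  by move=> z /h[B Bs Bz]; exists (index B s) => //=; rewrite nth_index.
move=> n; apply: le_trans v; rewrite [leRHS](big_nth b0) big_mkord.
have [ns|sn] := leqP n (size s).
  rewrite (big_ord_widen _ (fun i => vol (nth b0 s i)) ns).
  by rewrite [leRHS](bigID (fun i : 'I_(size s) => (i < n)%N)) /= lerDl sumr_ge0 // => i _; exact: vol_ge0.
rewrite [leRHS](big_ord_widen _ (fun i => vol (nth b0 s i)) (ltnW sn)).
rewrite (bigID (fun i : 'I_n => (i < size s)%N)) /= gerDl big1 // => i.
by rewrite -leqNgt => h1; rewrite nth_default.
Qed.

(** The face is enclosed in a slab of thickness [2 * h] whose other 2d - 1 sides have length [P].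
    The radius is enlarged to [r + 1] because boxes are half-open. *)
Lemma fnull_face x (r v : R) j b : fnull [set z : Cd | qn (z - x) <= r /\ co b (z 0 j) = v].
Proof.
move=> e e0.
have [r0|r0] := ltP r 0.
  by exists [::]; rewrite big_nil (ltW e0); split => // z [zr _]; have := le_lt_trans (le_trans (qn_ge0 _) zr) r0; rewrite ltxx.
pose P : R := 2 * (r + 1); have P0 : 0 < P by rewrite mulr_gt0 // ltr_wpDl.
pose K := \prod_(i < d | i != j) (P * P).
have K0 : 0 <= K by apply: prodr_ge0 => i _; rewrite mulr_ge0 // ltW.
pose h := e / (2 * (P * K + 1)).
have D0 : 0 < 2 * (P * K + 1) by rewrite mulr_gt0 // ltr_wpDl // mulr_ge0 // ltW.
have h0 : 0 < h by rewrite divr_gt0.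
pose lo b' (i : 'I_d) := if (i == j) && (b' == b) then v - h else co b' (x 0 i) - (r + 1).
pose hi b' (i : 'I_d) := if (i == j) && (b' == b) then v + h else co b' (x 0 i) + (r + 1).
pose B : box R d := (lo true, hi true, lo false, hi false).
exists [:: B]; rewrite big_seq1; split.
  move=> z [zx zv]; exists B; first exact: mem_head.
  move=> i; suff H b' : lo b' i <= co b' (z 0 i) < hi b' i by split; [exact: (H true)|exact: (H false)].
  rewrite /lo /hi; case: ifP => [/andP[/eqP -> /eqP ->]|_].
    by rewrite zv; move: h0; clear => *; apply/andP; split; lra.
  have r1 : 0 < r + 1 by move: r0; clear; lra.
  have /(co_ltP _ _ r1)/(_ i b') : qn (z - x) < r + 1 by move: zx; clear; lra.
  by rewrite ltr_norml => /andP[a1 a2]; move: a1 a2; clear => *; apply/andP; split; lra.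
have len b' i : Num.max 0 (hi b' i - lo b' i) = if (i == j) && (b' == b) then 2 * h else P.
  by rewrite /hi /lo; case: ifP => _; rewrite max_r /P; move: h0 r0; clear; lra.
rewrite /vol /B; under eq_bigr do rewrite !len.
rewrite (bigD1 j) //= eqxx /=.
rewrite [X in _ * X](_ : _ = K); last first.
  by apply: eq_bigr => i /negbTE ->.
have -> : (if true == b then 2 * h else P) * (if false == b then 2 * h else P) = 2 * h * P.
  by case: (b) => /=; rewrite // mulrC.
rewrite /h (_ : 2 * (e / (2 * (P * K + 1))) * P * K = e * (P * K / (P * K + 1))); last first.
  by field; rewrite gt_eqF // ltr_wpDl // mulr_ge0 // ltW.
by rewrite ler_piMr ?(ltW e0) // ler_pdivrMr ?mul1r ?lerDl // ltr_wpDl // mulr_ge0 // ltW.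
Qed.

(** A boundary point lies in a closed cube of the family but in no open one, hence on one of
    finitely many faces. *)
Lemma property1_cubes s : (0 < d)%N -> (forall c, c \in s -> 0 < c.2) -> property1 (cubes s).
Proof.
move=> d0 s0; apply: fnull_null => //.
pose S := [seq (c, i) | c <- s, i <- enum {: 'I_d * bool * bool}].
pose A (t : (Cd * R) * ('I_d * bool * bool)) : set Cd := let: (c, (j, b, sg)) := t in
  [set z | qn (z - c.1) <= c.2 /\ co b (z 0 j) = co b (c.1 0 j) + (if sg then c.2 else - c.2)].
apply: (@fnull_sub _ [set z | exists2 t, t \in S & A t z]); last first.
  by apply: fnull_union => -[c [[j b] sg]] _; exact: fnull_face.
move=> z [/closure_cubes[c cs zc] nz].
have {}nz : ~ cubes s z.
  by move=> h; apply: nz; apply/interior_Cd; have /open_Cd := open_cubes (s := s); apply.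
have c0 := s0 c cs.
have [j [b hj]] : exists j b, c.2 <= `|co b (z 0 j) - co b (c.1 0 j)|.
  apply: contrapT => H; apply: nz; exists c => //; apply/(co_ltP _ _ c0) => j b.
  by rewrite ltNge; apply/negP => h; apply: H; exists j, b.
have hj2 : `|co b (z 0 j) - co b (c.1 0 j)| <= c.2.
  have := le_trans (cmax_qn (z - c.1) j) zc; rewrite !mxE cmax_le ReD ReN ImD ImN.
  by case: (b) => /andP[].
have /eqP : `|co b (z 0 j) - co b (c.1 0 j)| == c.2 by rewrite eq_le hj hj2.
case: ler0P => a E.
  exists (c, (j, b, false)); first by apply/allpairsP; exists (c, (j, b, false)); rewrite mem_enum.
  by split => //; move: E; clear; lra.
exists (c, (j, b, true)); first by apply/allpairsP; exists (c, (j, b, true)); rewrite mem_enum.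
by split => //; move: E; clear; lra.
Qed.

Lemma avoid_finite (l : seq R) (a b : R) : a < b -> exists2 t, a < t < b & t \notin l.
Proof.
elim: l a b => [|x l IH] a b ab.
  by exists ((a + b) / 2) => //; apply/andP; split; move: ab; clear; lra.
have am : a < (a + b) / 2 by move: ab; clear; lra.
have mb : (a + b) / 2 < b by move: ab; clear; lra.
have [xm|mx] := leP x ((a + b) / 2).
  have [t /andP[t1 t2] tl] := IH _ _ mb; exists t; first by rewrite (lt_trans am) // t2.
  by rewrite inE negb_or tl andbT gt_eqF // (le_lt_trans xm).
have [t /andP[t1 t2] tl] := IH _ _ am; exists t; first by rewrite t1 (lt_trans t2).
by rewrite inE negb_or tl andbT lt_eqF // (lt_trans t2).
Qed.

Definition dilate (t : R) s := [seq (c.1, t * c.2) | c <- s].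

(** For a pair of cubes and a real direction, coincidence of the two faces is a linear equation with
    a single solution [t], so finitely many values are excluded. Since t > 1 coverings persist, and
    t < 2 leaves the cubes within twice their size. *)
Lemma generic_dilate s : (forall c, c \in s -> 0 < c.2) ->
  exists2 t : R, 1 < t < 2 & generic (dilate t s).
Proof.
move=> s0.
pose g (x : (Cd * R) * (Cd * R) * ('I_d * bool)) : R :=
  let: (c, c', (j, b)) := x in (co b (c'.1 0 j) - co b (c.1 0 j)) / (c.2 + c'.2).
pose l := [seq g (cc, i) | cc <- [seq (c, c') | c <- s, c' <- s], i <- enum {: 'I_d * bool}].
have [t t12 tl] := avoid_finite l (ltr1n R 2).
exists t => // c c' /mapP[x xs ->] /mapP[y ys ->] j b /=; apply/eqP => E.
move/negP: tl; apply; have -> : t = g (x, y, (j, b)); last first.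
  apply: (allpairs_f (fun cc i => g (cc, i))); last by rewrite mem_enum.
  exact: (allpairs_f pair).
rewrite /g.
have := s0 x xs; have := s0 y ys => h1 h2.
have h3 : x.2 + y.2 != 0 by rewrite gt_eqF // addr_gt0.
apply: (mulIf h3); rewrite /= divfK //; move: E; clear; lra.
Qed.
End Cubes.

(** * Critical values and images of polylines *)

Section Sard.
Variables (R : realType) (d : nat).
Local Notation C := (Cx R).
Local Notation Cd := (Cd R d).
Variables (U : set Cd) (Phi : Cd -> Cd).
Local Notation Re := complex.Re.
Local Notation Im := complex.Im.
Local Notation holoPhi := (forall j : 'I_d, holomorphic_on U (fun z => Phi z 0 j)).

Lemma lip_local z : open U -> holoPhi -> U z ->
  exists r, exists2 A : R, 0 < r /\ 0 <= A & forall w w', qn (w - z) <= r -> qn (w' - z) <= r ->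
    qn (Phi w' - Phi w) <= A * qn (w' - w).
Proof.
move=> oU hP Uz; have /open_Cd/(_ z Uz)[r r0 hr] := oU.
have r2 : 0 < r / 2 by rewrite divr_gt0.
have hr2 w : qn (w - z) <= r / 2 -> U w by move=> h; apply: hr; move: h r0; clear; lra.
have B j : exists M : R, 0 < M /\ forall w, qn (w - z) <= r / 2 -> normc (Phi w 0 j) <= M.
  have [|M M0 hM] := @compact_bound _ _ _ (fun w => normc (Phi w 0 j)) (@compact_cube_at R d z (r / 2)).
    by move=> w /hr2 Uw; apply: continuous_normc; exact: holo_cont (hP j) Uw.
  by exists M.
have [M hM] := choice B.
have M0 j : 0 <= d%:R * (48 * M j / (r / 2)).
  have [m0 _] := hM j; apply: mulr_ge0 => //; apply: divr_ge0; last exact: ltW.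
  by apply: mulr_ge0 => //; exact: ltW.
pose A := \sum_j d%:R * (48 * M j / (r / 2)).
exists (r / 2 / 8), A; first by split; [rewrite divr_gt0|rewrite sumr_ge0].
move=> w w' hw hw'; apply/qn_leP => [|j].
  by rewrite mulr_ge0 ?qn_ge0 // sumr_ge0.
rewrite !mxE; apply: le_trans (cmax_normc _) _.
apply: le_trans (holo_lip (hP j) r2 hr2 (proj2 (hM j)) hw hw') _.
by rewrite ler_wpM2r ?qn_ge0 // /A (bigD1 j) //= lerDl sumr_ge0.
Qed.

Lemma continuous_qnPhi z : holoPhi -> U z -> {for z, continuous (fun w => qn (Phi w))}.
Proof.
move=> hP Uz; apply/continuous_CdR => e e0.
have B j : exists r : R, 0 < r /\ forall w, qn (w - z) < r -> normc (Phi w 0 j - Phi z 0 j) < e.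
  by have /continuous_CdC/(_ e e0)[r r0 hr] := holo_cont (hP j) Uz; exists r.
have [rr hrr] := choice B.
have [|r r0 hr] := @finite_min _ _ (enum 'I_d) rr; first by move=> j _; case: (hrr j).
exists r => // w wr.
have h : qn (Phi w - Phi z) < e.
  apply/qn_ltP => // j; rewrite !mxE; apply: le_lt_trans (cmax_normc _) _.
  by apply: (proj2 (hrr j)); apply: lt_le_trans wr _; apply: hr; rewrite mem_enum.
have h1 := qn_tri (Phi w) (Phi z) 0; have h2 := qn_tri (Phi z) (Phi w) 0.
rewrite (qnB_sym (Phi z) (Phi w)) in h2; rewrite !subr0 in h1 h2.
by rewrite ltr_norml; move: h h1 h2; clear => *; apply/andP; split; lra.
Qed.

(** Points closer than [eta] lie in one cube of the finite cover and use its Lipschitz constant; for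
    points farther apart the bound [2 * M] on the values is at most [2 * M / eta] times their
    distance. *)
Lemma lip_compact (K : set Cd) : open U -> holoPhi -> compact K -> K `<=` U ->
  exists2 A : R, 0 < A & forall w w', K w -> K w' -> qn (Phi w' - Phi w) <= A * qn (w' - w).
Proof.
move=> oU hP cK KU.
have H z : exists rA : R * R, U z -> [/\ 0 < rA.1, 0 <= rA.2 & forall w w', qn (w - z) <= rA.1 ->
    qn (w' - z) <= rA.1 -> qn (Phi w' - Phi w) <= rA.2 * qn (w' - w)].
  have [Uz|nUz] := pselect (U z); last by exists (0, 0).
  by have [r [A [r0 A0] h]] := lip_local oU hP Uz; exists (r, A).
have [rA hrA] := choice H.
have [|s sK hs] := compact_finite_cover (rho := fun z => (rA z).1 / 2) cK.
  by move=> z /KU/hrA[r0 _ _]; rewrite divr_gt0.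
have [|eta eta0 heta] := @finite_min _ _ s (fun z => (rA z).1 / 2).
  by move=> z /sK/KU/hrA[r0 _ _]; rewrite divr_gt0.
have [|M M0 hM] := @compact_bound _ _ K (fun w => qn (Phi w)) cK.
  by move=> z /KU Uz; exact: continuous_qnPhi.
have S0 z : z \in s -> 0 <= (rA z).2 by move=> /sK/KU/hrA[].
pose A := \sum_(z <- s) (rA z).2.
have A0 : 0 <= A by rewrite /A big_seq sumr_ge0.
exists (A + 2 * M / eta); first by rewrite ltr_wpDl // divr_gt0 // mulr_gt0.
move=> w w' Kw Kw'; have [lt|ge] := ltP (qn (w' - w)) eta.
  have [z zs wz] := hs w Kw; have [r0 a0 hz] := hrA z (KU _ (sK _ zs)).
  apply: le_trans (hz w w' _ _) _.
  - by move: wz r0; clear; lra.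
  - by have := heta z zs; have := qn_tri w' w z; move: lt wz; clear; lra.
  rewrite ler_wpM2r ?qn_ge0 // /A (big_rem z) //= -addrA lerDl addr_ge0 //.
    by rewrite big_seq sumr_ge0 // => y /mem_rem; exact: S0.
  by rewrite divr_ge0 ?ltW // mulr_gt0.
apply: le_trans (qnD _ _) _; rewrite qnN.
have := hM w Kw; have := hM w' Kw' => h1 h2.
apply: le_trans (_ : 2 * M <= _); first by move: h1 h2; clear; lra.
rewrite [leRHS]mulrDl; apply: le_trans (_ : 2 * M / eta * qn (w' - w) <= _); last first.
  by rewrite lerDr mulr_ge0 ?qn_ge0.
by rewrite mulrAC ler_pdivlMr // ler_wpM2l // mulr_ge0 // ltW.
Qed.

(** Row [i] holds the derivatives in direction [i], so that the differential acts on row vectors as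
    [h *m jac z]. *)
Definition jac z : 'M[C]_d := \matrix_(i, j) pd (fun z => Phi z 0 j) i z.

Lemma holo_det_jac : open U -> holoPhi -> holomorphic_on U (fun z => \det (jac z)).
Proof.
move=> oU hP; rewrite /determinant; apply: holo_sum => s; apply: holoZ.
by apply: holo_prod => i; under eq_fun do rewrite mxE; exact: holo_pd.
Qed.

(** Quantitative local injectivity. [be] bounds the inverse matrix, and the error [(2 * be)^-1] of
    strict differentiability is absorbed into half of [qn h]. *)
Lemma nondeg_inj z : open U -> holoPhi -> U z -> \det (jac z) != 0 ->
  exists r, exists2 c : R, 0 < r /\ 0 < c & forall w w', qn (w - z) < r -> qn (w' - z) < r ->
    c * qn (w' - w) <= qn (Phi w' - Phi w).
Proof.
move=> oU hP Uz dz; have uA : jac z \in unitmx by rewrite unitmxE unitfE.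
pose be := \sum_k \sum_j normc ((invmx (jac z)) j k) + 1.
have S0 : 0 <= \sum_k \sum_j normc ((invmx (jac z)) j k).
  by do 2!(apply: sumr_ge0 => ? _); exact: normc_ge0.
have be0 : 0 < be by rewrite ltr_wpDl.
have e0 : 0 < (2 * be)^-1 by rewrite invr_gt0 mulr_gt0.
have B j : exists r : R, 0 < r /\ forall w w', qn (w - z) < r -> qn (w' - z) < r ->
    normc (Phi w' 0 j - Phi w 0 j - \sum_(k < d) pd (fun z => Phi z 0 j) k z * (w' 0 k - w 0 k)) <=
    (2 * be)^-1 * qn (w' - w).
  by have [r r0 hr] := holo_strict oU (hP j) Uz e0; exists r.
have [rr hrr] := choice B.
have [|r r0 hr] := @finite_min _ _ (enum 'I_d) rr; first by move=> j _; case: (hrr j).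
exists r, (4 * be)^-1; first by rewrite invr_gt0 mulr_gt0.
move=> w w' hw hw'; set D := qn (Phi w' - Phi w); pose h := w' - w.
have hj j : normc ((h *m jac z) 0 j) <= 2 * D + (2 * be)^-1 * qn h.
  have wj : qn (w - z) < rr j by apply: lt_le_trans hw _; apply: hr; rewrite mem_enum.
  have wj' : qn (w' - z) < rr j by apply: lt_le_trans hw' _; apply: hr; rewrite mem_enum.
  have [_ /(_ w w' wj wj')] := hrr j.
  have -> : \sum_(k < d) pd (fun z => Phi z 0 j) k z * (w' 0 k - w 0 k) = (h *m jac z) 0 j.
    by rewrite mxE; apply: eq_bigr => k _; rewrite !mxE mulrC.
  move=> h1; have h2 := normc_qn (Phi w' - Phi w) j; rewrite !mxE -/D in h2.
  have h3 := normcB_tri ((h *m jac z) 0 j) (Phi w' 0 j - Phi w 0 j).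
  rewrite normcB_sym in h3; move: h1 h2 h3; rewrite -/h.
  move: (normc _) (normc _) (normc _) (_ * qn h) => x y u v; clear; lra.
have hle : qn h <= be * (2 * D + (2 * be)^-1 * qn h).
  have P0 : 0 <= 2 * D + (2 * be)^-1 * qn h by rewrite addr_ge0 // mulr_ge0 ?qn_ge0 // ltW.
  apply/qn_leP => [|k]; first by rewrite mulr_ge0 // ltW.
  apply: le_trans (cmax_normc _) _.
  have -> : h 0 k = \sum_j (h *m jac z) 0 j * (invmx (jac z)) j k.
    by rewrite -[h in LHS](mulmxK uA) mxE.
  apply: le_trans (normc_sum _ _ _) _.
  apply: le_trans (_ : \sum_j normc (invmx (jac z) j k) * (2 * D + (2 * be)^-1 * qn h) <= _).
    by apply: ler_sum => j _; rewrite normcM mulrC ler_wpM2l ?normc_ge0.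
  rewrite -mulr_suml ler_wpM2r //.
  apply: le_trans (_ : \sum_k \sum_j normc ((invmx (jac z)) j k) <= _); last by rewrite lerDl.
  rewrite [leRHS](bigD1 k) //= lerDl.
  by apply: sumr_ge0 => i _; apply: sumr_ge0 => j _; exact: normc_ge0.
rewrite ler_pdivrMl ?mulr_gt0 // -/h.
move: hle; rewrite mulrDr mulrA (_ : be * (_ * qn h) = qn h / 2); last by field; rewrite gt_eqF.
by clear; move: be D (qn h) => x y u; clear; lra.
Qed.

(** A functional that kills the range of the differential, scaled to have coefficient 1 at some [k]:
    to first order, the k-th coordinate of Phi is then determined by the others. *)
Lemma degenerate_functional z : \det (jac z) = 0 ->
  exists v, exists2 k : 'I_d, v k = 1 & forall i, \sum_j v j * pd (fun z => Phi z 0 j) i z = 0 :> C.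
Proof.
move=> dz; have /det0P[u u0 hu] : \det (jac z)^T == 0 by rewrite det_tr dz.
have [k uk] : exists k, u 0 k != 0.
  apply: contrapT => H; move/negP: u0; apply; apply/eqP/rowP => k; rewrite mxE.
  by apply/eqP; apply: contrapT => /negP uk; apply: H; exists k.
exists (fun j => u 0 j / u 0 k), k; first by rewrite divff.
move=> i; have /rowP/(_ i) := hu; rewrite !mxE => h.
transitivity ((u 0 k)^-1 * \sum_j u 0 j * (jac z)^T j i); last by rewrite h mulr0.
by rewrite mulr_sumr; apply: eq_bigr => j _; rewrite !mxE mulrCA mulrA.
Qed.

(** One scale [eta] serves all of [K]; the functional is that of a nearby centre of a finite
    cover. *)
Lemma sard_uniform (K : set Cd) : open U -> holoPhi -> compact K -> K `<=` U ->
  (forall z, K z -> \det (jac z) = 0) -> forall e : R, 0 < e ->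
  exists2 eta : R, 0 < eta & forall z, K z -> exists v, exists2 k : 'I_d, v k = 1 &
    forall w w', qn (w - z) <= eta -> qn (w' - z) <= eta ->
      normc (\sum_j v j * (Phi w' 0 j - Phi w 0 j)) <= e * qn (w' - w).
Proof.
move=> oU hP cK KU dK e e0.
have H z : exists (rvk : R * (('I_d -> C) * option 'I_d)), K z -> 0 < rvk.1 /\
    exists2 k : 'I_d, rvk.2.1 k = 1 & forall w w', qn (w - z) < rvk.1 -> qn (w' - z) < rvk.1 ->
      normc (\sum_j rvk.2.1 j * (Phi w' 0 j - Phi w 0 j)) <= e * qn (w' - w).
  have [Kz|nKz] := pselect (K z); last by exists (0, (fun=> 0, None)).
  have [v [k vk hv]] := degenerate_functional (dK z Kz).
  pose S := \sum_j normc (v j) + 1.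
  have Ss : 0 <= \sum_j normc (v j) by apply: sumr_ge0 => j _; exact: normc_ge0.
  have S0 : 0 < S by rewrite ltr_wpDl.
  have eS : 0 < e / S by rewrite divr_gt0.
  have B j : exists r : R, 0 < r /\ forall w w', qn (w - z) < r -> qn (w' - z) < r ->
      normc (Phi w' 0 j - Phi w 0 j - \sum_(k < d) pd (fun z => Phi z 0 j) k z * (w' 0 k - w 0 k)) <=
      e / S * qn (w' - w).
    by have [r r0 hr] := holo_strict oU (hP j) (KU _ Kz) eS; exists r.
  have [rr hrr] := choice B.
  have [|r r0 hr] := @finite_min _ _ (enum 'I_d) rr; first by move=> j _; case: (hrr j).
  exists (r, (v, None)); split => //=; exists k => // w w' hw hw'.
  have -> : \sum_j v j * (Phi w' 0 j - Phi w 0 j) = \sum_j v j * (Phi w' 0 j - Phi w 0 j -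
      \sum_(k < d) pd (fun z => Phi z 0 j) k z * (w' 0 k - w 0 k)).
    under [RHS]eq_bigr do rewrite mulrBr; rewrite sumrB [X in _ - X](_ : _ = 0) ?subr0 //.
    under eq_bigr do rewrite mulr_sumr; rewrite exchange_big /= big1 // => i _.
    by under eq_bigr do rewrite mulrA; rewrite -mulr_suml hv mul0r.
  apply: le_trans (normc_sum _ _ _) _.
  apply: le_trans (_ : \sum_j normc (v j) * (e / S * qn (w' - w)) <= _).
    apply: ler_sum => j _; rewrite normcM ler_wpM2l ?normc_ge0 //.
    by apply: (proj2 (hrr j)); [apply: lt_le_trans hw _|apply: lt_le_trans hw' _]; apply: hr; rewrite mem_enum.
  rewrite -mulr_suml mulrA ler_wpM2r ?qn_ge0 // mulrCA ler_piMr ?(ltW e0) // ler_pdivrMr // mul1r.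
  by rewrite lerDl.
have [rvk hrvk] := choice H.
have [|s sK hs] := compact_finite_cover (rho := fun z => (rvk z).1 / 2) cK.
  by move=> z /hrvk[r0 _]; rewrite divr_gt0.
have [|eta eta0 heta] := @finite_min _ _ s (fun z => (rvk z).1 / 4).
  by move=> z /sK/hrvk[r0 _]; rewrite divr_gt0.
exists eta => // z Kz; have [x xs zx] := hs z Kz.
have [r0 [k vk hv]] := hrvk x (sK _ xs).
exists (rvk x).2.1, k => // w w' hw hw'.
have := heta x xs => h; apply: hv.
  by have := qn_tri w z x; move: hw zx h r0; clear; lra.
by have := qn_tri w' z x; move: hw' zx h r0; clear; lra.
Qed.

Definition grid_index (T : nat) (e : R) (M : R) (x : R) : nat := minn (Num.truncn ((x + M) / e)) T.

Lemma grid_inordK T e M x : nat_of_ord (inord (grid_index T e M x) : 'I_T.+1) = grid_index T e M x.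
Proof. by rewrite inordK // ltnS geq_minr. Qed.

Lemma grid_index_close T e M x y : 0 < e -> 0 <= x + M -> 0 <= y + M ->
  (x + M) / e < T.+1%:R -> (y + M) / e < T.+1%:R ->
  grid_index T e M x = grid_index T e M y -> `|x - y| <= e.
Proof.
move=> e0 x0 y0 xT yT; have tr (u : R) : 0 <= u + M -> (u + M) / e < T.+1%:R ->
    grid_index T e M u = Num.truncn ((u + M) / e).
  move=> u0 uT; apply/minn_idPl; rewrite -ltnS -(ltr_nat R).
  have /truncn_itv/andP[h _] : 0 <= (u + M) / e by rewrite divr_ge0 // ltW.
  exact: le_lt_trans uT.
rewrite !tr // => E.
have /truncn_itv/andP[a1 a2] : 0 <= (x + M) / e by rewrite divr_ge0 // ltW.
have /truncn_itv/andP[b1 b2] : 0 <= (y + M) / e by rewrite divr_ge0 // ltW.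
rewrite E in a1 a2; rewrite -natr1 in a2 b2.
move: a1 b1; rewrite !ler_pdivlMr // => a1 b1; move: a2 b2; rewrite !ltr_pdivrMr // => a2 b2.
rewrite ler_norml; move: a1 a2 b1 b2; rewrite !mulrDl mul1r.
by move: (_%:R * e) => k; clear => *; apply/andP; split; lra.
Qed.

(** An integer known up to an error below [T] is determined by its residue, so only [T] values have
    to be counted for it. *)
Lemma mod_close (T a b : nat) : `|a%:R - b%:R| < T%:R :> R -> (a %% T = b %% T)%N -> a = b.
Proof.
wlog ab : a b / (a <= b)%N => [hw h E|].
  have [/hw|/ltnW/hw] := leqP a b; first exact.
  by rewrite distrC => /(_ h (esym E)).
rewrite distrC -natrB // ger0_norm // ltr_nat => h E.
apply/eqP; rewrite eqn_leq ab /= -subn_eq0 -leqn0 leqNgt; apply/negP => p.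
have : (T %| b - a)%N by rewrite -eqn_mod_dvd // E.
by move=> /(dvdn_leq p); rewrite leqNgt h.
Qed.

(* Counting lattice points: where the Jacobian vanishes, the image of a small cell lies close to
   a hyperplane, so it meets few points of a lattice much finer than the cell. *)
Lemma sard (K : set Cd) w0 (rho : R) : open U -> holoPhi -> compact K -> K `<=` U ->
  (forall z, K z -> \det (jac z) = 0) -> 0 < rho ->
  ~ (forall y, qn (y - w0) <= rho -> exists2 z, K z & Phi z = y).
Proof.
move=> oU hP cK KU dK rho0 cover.
have [A A0 lipA] := lip_compact oU hP cK KU.
have [|M M0 hM] := @compact_bound _ _ K (fun w : Cd => qn (w - 0)) cK.
  by move=> z _; exact: qn_continuous.
have {}hM z : K z -> qn z <= M by move=> /hM; rewrite subr0.
have [P [P0 hPr]] : exists P : nat, (0 < P)%N /\ P%:R^-1 <= rho.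
  have [n0 /(_ n0 (leqnn _)) h] := inv_small rho0; exists n0.+1; split => //; exact: ltW.
have [Q hQ] : exists Q : nat, 2 * M * P%:R + 2 <= Q%:R.
  by have [n0 /(_ n0 (leqnn _)) h] := big_nat_ge (2 * M * P%:R + 2); exists n0.+1.
have [S hS] : exists S : nat, A + 1 <= S%:R.
  by have [n0 /(_ n0 (leqnn _)) h] := big_nat_ge (A + 1); exists n0.+1.
(* Chosen for the final count: the (at)^(2d) lattice points would inject into (Qa)^(2d)
   (St)^(2(d-1)) labels, which is false once t^2 exceeds Q^(2d) S^(2(d-1)). *)
pose t := ((Q * Q) ^ d * (S * S) ^ d.-1).+1.
have e0 : 0 < (2 * t%:R)^-1 :> R by rewrite invr_gt0 mulr_gt0 // ltr0n.
have [eta eta0 heta] := sard_uniform oU hP cK KU dK e0.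
have [a [a0 ha]] : exists a : nat, (0 < a)%N /\ (P * a)%:R^-1 <= eta.
  have [n0 /(_ n0 (leqnn _)) h] := inv_small eta0; exists n0.+1; split => //.
  apply: le_trans (ltW h); rewrite lef_pV2 ?posrE ?ltr0n ?muln_gt0 ?P0 // ler_nat leq_pmull //.
(* [h] is the size of a source cell and [m] the number of cells per real direction. In the target,
   lattice points are spaced by [sg = h / t], [n] per real direction, and [T] steps exceed the
   Lipschitz bound [A * h] for the image of a cell. *)
pose h : R := (P * a)%:R^-1.
have h0 : 0 < h by rewrite invr_gt0 ltr0n muln_gt0 P0.
pose n := (a * t)%N; pose m := (Q * a)%N; pose T := (S * t)%N.
pose sg : R := h / t%:R; have t0 : 0 < t%:R :> R by rewrite ltr0n.
have sg0 : 0 < sg by rewrite divr_gt0.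
have nsg : n%:R * sg <= rho.
  apply: le_trans hPr; rewrite /n /sg /h !natrM le_eqVlt; apply/orP; left; apply/eqP.
  by field; rewrite !pnatr_eq0 -!lt0n P0 a0.
have mgt x : x <= M -> (x + M) / h < m%:R.
  move=> xM; rewrite /h invrK /m !natrM; apply: le_lt_trans (_ : 2 * M * P%:R * a%:R < _).
    rewrite -!mulrA mulrA ler_wpM2r ?mulr_ge0 //; move: xM; clear; lra.
  rewrite ltr_pM2r ?ltr0n //; move: hQ; clear; lra.
have m0 : (0 < m)%N.
  by rewrite -(ltr_nat R); apply: le_lt_trans (mgt M (lexx _)); rewrite divr_ge0 ?addr_ge0 ?ltW.
have TT0 : (0 < T)%N.
  by rewrite muln_gt0 andbT -(ltr_nat R); apply: lt_le_trans hS; rewrite ltr_wpDl // ltW.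
pose pt (p : {ffun 'I_d -> 'I_n * 'I_n}) : Cd :=
  w0 + \row_j ((sg * ((p j).1)%:R) +i* (sg * ((p j).2)%:R))%C.
have ptin p : qn (pt p - w0) <= rho.
  rewrite /pt addrC addKr; apply/qn_leP => [|j]; first exact: ltW.
  have le1 (i : 'I_n) : `|sg * i%:R| <= rho.
    rewrite (ger0_norm (mulr_ge0 (ltW sg0) (ler0n _ _))); apply: le_trans nsg.
    by rewrite mulrC ler_wpM2r ?(ltW sg0) // ler_nat ltnW.
  by rewrite mxE cmax_le /= !le1.
have [z hz] : {z : {ffun 'I_d -> 'I_n * 'I_n} -> Cd | forall p, K (z p) /\ Phi (z p) = pt p}.
  have H p : exists z, K z /\ Phi z = pt p by have [z Kz E] := cover _ (ptin p); exists z.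
  by have [z hz] := choice H; exists z.
pose cell (w : Cd) : {ffun 'I_d -> 'I_m.-1.+1 * 'I_m.-1.+1} :=
  [ffun j => (inord (grid_index m.-1 h M (Re (w 0 j))), inord (grid_index m.-1 h M (Im (w 0 j))))].
have bnd w j : K w -> [/\ 0 <= Re (w 0 j) + M, Re (w 0 j) <= M, 0 <= Im (w 0 j) + M & Im (w 0 j) <= M].
  move=> Kw; have := le_trans (cmax_qn w j) (hM w Kw).
  by rewrite cmax_le !ler_norml => /andP[/andP[a1 a2] /andP[b1 b2]]; split => //; move: a1 b1; clear; lra.
have cellP w w' : K w -> K w' -> cell w = cell w' -> qn (w - w') <= h.
  move=> Kw Kw' /ffunP E; apply/qn_leP => [|j]; first exact: ltW.
  have [c1 c2 c3 c4] := bnd w j Kw; have [c5 c6 c7 c8] := bnd w' j Kw'.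
  have := E j; rewrite !ffunE => -[/(congr1 (@nat_of_ord _)) E1 /(congr1 (@nat_of_ord _)) E2].
  have mm : m.-1.+1 = m by rewrite prednK.
  rewrite !grid_inordK in E1 E2.
  rewrite !mxE cmax_le ReD ReN ImD ImN.
  by rewrite (grid_index_close h0 c1 c5 _ _ E1) ?(grid_index_close h0 c3 c7 _ _ E2) ?mm ?mgt.
have H c : exists vk : ('I_d -> C) * option 'I_d, forall w w', K w -> K w' -> cell w = c -> cell w' = c ->
    exists2 k, vk.2 = Some k & vk.1 k = 1 /\
      normc (\sum_j vk.1 j * (Phi w' 0 j - Phi w 0 j)) <= (2 * t%:R)^-1 * h.
  have [[x [Kx xc]]|nx] := pselect (exists x, K x /\ cell x = c); last first.
    by exists (fun=> 0, None) => w w' Kw _ wc; case: nx; exists w.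
  have [v [k vk hv]] := heta x Kx; exists (v, Some k) => w w' Kw Kw' wc wc'; exists k => //; split => //.
  apply: le_trans (hv w w' _ _) _.
  - by apply: le_trans (cellP w x Kw Kx _) ha; rewrite wc xc.
  - by apply: le_trans (cellP w' x Kw' Kx _) ha; rewrite wc' xc.
  by rewrite ler_wpM2l ?(ltW e0) // cellP // wc wc'.
have [vk hvk] := choice H.
have inT x : (x %% T < T)%N by rewrite ltn_mod.
(* A lattice point is labelled by the cell of its preimage and, in the coordinates other than [k],
   by its indices modulo [T]. Within a cell the residues determine those coordinates; the functional
   then confines the k-th one to less than a lattice step. *)
pose F (p : {ffun 'I_d -> 'I_n * 'I_n}) :
    {ffun 'I_d -> 'I_m.-1.+1 * 'I_m.-1.+1} * {ffun 'I_d.-1 -> 'I_T * 'I_T} :=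
  (cell (z p), [ffun i => if (vk (cell (z p))).2 is Some k
    then (Ordinal (inT (p (lift k i)).1), Ordinal (inT (p (lift k i)).2))
    else (Ordinal (inT 0%N), Ordinal (inT 0%N))]).
have Finj : injective F.
  move=> p q [Ec /ffunP Er]; apply/ffunP => j.
  have [Kp Pp] := hz p; have [Kq Pq] := hz q.
  have [k Ek [vk1 hv]] := hvk (cell (z q)) (z p) (z q) Kp Kq Ec erefl.
  have diff i : pt q 0 i - pt p 0 i = ((sg * ((q i).1%:R - (p i).1%:R)) +i* (sg * ((q i).2%:R - (p i).2%:R)))%C.
    by rewrite !mxE; apply: complex_eqP; rewrite !(ReD, ImD, ReN, ImN) /=; ring.
  have lip : qn (pt q - pt p) <= A * h.
    rewrite -Pp -Pq; apply: le_trans (lipA _ _ Kp Kq) _.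
    by rewrite ler_wpM2l ?(ltW A0) // cellP.
  have AS : A * h < sg * T%:R.
    rewrite /sg /T natrM mulrCA (_ : h / t%:R * t%:R = h); last by rewrite divfK // gt_eqF.
    by rewrite ltr_pM2r //; move: hS; clear; lra.
  have other i : i != k -> p i = q i.
    move=> ik; have [i' Ei] : exists i', i = lift k i'.
      by case: (unliftP k i) ik => [i' ->|->]; [exists i'|rewrite eqxx].
    have := Er i'; rewrite !ffunE Ec Ek => -[E1 E2]; rewrite -Ei in E1 E2.
    have := le_lt_trans (le_trans (cmax_qn _ i) lip) AS.
    rewrite [(pt q - pt p) 0 i]mxE [(- pt p) 0 i]mxE diff cmax_lt /= !(normrM sg) (gtr0_norm sg0) !(ltr_pM2l sg0).
    move=> /andP[l1 l2]; have := mod_close l1 (esym E1); have := mod_close l2 (esym E2).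
    by case: (p i) (q i) => [x1 x2] [y1 y2] /= /val_inj -> /val_inj ->.
  have [->|] := eqVneq j k; last exact: other.
  move: hv; rewrite (bigD1 k) //= big1 => [|i ik]; last first.
    by rewrite Pp Pq diff (other i ik) !subrr mulr0 (_ : (0 +i* 0)%C = 0) // mulr0.
  rewrite addr0 vk1 mul1r Pp Pq diff => /(le_trans (cmax_normc _)).
  have sm : (2 * t%:R)^-1 * h < sg.
    rewrite /sg mulrC ltr_pM2l // ltf_pV2 ?posrE ?mulr_gt0 //; move: t0; clear; lra.
  move=> /le_lt_trans/(_ sm); rewrite cmax_lt /= !(normrM sg) (gtr0_norm sg0).
  rewrite -{2 4}[sg]mulr1 !(ltr_pM2l sg0) => /andP[l1 l2].
  have := mod_close (T := 1%N) l1; have := mod_close (T := 1%N) l2; rewrite !modn1.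
  by case: (p k) (q k) => [x1 x2] [y1 y2] /= /(_ erefl)/val_inj -> /(_ erefl)/val_inj ->.
have := leq_card F Finj; rewrite card_prod !card_ffun !card_prod !card_ord prednK //.
have [k0 _] : exists k : 'I_d, true.
  have [z0 Kz0 _] := cover w0 ltac:(by rewrite subrr qn0 ltW).
  by have [v [k _ _]] := heta z0 Kz0; exists k.
have d0 : (0 < d)%N by case: (k0) => i; case: (d).
rewrite leqNgt => /negP; apply.
have tt : ((t * t) ^ d = (t * t) ^ d.-1 * (t * t))%N.
  by rewrite -[in LHS](prednK d0) expnSr.
have -> : ((m * m) ^ d * (T * T) ^ d.-1 = (a * a) ^ d * (t * t) ^ d.-1 * ((Q * Q) ^ d * (S * S) ^ d.-1))%N.
  by rewrite /m /T !(mulnACA _ a) !(mulnACA _ t) !(expnMn (_ * _)); ring.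
have -> : ((n * n) ^ d = (a * a) ^ d * (t * t) ^ d.-1 * (t * t))%N.
  by rewrite /n mulnACA expnMn tt mulnA.
rewrite ltn_pmul2l ?muln_gt0 ?expn_gt0 ?muln_gt0 ?a0 //.
by apply: leq_trans (_ : t <= _)%N; rewrite // leq_pmull.
Qed.

Lemma compact_segs (l : seq (Cd * Cd)) : compact [set z | exists2 ab, ab \in l & seg ab.1 ab.2 z].
Proof.
elim: l => [|ab l IH].
  rewrite (_ : mkset _ = set0); first exact: compact0.
  by apply/seteqP; split => // z [].
rewrite (_ : mkset _ = seg ab.1 ab.2 `|` [set z | exists2 ab, ab \in l & seg ab.1 ab.2 z]).
  by apply: compactU => //; exact: compact_seg.
apply/seteqP; split => z.
  by move=> [cd]; rewrite inE => /predU1P[->|cl] h; [left|right; exists cd].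
move=> [h|[cd cl h]]; first by exists ab; rewrite ?mem_head.
by exists cd; rewrite ?inE ?cl ?orbT.
Qed.

(* The image of a polyline is too thin to contain the n^2 separated images of a grid. *)
Lemma curve_avoid (l : seq (Cd * Cd)) z0 (r c : R) : (0 < d)%N -> open U -> holoPhi ->
  (forall ab, ab \in l -> seg ab.1 ab.2 `<=` U) -> 0 < r -> 0 < c ->
  (forall w w', qn (w - z0) < r -> qn (w' - z0) < r -> c * qn (w' - w) <= qn (Phi w' - Phi w)) ->
  exists2 la, qn (la - z0) < r & forall ab z, ab \in l -> seg ab.1 ab.2 z -> Phi z <> Phi la.
Proof.
move=> d0 oU hP lU r0 c0 inj; apply: contrapT => NH.
have [A A0 lipA] := lip_compact oU hP (@compact_segs l)
  (fun z h => let: ex_intro2 ab abl hz := h in lU ab abl z hz).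
have cover la : qn (la - z0) < r -> exists x : (Cd * Cd) * R, [/\ x.1 \in l, 0 <= x.2 <= 1 &
    Phi (x.1.1 + x.2%:C%C *: (x.1.2 - x.1.1)) = Phi la].
  move=> lar; apply: contrapT => H; apply: NH; exists la => // ab z abl [t /=].
  by rewrite in_itv /= => t01 <- E; apply: H; exists (ab, t).
pose L := \sum_(ab <- l) qn (ab.2 - ab.1).
have hL ab : ab \in l -> qn (ab.2 - ab.1) <= L.
  by move=> abl; rewrite /L (big_rem ab) //= lerDl sumr_ge0 // => i _; exact: qn_ge0.
have L0 : 0 <= L by apply: sumr_ge0 => i _; exact: qn_ge0.
have [S hS] : exists S : nat, 2 * A * L / (c * r) + 1 <= S%:R.
  by have [n0 /(_ n0 (leqnn _)) h] := big_nat_ge (2 * A * L / (c * r) + 1); exists n0.+1.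
have S1 : 1 <= S%:R :> R.
  apply: le_trans hS; rewrite lerDr; apply: divr_ge0; last exact: ltW (mulr_gt0 c0 r0).
  exact: mulr_ge0 (mulr_ge0 (ler0n _ _) (ltW A0)) L0.
have S0 : (0 < S)%N by rewrite -(ltr_nat R); apply: lt_le_trans S1.
have onl (y : (Cd * Cd) * R) : y.1 \in l -> 0 <= y.2 <= 1 ->
    [set z | exists2 ab, ab \in l & seg ab.1 ab.2 z] (y.1.1 + y.2%:C%C *: (y.1.2 - y.1.1)).
  by move=> yl y01; exists y.1 => //; exists y.2.
(* The n^2 lattice points, placed in one complex line, are sent to a segment and one of [m + 1]
   parameter intervals, where m = S n. This [n] makes n^2 larger than the number of such labels. *)
have [n nE] : exists n, n = (size l * S.+1).+1 by exists (size l * S.+1).+1.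
have [m mE] : exists m, m = (S * n)%N by exists (S * n)%N.
have n0 : 0 < n%:R :> R by rewrite nE ltr0n.
have m0 : 0 < m%:R :> R by rewrite mE natrM mulr_gt0 // ltr0n.
pose h := r / (2 * n%:R); have h0 : 0 < h by rewrite divr_gt0 // mulr_gt0.
pose i0 := Ordinal d0.
have [pt [ptin ptB]] : exists pt : 'I_n * 'I_n -> Cd, (forall p, qn (pt p - z0) < r) /\
    forall p q, pt p - pt q = (h * (p.1%:R - q.1%:R) +i* (h * (p.2%:R - q.2%:R)))%C *: 'e_i0.
  exists (fun p : 'I_n * 'I_n => z0 + ((h * p.1%:R) +i* (h * p.2%:R))%C *: 'e_i0); split => [p|p q]; last first.
    rewrite opprD addrACA subrr add0r -scalerBl; congr (_ *: _).
    by apply: complex_eqP; rewrite /= mulrBr.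
  rewrite addrC addKr qn_delta.
  have le1 (i : 'I_n) : `|h * i%:R| < r.
    rewrite (ger0_norm (mulr_ge0 (ltW h0) (ler0n _ _))); apply: le_lt_trans (_ : h * n%:R < _).
      by rewrite ler_wpM2l ?(ltW h0) // ler_nat ltnW.
    rewrite /h (_ : r / (2 * n%:R) * n%:R = r / 2); last by field; rewrite gt_eqF.
    by rewrite ltr_pdivrMr // ltr_pMr // ltr1n.
  by rewrite cmax_lt /= !le1.
have [x hx] := choice (fun p => cover _ (ptin p)).
have xl p : (index (x p).1 l < size l)%N by rewrite index_mem; case: (hx p).
pose F p : 'I_(size l) * 'I_m.+1 := (Ordinal (xl p), inord (grid_index m m%:R^-1 0 (x p).2)).
have Finj : injective F.
  move=> p q [E1 E2]; have [pl /andP[p0 p1] pE] := hx p; have [ql /andP[q0 q1] qE] := hx q.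
  have E : (x p).1 = (x q).1 by rewrite -(nth_index (x p).1 pl) E1 nth_index.
  have {}E2 := congr1 (@nat_of_ord _) E2; rewrite !grid_inordK in E2.
  have lt1 u : u <= 1 -> (u + 0) / m%:R^-1 < m.+1%:R :> R.
    move=> u1; rewrite addr0 invrK -natr1; apply: le_lt_trans (_ : m%:R < _); last by rewrite ltrDl.
    by rewrite ler_piMl // ltW.
  have mi0 : 0 < m%:R^-1 :> R by rewrite invr_gt0.
  have cl : `|(x p).2 - (x q).2| <= m%:R^-1.
    have ge0 u : 0 <= u -> 0 <= u + 0 :> R by rewrite addr0.
    exact: (grid_index_close mi0 (ge0 _ p0) (ge0 _ q0) (lt1 _ p1) (lt1 _ q1) E2).
  have dl : c * qn (pt q - pt p) < c * h.
    apply: le_lt_trans (inj _ _ (ptin p) (ptin q)) _; rewrite -pE -qE.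
    apply: le_lt_trans (lipA _ _ _ _) _.
    - by apply: onl; rewrite ?p0.
    - by apply: onl; rewrite ?q0.
    rewrite E opprD addrACA subrr add0r -scalerBl -rmorphB.
    apply: le_lt_trans (ler_wpM2l (ltW A0) (qnZ _ _)) _.
    apply: le_lt_trans (_ : A * (m%:R^-1 * L) < _).
      apply: ler_wpM2l; first exact: ltW.
      by apply: ler_pM; [exact: normr_ge0|exact: qn_ge0|rewrite distrC|exact: hL].
    rewrite /h mE natrM invfM.
    rewrite (_ : A * (S%:R^-1 / n%:R * L) = (A * L) / S%:R / n%:R); last by ring.
    rewrite (_ : c * (r / (2 * n%:R)) = c * r / 2 / n%:R); last by field; rewrite gt_eqF.
    rewrite ltr_pM2r ?invr_gt0 // ltr_pdivrMr ?ltr0n //.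
    have := hS; rewrite -lerBrDr ler_pdivrMr ?mulr_gt0 //.
    have := mulr_gt0 c0 r0; move: (c * r) => u; rewrite -(mulrA 2 A); move: (A * L) (S%:R) => v w u0 h1; lra.
  move: dl; rewrite ltr_pM2l // ptB qn_delta cmax_lt /= !(normrM h) (gtr0_norm h0) -{2 4}[h]mulr1 !(ltr_pM2l h0) => /andP[l1 l2].
  have := mod_close (T := 1%N) l1; have := mod_close (T := 1%N) l2; rewrite !modn1.
  by move: l1 l2; case: (p) (q) => [x1 x2] [y1 y2] _ _ /= /(_ erefl)/val_inj -> /(_ erefl)/val_inj ->.
have := leq_card F Finj; rewrite !card_prod !card_ord leqNgt => /negP; apply.
rewrite mE; apply: leq_ltn_trans (_ : size l * (S.+1 * n) < _)%N.
  by rewrite leq_mul2l mulSn -add1n leq_add2r -(ltr_nat R) n0 orbT.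
by rewrite mulnA ltn_pmul2r -?(ltr_nat R) // ltr_nat nE.
Qed.
End Sard.

(** * Choice of the domain *)

Section Hull.
Variables (R : realType) (d : nat).
Local Notation C := (Cx R).
Local Notation Cd := (Cd R d).

Definition segs (l : seq (Cd * Cd)) : set Cd := [set z | exists2 ab, ab \in l & seg ab.1 ab.2 z].

Lemma segs_cons ab l : segs (ab :: l) = seg ab.1 ab.2 `|` segs l.
Proof.
apply/seteqP; split => z.
  by move=> [cd]; rewrite inE => /predU1P[->|cl] h; [left|right; exists cd].
move=> [h|[cd cl h]]; first by exists ab; rewrite ?mem_head.
by exists cd; rewrite ?inE ?cl ?orbT.
Qed.

(** The reachable points form an open and relatively closed set. The polyline is kept as an
    unordered list of segments with connected union, which is all that is asked of it later. *)
Lemma polyline (Om : set Cd) x0 : open Om -> connected Om -> Om x0 -> forall z, Om z ->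
  exists l, [/\ segs l `<=` Om, connected (segs l), segs l x0 & segs l z].
Proof.
move=> oO cO Ox0; pose A := [set z | Om z /\ exists l, [/\ segs l `<=` Om, connected (segs l), segs l x0 & segs l z]].
suff AE : A = Om by move=> z; rewrite -{1}AE => -[].
have ext z w r : 0 < r -> (forall v, qn (v - z) < r -> Om v) -> A z -> qn (w - z) < r -> A w.
  move=> r0 hr [Oz [l [lO cl lx lz]]] wr; split; first exact: hr.
  exists ((z, w) :: l); rewrite segs_cons; split.
  - move=> v [/= h|/lO//]; apply: hr; apply: le_lt_trans (seg_qn h _ _) wr => //.
    by rewrite subrr qn0 qn_ge0.
  - apply: connectedU => //; last exact: connected_seg.
    by exists z; split => //=; exact: seg_start.
  - by right.
  - by left; exact: seg_end.
apply: connected_open_closed => //.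
- exists x0; split => //; exists [:: (x0, x0)].
  have E : segs [:: (x0, x0)] = seg x0 x0.
    by rewrite segs_cons (_ : segs [::] = set0) ?setU0 //; apply/seteqP; split => // z [].
  rewrite E; split; [|exact: connected_seg|exact: seg_start|exact: seg_start].
  by move=> v [t _ <-]; rewrite subrr scaler0 addr0.
- by move=> z [].
- apply/open_Cd => z Az; have [Oz _] := Az; have /open_Cd/(_ z Oz)[r r0 hr] := oO.
  by exists r => // w; exact: ext Az.
- move=> z Oz /closure_Cd cz; have /open_Cd/(_ z Oz)[r r0 hr] := oO.
  have r2 : 0 < r / 2 by rewrite divr_gt0.
  have [w Aw wz] := cz _ r2; apply: (ext w z (r / 2)) => //; last by rewrite qnB_sym.
  by move=> v vw; apply: hr; have := qn_tri v w z; move: vw wz; clear; lra.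
Qed.

(** Finitely many closed cubes inside [Om] cover [K], and each is tied to [x0] by a polyline. *)
Lemma connected_hull (Om K : set Cd) x0 : open Om -> connected Om -> Om x0 -> compact K -> K `<=` Om ->
  exists A, [/\ compact A, connected A, A `<=` Om, K `<=` A & A x0].
Proof.
move=> oO cO Ox0 cK KO.
have H z : exists rl : R * seq (Cd * Cd), Om z -> [/\ 0 < rl.1, forall w, qn (w - z) <= rl.1 -> Om w &
    [/\ segs rl.2 `<=` Om, connected (segs rl.2), segs rl.2 x0 & segs rl.2 z]].
  have [Oz|nOz] := pselect (Om z); last by exists (0, [::]).
  have [l hl] := polyline oO cO Ox0 Oz; have /open_Cd/(_ z Oz)[r r0 hr] := oO.
  exists (r / 2, l) => _; split => //=; first by rewrite divr_gt0.
  by move=> w h; apply: hr; move: h r0; clear; lra.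
have [rl hrl] := choice H.
have [|s sK hs] := compact_finite_cover (rho := fun z => (rl z).1) cK.
  by move=> z /KO/hrl[].
pose B z : set Cd := segs (rl z).2 `|` [set w | qn (w - z) <= (rl z).1].
have hB z : z \in s -> [/\ compact (B z), connected (B z), B z `<=` Om & B z x0].
  move=> /sK/KO Oz; have [r0 rO [lO cl lx lz]] := hrl z Oz; split.
  - apply: compactU; [exact: compact_segs|exact: compact_cube_at].
  - apply: connectedU => //; last exact: connected_ccube.
    by exists z; split => //=; rewrite subrr qn0 ltW.
  - by move=> w [/lO//|/rO].
  - by left.
exists (\bigcup_(A in [set A | A \in [set x0] :: [seq B z | z <- s]]) A); split.
- apply: finite_compact_union => A; rewrite inE => /predU1P[->|/mapP[z /hB[h _ _ _] ->]] //.
  exact: compact_set1.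
- apply: bigcup_connected.
    by exists x0 => A; rewrite /= inE => /predU1P[->|/mapP[z /hB[_ _ _ h] ->]].
  move=> A; rewrite /= inE => /predU1P[->|/mapP[z /hB[_ h _ _] ->]] //; exact: connected1.
- by move=> w [A]; rewrite /= inE => /predU1P[-> -> //|/mapP[z /hB[_ _ h _] ->]] /h.
- move=> w /hs[z zs wz]; exists (B z); first by rewrite /= inE map_f ?orbT.
  by right; exact: ltW.
- by exists [set x0] => //=; rewrite inE eqxx.
Qed.

Lemma closure_bounded (Om : set Cd) M : (forall z, Om z -> qn z <= M) -> forall z, closure Om z -> qn z <= M.
Proof.
move=> h z /closure_Cd cz; rewrite leNgt; apply/negP => Mz.
have [w Ow wz] := cz (qn z - M) ltac:(by rewrite subr_gt0).
have := h w Ow; have := qn_tri z w 0; rewrite !subr0 (qnB_sym z w); move: wz; clear; lra.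
Qed.

Lemma compact_closure_bounded (Om : set Cd) M : (forall z, Om z -> qn z <= M) -> compact (closure Om).
Proof. move=> /closure_bounded; apply: closed_bounded_compact; exact: closed_closure. Qed.

(** For closedness, a limit point outside [Om] would be a boundary point with points of the core
    closer than [eta]. *)
Lemma compact_core (Om : set Cd) M (eta : R) : open Om -> (forall z, Om z -> qn z <= M) -> 0 < eta ->
  compact [set z | Om z /\ forall b, boundary Om b -> eta <= qn (z - b)].
Proof.
move=> oO hM eta0; apply: (closed_bounded_compact (M := M)) => [|z [/hM]//].
apply/closed_Cd => z hz.
have clz : closure Om z by apply/closure_Cd => r /hz[w [Ow _] wz]; exists w.
have Oz : Om z.
  apply: contrapT => nOz; have [w [_ hw] wz] := hz eta eta0.
  have := hw z; rewrite leNgt wz /=; move=> /(_ _)/negP; apply => //; split => //.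
  by move=> /interior_Cd[r r0 hr]; apply: nOz; apply: hr; rewrite subrr qn0.
split => // b bb; rewrite leNgt; apply/negP => h.
have [w [_ hw] wz] := hz (eta - qn (z - b)) ltac:(by rewrite subr_gt0).
by have := hw b bb; have := qn_tri w z b; move: wz; clear; lra.
Qed.

Lemma qn_sq_le (v w : Cd) : qn (v - w) ^+ 2 <= \sum_j sqmod (v 0 j - w 0 j).
Proof.
have S0 : 0 <= \sum_j sqmod (v 0 j - w 0 j) by apply: sumr_ge0 => j _; exact: sqmod_ge0.
rewrite -[leRHS]sqr_sqrtr // ler_pXn2r ?nnegrE ?qn_ge0 ?sqrtr_ge0 //; exact: qn_le_edist.
Qed.
End Hull.

(** * Nondegenerate points, and assembly of the domain *)

Section Assembly.
Variables (R : realType) (d : nat).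
Local Notation C := (Cx R).
Local Notation Cd := (Cd R d).
Variables (Om U : set Cd) (Phi : Cd -> Cd) (M : R).
Hypothesis d0 : (0 < d)%N.
Hypothesis oO : open Om.
Hypothesis cO : connected Om.
Hypothesis hM : forall z, Om z -> qn z <= M.
Hypothesis oU : open U.
Hypothesis OU : closure Om `<=` U.
Hypothesis hP : forall j : 'I_d, holomorphic_on U (fun z => Phi z 0 j).
Hypothesis iP : interior (Phi @` Om) !=set0.

Lemma OmU : Om `<=` U. Proof. by move=> z Oz; apply: OU; exact: subset_closure. Qed.

(** If the Jacobian vanished near [z], it would vanish on [Om] by the identity theorem and on the
    compact closure by continuity; Sard's theorem would then forbid interior points of the image. *)
Lemma nondegenerate_dense z (s : R) : Om z -> 0 < s ->
  exists2 w, qn (w - z) < s & \det (jac Phi w) != 0.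
Proof.
move=> Oz s0; apply: contrapT => H.
have hd := holo_det_jac oU hP.
have zero w : Om w -> \det (jac Phi w) = 0.
  move=> Ow; apply: (identity_theorem oO cO (holo_sub OmU hd) Oz s0 _ Ow) => v vz.
  by apply/eqP; apply: contrapT => /negP h; apply: H; exists v.
have zero' w : closure Om w -> \det (jac Phi w) = 0.
  move=> cw; apply: eq0_normc; apply/eqP; rewrite eq_le normc_ge0 andbT leNgt; apply/negP => n0.
  have /continuous_CdC/(_ _ n0)[r r0 hr] := holo_cont hd (OU cw).
  have /closure_Cd/(_ r r0)[v Ov vw] := cw.
  by have := hr v vw; rewrite (zero v Ov) sub0r normcN ltxx.
have [y /interior_Cd[rho rho0 hrho]] := iP.
have r2 : 0 < rho / 2 by rewrite divr_gt0.
apply: (sard oU hP (compact_closure_bounded hM) OU zero' r2 (w0 := y)) => v vy.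
have [|z' Oz' E] := hrho v; first by apply: le_lt_trans vy _; rewrite ltr_pdivrMr // ltr_pMr // ltr1n.
by exists z' => //; exact: subset_closure.
Qed.

(** Otherwise this coordinate of Phi would be constant by the maximum principle, although the image
    contains two points that differ in it. *)
Lemma no_max (j : 'I_d) z : Om z -> exists2 w, Om w & normc (Phi z 0 j) < normc (Phi w 0 j).
Proof.
move=> Oz; apply: contrapT => H.
have cst := max_principle oO cO (holo_sub OmU (hP j)) Oz (fun w Ow =>
  ltac:(by rewrite leNgt; apply/negP => h; apply: H; exists w)).
have [y /interior_Cd[rho rho0 hrho]] := iP.
have [|z1 Oz1 E1] := hrho y; first by rewrite subrr qn0.
have [|z2 Oz2 E2] := hrho (y + (rho / 2)%:C%C *: 'e_j).
  rewrite addrC addKr qn_delta cmax_lt /= normr0 rho0 andbT gtr0_norm ?divr_gt0 //.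
  by rewrite ltr_pdivrMr // ltr_pMr // ltr1n.
have := cst z2 Oz2; rewrite -(cst z1 Oz1) E1 E2 !mxE !eqxx mulr1 => /eqP.
rewrite -subr_eq0 addrAC subrr add0r => /eqP[] /eqP; rewrite mulf_eq0 gt_eqF //= invr_eq0 pnatr_eq0 //.
Qed.

Lemma separated_cube z la : Om z -> Phi z <> Phi la -> exists2 r : R, 0 < r &
  forall w, qn (w - z) < r -> Om w /\ Phi w <> Phi la.
Proof.
move=> Oz ne.
have [j nej] : exists j, Phi z 0 j != Phi la 0 j.
  by apply: contrapT => H; apply: ne; apply/rowP => j; apply/eqP; apply: contrapT => /negP h; apply: H; exists j.
have n0 : 0 < normc (Phi z 0 j - Phi la 0 j) by rewrite normc_gt0 subr_eq0.
have /continuous_CdC/(_ _ n0)[r r0 hr] := holo_cont (hP j) (OmU Oz).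
have /open_Cd/(_ z Oz)[s s0 hs] := oO.
exists (Num.min r s); first by rewrite lt_min r0.
move=> w; rewrite lt_min => /andP[wr ws]; split; first exact: hs.
by move=> E; have := hr w wr; rewrite E normcB_sym ltxx.
Qed.

Lemma holo_shift (v : Cd) : forall j : 'I_d, holomorphic_on U (fun z => (Phi z - v) 0 j).
Proof.
move=> j; have := holoB (hP j) (@holo_cst _ _ U (v 0 j)).
by under [in X in _ -> X]eq_fun do rewrite !mxE.
Qed.

Lemma phi_bounded : exists B : R, forall (j : 'I_d) z, Om z -> normc (Phi z 0 j) <= B.
Proof.
have H j : exists B : R, 0 < B /\ forall z, Om z -> normc (Phi z 0 j) <= B.
  have [|B B0 hB] := @compact_bound _ _ _ (fun w => normc (Phi w 0 j)) (compact_closure_bounded hM).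
    by move=> z /OU Uz; apply: continuous_normc; exact: holo_cont (hP j) Uz.
  by exists B; split => // z Oz; apply: hB; exact: subset_closure.
have [B hB] := choice H; exists (\sum_j B j) => j z Oz.
apply: le_trans (proj2 (hB j) z Oz) _; rewrite (bigD1 j) //= lerDl sumr_ge0 // => i _.
by apply: ltW; case: (hB i).
Qed.

Lemma trivial_subdomain (K : set Cd) : Om !=set0 -> compact K -> K `<=` Om -> exists Omh : set Cd,
  [/\ is_domain Omh, property1 Omh, property2 Omh, Omh `<=` Om &
   K `<=` Omh /\ Vstar_trivial (fun j z => Phi z 0 j) Omh].
Proof.
move=> [x0 Ox0] cK KO.
have [C1 [cC1 conC1 C1O KC1 C1x0]] := connected_hull oO cO Ox0 cK KO.
pose j0 : 'I_d := Ordinal d0.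
have [z1 C1z1 hz1] := compact_max (g := fun w => normc (Phi w 0 j0)) (ex_intro _ x0 C1x0) cC1
  (fun z h => continuous_normc (holo_cont (hP j0) (OmU (C1O z h)))).
(* Around [l1] the modulus of this coordinate exceeds its maximum over the hull [C1], so no point
   there shares its Phi-value with a point of [C1]. *)
have [l1 Ol1 gt1] := no_max j0 (C1O _ C1z1).
have [s [s0 hs]] : exists s : R, 0 < s /\ forall w, qn (w - l1) < s -> Om w /\ normc (Phi z1 0 j0) < normc (Phi w 0 j0).
  have /open_Cd/(_ l1 Ol1)[r r0 hr] := oO.
  have e0 : 0 < normc (Phi l1 0 j0) - normc (Phi z1 0 j0) by rewrite subr_gt0.
  have /continuous_CdC/(_ _ e0)[r' r'0 hr'] := holo_cont (hP j0) (OmU Ol1).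
  exists (Num.min r r'); split; first by rewrite lt_min r0.
  move=> w; rewrite lt_min => /andP[w1 w2]; split; first exact: hr.
  have := hr' w w2; have := normcB_tri (Phi l1 0 j0) (Phi w 0 j0); rewrite normcB_sym.
  by move: (normc _) (normc _) (normc _) (normc _) => a b c e; lra.
have [l0 l0s dl0] := nondegenerate_dense Ol1 s0.
have [Ol0 _] := hs l0 l0s.
have [r0 [c0 [r00 c00] inj]] := nondeg_inj oU hP (OmU Ol0) dl0.
(* Halved so that the cube about [l0], dilated by [t < 2], stays within the range of injectivity and
   within the cube of radius [s] about [l1]. *)
pose r := Num.min r0 (s - qn (l0 - l1)) / 2.
have r_gt0 : 0 < r by rewrite divr_gt0 // lt_min r00 subr_gt0.
have hr w : qn (w - l0) < 2 * r -> qn (w - l0) < r0 /\ qn (w - l1) < s.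
  rewrite /r mulrC divfK // lt_min => /andP[h1 h2]; split => //.
  by have := qn_tri w l0 l1; lra.
have hr1 w : qn (w - l0) < r -> qn (w - l0) < 2 * r by lra.
have [l [lO conl lx0 ll0]] := polyline oO cO Ox0 Ol0.
have [|la lar hla] := @curve_avoid _ _ U Phi l l0 r c0 d0 oU hP _ r_gt0 c00
    (fun w w' h h' => inj w w' (proj1 (hr w (hr1 w h))) (proj1 (hr w' (hr1 w' h')))).
  by move=> ab abl z hz; apply: OmU; apply: lO; exists ab.
pose K0 := C1 `|` segs l.
have cK0 : compact K0 by apply: compactU => //; exact: compact_segs.
have conK0 : connected K0 by apply: connectedU => //; exists x0.
have K0O : K0 `<=` Om by move=> z [/C1O//|/lO].
have K0la z : K0 z -> Phi z <> Phi la.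
  move=> [C1z E|[ab abl hz]]; last exact: hla abl hz.
  have [_ ] := hs la (proj2 (hr la (hr1 la lar))); rewrite -E ltNge.
  by rewrite hz1.
have H z : exists rz : R, K0 z -> 0 < rz /\ forall w, qn (w - z) <= 2 * rz -> Om w /\ Phi w <> Phi la.
  have [Kz|nKz] := pselect (K0 z); last by exists 0.
  have [rz rz0 hrz] := separated_cube (K0O z Kz) (K0la z Kz).
  (* A third, so that even the closed cube of twice the radius lies strictly inside the separating
     one. *)
  exists (rz / 3) => _; split; first by rewrite divr_gt0.
  by move=> w h; apply: hrz; lra.
have [rz hrz] := choice H.
have [|sq sqK hsq] := compact_finite_cover (rho := rz) cK0; first by move=> z /hrz[].
(* Only the cube about [l0] may contain points with value [Phi la]; all others come from
   [separated_cube] and keep avoiding it after dilation. *)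
pose L := (l0, r) :: [seq (z, rz z) | z <- sq].
have LK c : c \in L -> K0 c.1 /\ 0 < c.2.
  rewrite inE => /predU1P[->|/mapP[z zs ->]] /=; first by split => //; right.
  by split; [exact: sqK|case: (hrz z (sqK z zs))].
have [t /andP[t1 t2] gen] := generic_dilate (fun c cL => proj2 (LK c cL)).
pose D := cubes (dilate t L).
have t0 : 0 < t by apply: lt_trans t1.
have dL c : c \in dilate t L -> K0 c.1 /\ 0 < c.2.
  by move=> /mapP[c' /LK[h1 h2] ->]; split => //=; rewrite mulr_gt0.
have K0D : K0 `<=` D.
  move=> z /hsq[x xs zx]; have [rx _] := hrz x (sqK x xs).
  exists (x, t * rz x).
    by apply/mapP; exists (x, rz x) => //; rewrite inE map_f ?orbT.
  by apply: lt_trans zx _; rewrite /= ltr_pMl.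
have Dcases z : D z -> qn (z - l0) < 2 * r \/ exists2 x, x \in sq & qn (z - x) <= 2 * rz x.
  move=> [c /mapP[c']]; rewrite inE => /predU1P[->|/mapP[x xs ->]] -> /= h.
    by left; apply: lt_trans h _; rewrite ltr_pM2r.
  right; exists x => //; apply: ltW; apply: lt_trans h _; rewrite ltr_pM2r //.
  by case: (hrz x (sqK x xs)).
have DO : D `<=` Om.
  move=> z /Dcases[/hr[_ /hs[]//]|[x xs /(proj2 (hrz x (sqK x xs)))[]//]].
exists D; split.
- split; first exact: open_cubes.
  split; last by exists x0; apply: K0D; left.
  by apply: (connected_cubes conK0) => //; exists x0; left.
- by apply: property1_cubes => // c /dL[].
- by apply: property2_cubes => // c /dL[].
- exact: DO.
- split; first by move=> z /KC1 h; apply: K0D; left.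
  pose Psi w := Phi w - Phi la.
  (* The finitely many closed doubled cubes are compact and avoid the value [Phi la], so Phi keeps a
     positive distance [de] from it on all of them. *)
  have [de de0 hde] : exists2 de : R, 0 < de & forall x z, x \in sq -> qn (z - x) <= 2 * rz x -> de <= qn (Psi z).
    have G x : exists m : R, x \in sq -> 0 < m /\ forall z, qn (z - x) <= 2 * rz x -> m <= qn (Psi z).
      have [xs|nxs] := boolP (x \in sq); last by exists 0.
      have [_ hx] := hrz x (sqK x xs).
      have [|z /= /hx[_ nz]|m m0 hm] := @compact_min_gt0 _ _ _ (fun w => qn (Psi w)) (@compact_cube_at R d x (2 * rz x)).
      - by move=> z /= /hx[/OmU Uz _]; exact: (continuous_qnPhi (holo_shift (Phi la)) Uz).
      - rewrite lt_neqAle qn_ge0 andbT eq_sym; apply/eqP => /qn_eq0 /eqP.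
        by rewrite subr_eq0 => /eqP.
      by exists m.
    have [mm hmm] := choice G.
    have [|de de0 hde] := @finite_min _ _ sq mm; first by move=> x /hmm[].
    by exists de => // x z xs zx; apply: le_trans (hde x xs) _; have [_ h] := hmm x xs; exact: h.
  have Ola : Om la by case: (hs la (proj2 (hr la (hr1 la lar)))).
  have de2 : 0 < de / 2 by rewrite divr_gt0.
  have /continuous_CdR/(_ _ de2)[r3 r30 hr3] := continuous_qnPhi (holo_shift (Phi la)) (OmU Ola).
  pose r4 := Num.min r3 (r - qn (la - l0)).
  have r40 : 0 < r4 by rewrite lt_min r30 subr_gt0.
  have hr4 w : qn (w - la) < r4 -> qn (Psi w) < de / 2 /\ qn (w - l0) < r.
    rewrite lt_min => /andP[/hr3 h1 h2]; split; last by have := qn_tri w la l0; lra.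
    by move: h1; rewrite subrr qn0 subr0 ger0_norm ?qn_ge0.
  have [B hB] := phi_bounded.
  apply: (Vstar_trivial_of_peak (M := M) (B := B) (z0 := la) (r0 := r4)) => //.
  - exact: open_cubes.
  - by apply: (connected_cubes conK0) => //; exists x0; left.
  - by move=> z /DO/hM.
  - by move=> j; apply: holo_sub (hP j) => z /DO/OmU.
  - by move=> j z /DO/hB.
  - move=> w /hr4[_ wl]; exists (l0, t * r).
      by apply/mapP; exists (l0, r); rewrite ?mem_head.
    by apply: lt_trans wl _; rewrite /= ltr_pMl.
  move=> mu /hr4[m1 m2] rr rr0.
  (* For [z] in the cube about [l0], injectivity gives distance at least [c0 * rr] between the
     values; in the other cubes the gap [de] loses at most [de / 2] when [Phi la] is replaced by
     [Phi mu]. *)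
  exists (Num.min (de / 2) (c0 * rr) ^+ 2).
    by rewrite exprn_gt0 // lt_min de2 mulr_gt0.
  move=> z Dz zr; apply: le_trans (qn_sq_le _ _).
  rewrite ler_pXn2r ?nnegrE ?qn_ge0 //; last by rewrite le_min (ltW de2) mulr_ge0 // ltW.
  have [z2|[x xs zx]] := Dcases z Dz.
    rewrite ge_min; apply/orP; right.
    apply: le_trans (inj mu z _ _); first by rewrite ler_wpM2l // ltW.
      by case: (hr mu (hr1 mu m2)).
    by case: (hr z z2).
  rewrite ge_min; apply/orP; left.
  have := hde x z xs zx; have := qn_tri (Phi z) (Phi mu) (Phi la); rewrite -/(Psi z) -/(Psi mu).
  by move: m1; lra.
Qed.
End Assembly.

Theorem theorem7p2 (R : realType) (d : nat) (Omega : set (Cd R d))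
    (Phi : Cd R d -> Cd R d) (U : set (Cd R d)) :
  is_domain Omega -> bounded_dom Omega -> property1 Omega -> property2 Omega ->
  open U -> closure Omega `<=` U ->
  (forall j : 'I_d, holomorphic_on U (fun z => Phi z 0 j)) ->
  interior (Phi @` Omega) !=set0 ->
  forall eps : R, 0 < eps ->
  exists Omegah : set (Cd R d),
    [/\ is_domain Omegah, property1 Omegah, property2 Omegah
      & closure Omegah `<=` U] /\
    (forall z, (Omegah z /\ ~ Omega z) \/ (Omega z /\ ~ Omegah z) ->
               eps_nbhd (boundary Omega) eps z) /\
    Vstar_trivial (fun j z => Phi z 0 j) Omegah.
Proof.
move=> [oO [cO O0]] [M hM] p1 p2 oU OU hP iP eps eps0.
have {}hM z : Omega z -> qn z <= M.
  by move=> /hM; apply: le_trans; rewrite -[X in qn X]subr0; exact: qn_le_edist.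
(* In dimension 0 the space is a single point and every function is a multiple of 1, so Omega itself
   serves. *)
have [d0|d0] := posnP d.
  exists Omega; split => //; split; first by move=> z [[]|[]].
  move=> T [bT _]; have b1 := bergman1 hM.
  exists (T (fun=> 1) 0) => f bf z Oz.
  have F (i : 'I_d) : False by case: i => k; rewrite d0.
  have z0 (w : Cd R d) : w = 0 by apply/rowP => i; case: (F i).
  have fE w : Omega w -> f w = f 0 * 1 by move=> _; rewrite mulr1 (z0 w).
  by rewrite (eqT bT bf (bergmanZ (f 0) b1) fE Oz) (TZ hM bT _ b1 Oz) (z0 z) mulrC.
(* [edist] is at most [2 * d] times [qn], so a point that fails to be at [qn]-distance eps/(2d) from
   the boundary is within [eps] of it. *)
have e0 : 0 < eps / (2 * d%:R) by rewrite divr_gt0 // mulr_gt0 // ltr0n.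
have [D [dD q1 q2 DO [KD tV]]] := trivial_subdomain d0 oO cO hM oU OU hP iP O0
  (compact_core oO hM e0) (fun z h => proj1 h).
exists D; split; first by split => //; apply: subset_trans OU; exact: closure_subset.
split => // z [[Dz nOz]|[Oz nDz]]; first by case: nOz; exact: DO.
apply: contrapT => nb; apply: nDz; apply: KD; split => // b bb.
rewrite leNgt; apply/negP => zb; apply: nb; exists b => //.
apply: le_lt_trans (edist_le _ _) _.
by rewrite mulrC -ltr_pdivlMr // mulr_gt0 // ltr0n.
Qed.
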